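(* Let $y_0\in H^1(0,1)$ with $y_0(0)=0$ and let $y_1\in L^2(0,1)$. For every $T\in[2,+\infty]$ and every $\lambda\in[0,1]$ (with $\lambda<1$ if $T=+\infty$), the problem $\mathbf{(OCP)}_\lambda^T$ (defined in the context) has a unique optimal control, denoted by $u_\lambda^T$. Moreover: 1. Assume that $T=2n$ for some $n\in\mathbb{N}^*$. (1a) If $\lambda=1$, then $u_1^T$ is $2$-anti-periodic (and thus $4$-periodic), that is, $$u_1^T(t+2k)=(-1)^k u_1^T(t)$$ for every $t\in(0,2)$ and every $k\in\mathbb{N}$ such that $t+2k\le T$, and $$u_1^T(t)=\begin{cases}\frac{1}{2n}\left(y_0'(1-t)-y_1(1-t)\right), & t\in(0,1),\\ \frac{1}{2n}\left(y_0'(t-1)+y_1(t-1)\right), & t\in(1,2).\end{cases}$$ (1b) If $0<\lambda<1$, then $u_\lambda^T$ is the sum of an exponentially decaying term and of an exponentially increasing one. More precisely, defining $z_\lambda\in(-1,0)$ by $$z_\lambda=\frac{-\lambda}{2-\lambda+2\sqrt{1-\lambda}},$$ we have $$u_\lambda^T(t+2k)=z_\lambda^k f_+(t)+\frac{1}{z_\lambda^k}f_-(t)$$ for every $t\in(0,2)$ and every $k\in\mathbb{N}$ such that $t+2k\le T$, where $$f_+(t)=\frac{1+z_\lambda}{1-z_\lambda^{2n}}F(t-1),\qquad f_-(t)=\frac{1+\frac{1}{z_\lambda}}{1-\frac{1}{z_\lambda^{2n}}}F(t-1),$$ with $F\in L^2(-1,1)$ defined by $$F(t)=\begin{cases}\frac12\left(y_0'(-t)-y_1(-t)\right),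 & t\in(-1,0),\\ \frac12\left(y_0'(t)+y_1(t)\right), & t\in[0,1).\end{cases}$$ 2. Assume that $T=+\infty$ and $\lambda<1$. (2a) If $\lambda=0$, then $u_0^\infty$ coincides along the time interval $[0,2]$ with the optimal control $u_1^2$, solution of $\mathbf{(OCP)}_1^2$. (2b) If $0<\lambda<1$, then, with $z_\lambda$ given by the same formula as in (1b), $u_\lambda^\infty$ is given along the time interval $[0,2]$ by $$u_\lambda^\infty(t)=\begin{cases}\frac{1+z_\lambda}{2}\left(y_0'(1-t)-y_1(1-t)\right), & t\in(0,1),\\ \frac{1+z_\lambda}{2}\left(y_0'(t-1)+y_1(t-1)\right), & t\in(1,2),\end{cases}$$ and moreover $$u_\lambda^\infty(t+2k)=z_\lambda^k u_\lambda^\infty(t)$$ for every $t\in(0,2)$ and every $k\in\mathbb{N}^*$. The corresponding optimal state $y_\lambda^\infty$ decays exponentially, in the sense that there exists $C_0>0$, not depending on the initial data $(y_0,y_1)$, such that $$\int_0^1\left(\left(\partial_x y_\lambda^\infty(t+2k,x)\right)^2+\left(\partial_t y_\lambda^\infty(t+2k,x)\right)^2\right)dx\le C_0|z_\lambda|^{2k}\int_0^1\left(y_0'(x)^2+y_1(x)^2\right)dx$$ for every $t\in(0,2)$ and every $k\in\mathbb{N}^*$.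
   Context: $\mathbb{N}=\{0,1,2,\dots\}$ and $\mathbb{N}^*=\{1,2,\dots\}$. Identities between $L^2$ functions are understood almost everywhere. The controlled system is the one-dimensional wave equation with homogeneous Dirichlet condition at $x=0$ and Neumann control at $x=1$: $$\partial_{tt}y(t,x)=\partial_{xx}y(t,x)\ \ (x\in(0,1)),\qquad y(t,0)=0,\qquad \partial_x y(t,1)=u(t).$$ Given $y_0\in H^1(0,1)$ with $y_0(0)=0$, $y_1\in L^2(0,1)$ and a square-integrable control $u$ on the time interval $(0,T)$, there is a unique (finite-energy) solution $y$, continuous in time with values in $H^1(0,1)$ and $C^1$ in time with values in $L^2(0,1)$, such that $y(0,\cdot)=y_0$ and $\partial_t y(0,\cdot)=y_1$. For $\lambda\in[0,1]$ and $T\in[2,+\infty)$, $\mathbf{(OCP)}_\lambda^T$ is the problem of finding $u\in L^2(0,T)$ minimizing $$J_\lambda^T(u)=\int_0^T\left((1-\lambda)\left(\partial_x y(t,0)\right)^2+\lambda u(t)^2\right)dt$$ among all $u\in L^2(0,T)$ such that the solution $y$ with initial data $(y_0,y_1)$ satisfies $y(T,\cdot)=0$ and $\partial_t y(T,\cdot)=0$. For $T=+\infty$, $\mathbf{(OCP)}_\lambda^\infty$ is the problem of minimizing $J_\lambda^\infty(u)$ (same integral over $(0,+\infty)$) over $u\in L^2(0,+\infty)$, without any terminal constraint. The optimal state $y_\lambda^T$ is the solution associated with $u_\lambda^T$. *)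

(* Defs.v *)
From HB Require Import structures.
From mathcomp Require Import all_boot all_order all_algebra.
From mathcomp Require Import all_classical all_reals all_analysis.
Set Implicit Arguments.
Unset Strict Implicit.
Unset Printing Implicit Defensive.
Import Order.TTheory GRing.Theory Num.Theory.
Import numFieldNormedType.Exports.
Local Open Scope classical_set_scope.
Local Open Scope ring_scope.

(* Elements of L^2 are represented by functions and compared almost everywhere.
   Spatial and temporal domains are taken closed; endpoints are null sets. *)
Definition L2 (R : realType) (D : set R) (f : R -> R) : Prop :=
  measurable_fun D f /\
  (@lebesgue_measure R).-integrable D (fun x => (f x ^+ 2)%:E).

(* H^1(0,1): [f] is the continuous representative and [df] a representative of
   its weak derivative, so that boundary values of [f] are genuine values. *)
Definition H1 (R : realType) (f df : R -> R) : Prop :=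
  L2 `[0, 1] df /\
  forall x, 0 <= x <= 1 ->
    f x = f 0 + \int[@lebesgue_measure R]_(s in `[0, x]) df s.

Definition sqdist (R : realType) (f g : R -> R) : R :=
  \int[@lebesgue_measure R]_(x in `[0, 1]) (f x - g x) ^+ 2.

(* [0, T] for finite [T], and [0, +oo[ for [T = +oo]. *)
Definition time_itv (R : realType) (T : \bar R) : set R :=
  [set t | 0 <= t /\ (t%:E <= T)%E].

Definition L2_continuous (R : realType) (T : \bar R) (f : R -> R -> R) : Prop :=
  forall t, time_itv T t ->
    sqdist (f s) (f t) @[s --> within (time_itv T) (nbhs t)] --> (0 : R).

Definition L2_differentiable (R : realType) (T : \bar R) (f df : R -> R -> R) :
    Prop :=
  forall t, time_itv T t ->
    sqdist (fun x => (f s x - f t x) / (s - t)) (df t)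
      @[s --> within (time_itv T) t^'] --> (0 : R).

(* A function y(t, x) with its partial derivatives; for each t, the derivatives
   are only relevant up to a null set of x. *)
Record trajectory (R : realType) := Trajectory {
  pos : R -> R -> R ;
  pos_x : R -> R -> R ;
  pos_t : R -> R -> R
}.

(* y belongs to C([0,T]; H^1(0,1)) and to C^1([0,T]; L^2(0,1)). *)
Definition finite_energy (R : realType) (T : \bar R) (y : trajectory R) : Prop :=
  [/\ forall t, time_itv T t ->
        H1 (pos y t) (pos_x y t) /\ L2 `[0, 1] (pos_t y t),
      L2_continuous T (pos y),
      L2_continuous T (pos_x y),
      L2_continuous T (pos_t y) &
      L2_differentiable T (pos y) (pos_t y)].

(* The equation y_tt = y_xx with y_x(., 0) = g and y_x(., 1) = u, multiplied by
   v(x), integrated by parts over (0, 1) and integrated in time over (0, t). *)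
Definition green_identity (R : realType) (y : trajectory R) (g u : R -> R)
    (v dv : R -> R) (t : R) : Prop :=
  \int[@lebesgue_measure R]_(x in `[0, 1]) (pos_t y t x * v x) -
  \int[@lebesgue_measure R]_(x in `[0, 1]) (pos_t y 0 x * v x) =
  \int[@lebesgue_measure R]_(s in `[0, t])
    (u s * v 1 - g s * v 0 -
     \int[@lebesgue_measure R]_(x in `[0, 1]) (pos_x y s x * dv x)).

(* Test functions vanish at the Dirichlet end, so that the boundary term at
   x = 0 is absent. *)
Definition wave_solution (R : realType) (T : \bar R) (y0 y1 u : R -> R)
    (y : trajectory R) : Prop :=
  [/\ finite_energy T y,
      forall t, time_itv T t -> pos y t 0 = 0,
      forall x, 0 <= x <= 1 -> pos y 0 x = y0 x,
      (\forall x \ae (@lebesgue_measure R), 0 <= x <= 1 ->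
         pos_t y 0 x = y1 x) &
      forall v dv, H1 v dv -> v 0 = 0 ->
        forall t, time_itv T t -> green_identity y (cst 0) u v dv t].

(* [g] is the normal trace t |-> y_x(t, 0) of a finite-energy solution.  As
   y_x(t, .) is only in L^2(0,1), this trace is given by Green's formula against
   test functions that need not vanish at 0. *)
Definition trace_x0 (R : realType) (T : \bar R) (u : R -> R)
    (y : trajectory R) (g : R -> R) : Prop :=
  (forall t, time_itv T t ->
     (@lebesgue_measure R).-integrable `[0, t] (fun s => (g s)%:E)) /\
  forall v dv, H1 v dv ->
    forall t, time_itv T t -> green_identity y g u v dv t.

Definition initial_data (R : realType) (y0 dy0 y1 : R -> R) : Prop :=
  [/\ H1 y0 dy0, y0 0 = 0 & L2 `[0, 1] y1].

(* The last clause is void when [T = +oo]. *)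
Definition feasible (R : realType) (T : \bar R) (y0 y1 u : R -> R)
    (y : trajectory R) (g : R -> R) : Prop :=
  [/\ L2 (time_itv T) u,
      wave_solution T y0 y1 u y,
      trace_x0 T u y g &
      forall r : R, T = r%:E ->
        (forall x, 0 <= x <= 1 -> pos y r x = 0) /\
        (\forall x \ae (@lebesgue_measure R), 0 <= x <= 1 -> pos_t y r x = 0)].

(* Extended-real valued: on an infinite horizon the trace [g] of a state with a
   square-integrable control need not be square integrable. *)
Definition cost (R : realType) (T : \bar R) (lambda : R) (u g : R -> R) :
    \bar R :=
  (\int[@lebesgue_measure R]_(t in time_itv T)
     ((1 - lambda) * g t ^+ 2 + lambda * u t ^+ 2)%:E)%E.

Definition optimal (R : realType) (T : \bar R) (lambda : R) (y0 y1 u : R -> R)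
    (y : trajectory R) : Prop :=
  exists2 g, feasible T y0 y1 u y g &
    forall v w h, feasible T y0 y1 v w h ->
      (cost T lambda u g <= cost T lambda v h)%E.

Definition optimal_control (R : realType) (T : \bar R) (lambda : R)
    (y0 y1 u : R -> R) : Prop :=
  exists y, optimal T lambda y0 y1 u y.

Definition zlam (R : realType) (lambda : R) : R :=
  - lambda / (2 - lambda + 2 * Num.sqrt (1 - lambda)).

Definition Fdata (R : realType) (dy0 y1 : R -> R) (t : R) : R :=
  if t < 0 then (dy0 (- t) - y1 (- t)) / 2 else (dy0 t + y1 t) / 2.

Definition fplus (R : realType) (n : nat) (lambda : R) (dy0 y1 : R -> R)
    (t : R) : R :=
  (1 + zlam lambda) / (1 - zlam lambda ^+ (2 * n)) * Fdata dy0 y1 (t - 1).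

Definition fminus (R : realType) (n : nat) (lambda : R) (dy0 y1 : R -> R)
    (t : R) : R :=
  (1 + 1 / zlam lambda) / (1 - 1 / zlam lambda ^+ (2 * n)) *
  Fdata dy0 y1 (t - 1).

(* Main.v *)
Require Import Defs.
From HB Require Import structures.
From mathcomp Require Import all_boot all_order all_algebra.
From mathcomp Require Import all_classical all_reals all_analysis.
From mathcomp Require Import measurable_realfun ring lra.
Import Order.TTheory GRing.Theory Num.Theory.
Import numFieldNormedType.Exports.
Set Implicit Arguments.
Unset Strict Implicit.
Unset Printing Implicit Defensive.
Local Open Scope classical_set_scope.
Local Open Scope ring_scope.

(** Every finite-energy solution is a superposition of two travelling waves
    reflected at [x = 0].  With a single profile [h] on [[-1, +oo)] one has
    [y_x = h (t + x) + h (t - x)] and [y_t = h (t + x) - h (t - x)]; the trace of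
    [y_x] at [x = 0] is [2 h t], the Neumann control at [x = 1] is
    [h (t + 1) + h (t - 1)], the initial data prescribe [h = Fdata] on [[-1, 1)],
    and rest at the final time [T] means [h = 0] on [(T - 1, T + 1)].

    That such a superposition is a solution ([dAlembert_solution]) rests on the
    continuity of translations in L^2 ([L2_translation_continuous]) and on Green's
    formula written with a primitive of [h] ([dAlembert_green]).  Conversely the
    relation [h (t + 1) = u t - h (t - 1)] builds a profile from any control, and
    uniqueness of the solution ([wave_solution_unique]) makes it the profile of the
    given state ([feasible_profile]).  Uniqueness is a conservation law for an
    energy one derivative below the natural one, which makes sense for weak
    solutions ([homogeneous_solution_eq0]).

    The problem thus becomes the minimization of the integral of
    [4 (1 - lambda) h t ^ 2 + lambda (h (t + 1) + h (t - 1)) ^ 2] over profiles fixed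
    on [[-1, 1)] and, for a finite horizon, beyond [T - 1].  The functional is
    quadratic, and after translating the variable of integration its first
    variation is the integral of the variation against
    [lambda h (t - 2) + (4 - 2 lambda) h t + lambda h (t + 2)].  A profile which
    cancels this expression is therefore a minimizer.  Any competitor exceeds its
    cost by exactly the cost of the variation, whence uniqueness of the control
    ([cost_expansion], [profile_optimal], [profile_unique]).

    The equation couples only the values along a chain [s, s + 2, s + 4, ...] with
    [s] in [[-1, 1)], where it is a linear recurrence with constant coefficients
    whose characteristic roots are [zlam lambda] and its inverse.  On a finite
    horizon the chain, relative to its first value, starts at 1 and must vanish at
    the first point not before [T - 1]: this selects the combination [coef] of the
    two powers, or an alternating affine sequence when the roots collide at -1,
    that is for [lambda = 1].  For [lambda = 0] the recurrence degenerates and only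
    the first value survives, in accordance with [zlam 0 = 0].  On an infinite horizon square integrability leaves
    [zlam lambda ^ k].  Summing two consecutive terms of a chain gives the stated
    controls, and the geometric decay of the profile gives that of the energy. *)

(** * Measure-preserving changes of variable *)

Section change_of_variable.
Context (R : realType).
Notation mu := (@lebesgue_measure R).
Implicit Types (D : set (measurableTypeR R)) (f : R -> R).

Section measure_preserving.
Variable phi : measurableTypeR R -> measurableTypeR R.
Hypothesis mphi : measurable_fun setT phi.
Hypothesis muphi_oc : forall a b : R,
  mu (phi @^-1` `]a, b]%classic) = mu `]a, b]%classic.

Let mphi_mixin := isMeasurableFun.Build _ _ _ _ _ mphi.
Let mphi_pack : {mfun _ >-> _} := HB.pack phi mphi_mixin.

(** The push-forward measure agrees with Lebesgue measure on the half-open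
    intervals, which determine the latter. *)
Let muphi A : measurable A -> mu (phi @^-1` A) = mu A.
Proof.
move=> mA; apply/esym.
apply: (@lebesgue_measure_unique R (pushforward mu mphi_pack)) => // X.
by case=> -[a b] /= _ <-; rewrite [RHS]muphi_oc.
Qed.

Let ge0_integral_preserving D (f : R -> \bar R) : measurable D ->
  measurable_fun D f -> (forall x, 0 <= f x)%E ->
  (\int[mu]_(x in phi @^-1` D) f (phi x) = \int[mu]_(x in D) f x)%E.
Proof.
move=> mD mf f0.
rewrite -[LHS](ge0_integral_pushforward mphi mu mD mf); last by move=> y _; exact: f0.
by apply: eq_measure_integral => A mA _; exact: muphi.
Qed.

Lemma integral_preserving D (f : R -> \bar R) : measurable D ->
  measurable_fun D f ->
  (\int[mu]_(x in phi @^-1` D) f (phi x) = \int[mu]_(x in D) f x)%E.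
Proof.
move=> mD mf; rewrite integralE [RHS]integralE.
rewrite -(ge0_integral_preserving mD (measurable_funepos mf))//.
rewrite -(ge0_integral_preserving mD (measurable_funeneg mf))//.
by congr (_ - _)%E; apply: eq_integral => x _; rewrite ?funeposE ?funenegE.
Qed.

Lemma measurable_preserving D (f : R -> R) : measurable D ->
  measurable_fun D f -> measurable_fun (phi @^-1` D) (f \o phi).
Proof.
move=> mD mf; apply: (measurable_comp mD) => //; last exact: measurable_funTS.
by move=> _ [x Dx <-].
Qed.

Lemma integrable_preserving D (f : R -> R) : measurable D ->
  mu.-integrable D (EFin \o f) ->
  mu.-integrable (phi @^-1` D) (EFin \o (f \o phi)).
Proof.
move=> mD /integrableP[mf fi]; apply/integrableP; split.
  apply/measurable_EFinP; apply: (measurable_preserving mD); exact/measurable_EFinP.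
rewrite /= (@integral_preserving D (fun x => `|(f x)%:E|)%E)//.
exact: measurableT_comp.
Qed.

Lemma L2_preserving D f : measurable D -> L2 D f ->
  L2 (phi @^-1` D) (f \o phi).
Proof.
move=> mD [mf f2]; split; first exact: measurable_preserving.
exact: (@integrable_preserving D (fun x => f x ^+ 2)).
Qed.

Lemma ae_preserving (P : R -> Prop) :
  (\forall x \ae mu, P x) -> \forall x \ae mu, P (phi x).
Proof.
move=> [N [mN N0 PN]]; exists (phi @^-1` N); split.
- by rewrite -[_ @^-1` _]setTI; exact: mphi.
- by rewrite muphi.
- by move=> x Px; exact: PN.
Qed.

End measure_preserving.

Let measurable_shift (c : R) : measurable_fun setT (fun x : R => x + c).
Proof. exact: measurable_funD. Qed.

Let measurable_reflect (c : R) : measurable_fun setT (fun x : R => c - x).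
Proof. exact: measurable_funB. Qed.

Let mu_shift (c a b : R) :
  mu ((fun x => x + c) @^-1` `]a, b]%classic) = mu `]a, b]%classic.
Proof.
have -> : (fun x => x + c) @^-1` `]a, b]%classic = `]a - c, b - c]%classic.
  by apply/seteqP; split=> x /=; rewrite !in_itv/= => /andP[? ?]; apply/andP; split; lra.
rewrite !lebesgue_measure_itv/= !lte_fin ltrD2r; case: ifP => // _.
by rewrite -!EFinD; congr EFin; ring.
Qed.

Let mu_reflect (c a b : R) :
  mu ((fun x => c - x) @^-1` `]a, b]%classic) = mu `]a, b]%classic.
Proof.
have -> : (fun x => c - x) @^-1` `]a, b]%classic = `[c - b, c - a[%classic.
  by apply/seteqP; split=> x /=; rewrite !in_itv/= => /andP[? ?]; apply/andP; split; lra.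
rewrite !lebesgue_measure_itv/= !lte_fin ltrD2l ltrN2; case: ifP => // _.
by rewrite -!EFinD; congr EFin; ring.
Qed.

Lemma shift_preimage_cc (a b c : R) :
  (fun x => x + c) @^-1` `[a, b]%classic = `[a - c, b - c]%classic.
Proof.
by apply/seteqP; split=> x /=; rewrite !in_itv/= => /andP[? ?]; apply/andP; split; lra.
Qed.

Lemma shift_preimage_co (a b c : R) :
  (fun x => x + c) @^-1` `[a, b[%classic = `[a - c, b - c[%classic.
Proof.
by apply/seteqP; split=> x /=; rewrite !in_itv/= => /andP[? ?]; apply/andP; split; lra.
Qed.

Lemma reflect_preimage_cc (a b c : R) :
  (fun x => c - x) @^-1` `[a, b]%classic = `[c - b, c - a]%classic.
Proof.
by apply/seteqP; split=> x /=; rewrite !in_itv/= => /andP[? ?]; apply/andP; split; lra.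
Qed.

Definition integral_shift (c : R) := integral_preserving (measurable_shift c) (@mu_shift c).
Definition integrable_shift (c : R) := integrable_preserving (measurable_shift c) (@mu_shift c).
Definition L2_shift (c : R) := L2_preserving (measurable_shift c) (@mu_shift c).
Definition ae_shift (c : R) := ae_preserving (measurable_shift c) (@mu_shift c).
Definition integral_reflect (c : R) := integral_preserving (measurable_reflect c) (@mu_reflect c).
Definition L2_reflect (c : R) := L2_preserving (measurable_reflect c) (@mu_reflect c).
Definition ae_reflect (c : R) := ae_preserving (measurable_reflect c) (@mu_reflect c).

Lemma Rintegral_shift (a b c : R) f : measurable_fun `[a, b] f ->
  \int[mu]_(x in `[a - c, b - c]) f (x + c) = \int[mu]_(x in `[a, b]) f x.
Proof.
move=> mf; rewrite /Rintegral -(@integral_shift c `[a, b] (EFin \o f))//.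
  by rewrite shift_preimage_cc.
exact/measurable_EFinP.
Qed.

Lemma Rintegral_reflect (a b c : R) f : measurable_fun `[a, b] f ->
  \int[mu]_(x in `[c - b, c - a]) f (c - x) = \int[mu]_(x in `[a, b]) f x.
Proof.
move=> mf; rewrite /Rintegral -(@integral_reflect c `[a, b] (EFin \o f))//.
  by rewrite reflect_preimage_cc.
exact/measurable_EFinP.
Qed.

End change_of_variable.

(** * Square-integrable functions on a measurable set *)

Section L2_space.
Context (R : realType).
Notation mu := (@lebesgue_measure R).
Implicit Types (D E : set (measurableTypeR R)) (f g : R -> R).

Lemma ae_impl (P Q : R -> Prop) : (forall x, P x -> Q x) ->
  (\forall x \ae mu, P x) -> \forall x \ae mu, Q x.
Proof. by move=> PQ; exact: (@filterS _ _ (ae_filter_ringOfSetsType mu)). Qed.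

Lemma ae_impl2 (P1 P2 Q : R -> Prop) : (forall x, P1 x -> P2 x -> Q x) ->
  (\forall x \ae mu, P1 x) -> (\forall x \ae mu, P2 x) ->
  \forall x \ae mu, Q x.
Proof. by move=> PQ; exact: (@filterS2 _ _ (ae_filter_ringOfSetsType mu)). Qed.

Lemma Rintegral_ae_eq D f g : measurable D ->
  (\forall x \ae mu, D x -> f x = g x) ->
  measurable_fun D f -> measurable_fun D g ->
  \int[mu]_(x in D) f x = \int[mu]_(x in D) g x.
Proof.
move=> mD fg mf mg; rewrite /Rintegral; congr fine; apply: ae_eq_integral => //.
- exact/measurable_EFinP.
- exact/measurable_EFinP.
- by apply: ae_impl fg => x fgx Dx; rewrite fgx.
Qed.

Lemma Rintegral_lin D f g (a b : R) : measurable D ->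
  mu.-integrable D (EFin \o f) -> mu.-integrable D (EFin \o g) ->
  \int[mu]_(x in D) (a * f x + b * g x) =
  a * \int[mu]_(x in D) f x + b * \int[mu]_(x in D) g x.
Proof.
move=> mD If Ig; rewrite RintegralD//.
- by congr (_ + _); exact: RintegralZl.
- exact: (integrableZl mD a If).
- exact: (integrableZl mD b Ig).
Qed.

Lemma integrable_lin D f g (a b : R) : measurable D ->
  mu.-integrable D (EFin \o f) -> mu.-integrable D (EFin \o g) ->
  mu.-integrable D (EFin \o (fun x => a * f x + b * g x)).
Proof.
move=> mD If Ig.
exact: (integrableD mD (integrableZl mD a If) (integrableZl mD b Ig)).
Qed.

Lemma L2_measurable D f : L2 D f -> measurable_fun D f.
Proof. by case. Qed.

Lemma L2_sq D f : L2 D f -> mu.-integrable D (EFin \o (fun x => f x ^+ 2)).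
Proof. by case. Qed.

Lemma L2_mul D f g : measurable D -> L2 D f -> L2 D g ->
  mu.-integrable D (EFin \o (fun x => f x * g x)).
Proof.
move=> mD [mf f2] [mg g2].
apply: (le_integrable mD _ _ (integrableD mD f2 g2)).
  by apply/measurable_EFinP; exact: measurable_funM.
move=> x _ /=; rewrite lee_fin normrM.
rewrite [leRHS]ger0_norm; last by rewrite addr_ge0// sqr_ge0.
rewrite -(real_normK (num_real (f x))) -(real_normK (num_real (g x))).
have := sqr_ge0 (`|f x| - `|g x|); have := normr_ge0 (f x); have := normr_ge0 (g x).
nra.
Qed.

Lemma L2_lin D f g (a b : R) : measurable D -> L2 D f -> L2 D g ->
  L2 D (fun x => a * f x + b * g x).
Proof.
move=> mD Lf Lg; split.
  apply: measurable_funD; apply: measurable_funM => //; [exact: Lf.1|exact: Lg.1].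
have := integrable_lin 1 (b ^+ 2) mD
  (integrable_lin (a ^+ 2) (2 * a * b) mD (L2_sq Lf) (L2_mul mD Lf Lg)) (L2_sq Lg).
by apply: (eq_integrable mD) => // x _ /=; congr EFin; ring.
Qed.

Lemma eq_L2 D f g : measurable D -> (forall x, D x -> f x = g x) -> L2 D f -> L2 D g.
Proof.
move=> mD fg [mf f2]; split.
  by apply: eq_measurable_fun mf => x /set_mem /fg.
by apply: (eq_integrable mD) f2 => // x /set_mem /fg ->.
Qed.

Lemma L2D D f g : measurable D -> L2 D f -> L2 D g -> L2 D (fun x => f x + g x).
Proof.
move=> mD Lf Lg; apply: (eq_L2 mD _ (L2_lin 1 1 mD Lf Lg)) => x _.
by rewrite !mul1r.
Qed.

Lemma L2B D f g : measurable D -> L2 D f -> L2 D g -> L2 D (fun x => f x - g x).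
Proof.
move=> mD Lf Lg; apply: (eq_L2 mD _ (L2_lin 1 (-1) mD Lf Lg)) => x _.
by rewrite mul1r mulN1r.
Qed.

Lemma L2Z D f (a : R) : measurable D -> L2 D f -> L2 D (fun x => a * f x).
Proof.
move=> mD Lf; apply: (eq_L2 mD _ (L2_lin a 0 mD Lf Lf)) => x _.
by rewrite mul0r addr0.
Qed.

Lemma L2_subset D E f : measurable D -> measurable E -> E `<=` D ->
  L2 D f -> L2 E f.
Proof.
move=> mD mE ED [mf f2]; split; first exact: measurable_funS mf.
exact: integrableS f2.
Qed.

Lemma L2_0 D : measurable D -> L2 D (cst 0).
Proof.
move=> mD; split; first exact: measurable_cst.
apply: (eq_integrable mD (cst 0%E)); last exact: integrable0.
by move=> x _ /=; rewrite expr0n.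
Qed.

Lemma L2_restrict D E f : measurable D -> measurable E ->
  L2 (D `&` E) f <-> L2 D (f \_ E).
Proof.
move=> mD mE.
have sqE x : (((f \_ E) x) ^+ 2)%:E = ((EFin \o (fun x => f x ^+ 2)) \_ E) x.
  by rewrite !patchE /=; case: ifP => //; rewrite expr0n.
pose F := EFin \o (fun x => f x ^+ 2).
have restr : mu.-integrable (D `&` E) F <-> mu.-integrable D (F \_ E).
  exact: integrable_restrict.
split=> -[mf f2]; split; try exact/measurable_restrict.
  by apply: (eq_integrable mD _ _ _ (restr.1 f2)) => x _; rewrite sqE.
by apply: restr.2; apply: (eq_integrable mD _ _ _ f2) => x _; rewrite sqE.
Qed.

Lemma L2_setU D E f : measurable D -> measurable E -> L2 D f -> L2 E f ->
  L2 (D `|` E) f.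
Proof.
move=> mD mE [mfD fD] [mfE fE]; split; first exact/measurable_funU.
apply/integrableP; split.
  by apply/measurable_EFinP/measurable_funX/measurable_funU.
apply: (@le_lt_trans _ _ (\int[mu]_(x in D) `|(f x ^+ 2)%:E| +
                     \int[mu]_(x in E) `|(f x ^+ 2)%:E|)%E); last first.
  by apply: lte_add_pinfty; [case/integrableP : fD|case/integrableP : fE].
have mfU : measurable_fun (D `|` E) (fun x => (`|(f x ^+ 2)%:E|)%E).
  by apply: measurableT_comp => //; apply/measurable_EFinP/measurable_funX/measurable_funU.
rewrite -(setDUK (@subsetUl _ D E)) setDUl setDv set0U.
rewrite ge0_integral_setU//; first last.
- by apply/disj_set2P; apply/seteqP; split=> // x [Dx [_ /(_ Dx)]].
- apply: measurable_funS mfU => //; first exact: measurableU.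
  by move=> x [|[]]; [left|right].
- exact: measurableD.
rewrite leeD2l// ge0_subset_integral//; first exact: measurableD.
by apply: measurable_funS mfU; [exact: measurableU|right].
Qed.

Lemma L2_integrable D f : measurable D -> (mu D < +oo)%E -> L2 D f ->
  mu.-integrable D (EFin \o f).
Proof.
move=> mD Doo Lf.
have L1 : L2 D (cst 1).
  split; first exact: measurable_cst.
  apply/integrableP; split; first by apply/measurable_EFinP; apply: measurable_funX; exact: measurable_cst.
  rewrite (eq_integral (cst 1%E)) ?integral_cst ?mul1e// => x _.
  by rewrite /= expr1n normr1.
by have := L2_mul mD Lf L1; apply: (eq_integrable mD) => // x _ /=; rewrite mulr1.
Qed.

(** The discriminant of the nonnegative polynomial [t => int (f + t g)^2] is
    nonpositive. *)
Lemma Cauchy_Schwarz D f g : measurable D -> L2 D f -> L2 D g ->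
  (\int[mu]_(x in D) (f x * g x)) ^+ 2 <=
  (\int[mu]_(x in D) f x ^+ 2) * (\int[mu]_(x in D) g x ^+ 2).
Proof.
move=> mD Lf Lg.
set A := \int[mu]_(x in D) f x ^+ 2; set B := \int[mu]_(x in D) (f x * g x).
set C := \int[mu]_(x in D) g x ^+ 2.
have quad t : 0 <= A + 2 * t * B + t ^+ 2 * C.
  have -> : A + 2 * t * B + t ^+ 2 * C =
      \int[mu]_(x in D) (1 * (1 * f x ^+ 2 + 2 * t * (f x * g x)) + t ^+ 2 * g x ^+ 2).
    rewrite Rintegral_lin ?Rintegral_lin ?mul1r//; try exact: L2_sq; try exact: L2_mul.
    exact: integrable_lin (L2_sq Lf) (L2_mul mD Lf Lg).
  apply: Rintegral_ge0 => x _.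
  rewrite (_ : _ + _ = (f x + t * g x) ^+ 2) ?sqr_ge0//; ring.
have A0 : 0 <= A by apply: Rintegral_ge0 => x _; exact: sqr_ge0.
have C0 : 0 <= C by apply: Rintegral_ge0 => x _; exact: sqr_ge0.
have [C00|Cn0] := eqVneq C 0.
  have [->|Bn0] := eqVneq B 0; first by rewrite expr0n/= mulr_ge0.
  have := quad (- (A + 1) / (2 * B)); rewrite C00 mulr0 addr0.
  rewrite (_ : 2 * _ * _ = - (A + 1)); last by field.
  lra.
have := quad (- B / C).
rewrite (_ : _ + _ = A - B ^+ 2 / C); last by field.
rewrite subr_ge0 ler_pdivrMr// lt_neqAle eq_sym Cn0//.
Qed.

Definition L2norm D f := Num.sqrt (\int[mu]_(x in D) f x ^+ 2).

Lemma L2norm_ge0 D f : 0 <= L2norm D f. Proof. exact: sqrtr_ge0. Qed.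

Lemma sqr_L2norm D f : L2norm D f ^+ 2 = \int[mu]_(x in D) f x ^+ 2.
Proof. by rewrite sqr_sqrtr//; apply: Rintegral_ge0 => x _; exact: sqr_ge0. Qed.

Lemma L2norm_le D f (e : R) : 0 <= e -> \int[mu]_(x in D) f x ^+ 2 <= e ^+ 2 ->
  L2norm D f <= e.
Proof. by move=> e0 fe; rewrite -(ger0_norm e0) -sqrtr_sqr; exact: ler_wsqrtr. Qed.

Lemma normr_inner_le D f g : measurable D -> L2 D f -> L2 D g ->
  `|\int[mu]_(x in D) (f x * g x)| <= L2norm D f * L2norm D g.
Proof.
move=> mD Lf Lg; rewrite -ler_sqr ?nnegrE ?mulr_ge0 ?L2norm_ge0//.
by rewrite exprMn !sqr_L2norm real_normK ?num_real//; exact: Cauchy_Schwarz.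
Qed.

Lemma sqint_add_le D f g : measurable D -> L2 D f -> L2 D g ->
  \int[mu]_(x in D) (f x + g x) ^+ 2 <=
  2 * \int[mu]_(x in D) f x ^+ 2 + 2 * \int[mu]_(x in D) g x ^+ 2.
Proof.
move=> mD Lf Lg; rewrite -Rintegral_lin//; try exact: L2_sq.
apply: le_Rintegral => //.
- exact: (L2_sq (L2D mD Lf Lg)).
- exact: integrable_lin (L2_sq Lf) (L2_sq Lg).
- by move=> x _; have := sqr_ge0 (f x - g x); nra.
Qed.

Lemma ler_L2normD D f g : measurable D -> L2 D f -> L2 D g ->
  L2norm D (fun x => f x + g x) <= L2norm D f + L2norm D g.
Proof.
move=> mD Lf Lg; apply: L2norm_le; first by rewrite addr_ge0 ?L2norm_ge0.
have -> : \int[mu]_(x in D) (f x + g x) ^+ 2 =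
   \int[mu]_(x in D) (1 * (1 * f x ^+ 2 + 2 * (f x * g x)) + 1 * g x ^+ 2).
  by apply: eq_Rintegral => x _; ring.
rewrite Rintegral_lin//; first last.
- exact: L2_sq.
- exact: integrable_lin (L2_sq Lf) (L2_mul mD Lf Lg).
rewrite Rintegral_lin//; first last.
- exact: L2_mul.
- exact: L2_sq.
rewrite -!sqr_L2norm.
have := ler_norm (\int[mu]_(x in D) (f x * g x)).
have := normr_inner_le mD Lf Lg.
lra.
Qed.

Lemma sqint_eq0 D f : measurable D -> L2 D f ->
  \int[mu]_(x in D) f x ^+ 2 = 0 -> \forall x \ae mu, D x -> f x = 0.
Proof.
move=> mD Lf f0.
have /(ae_eq_integral_abs _ mD) : (\int[mu]_(x in D) `|(f x ^+ 2)%:E| = 0)%E.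
  rewrite -[RHS](_ : (\int[mu]_(x in D) f x ^+ 2)%:E = _); last by rewrite f0.
  rewrite /Rintegral fineK; last exact: (integrable_fin_num mD (L2_sq Lf)).
  by apply: eq_integral => x _; rewrite gee0_abs// lee_fin sqr_ge0.
move=> /(_ (measurable_int _ (L2_sq Lf))).
by apply: ae_impl => x fx Dx; have [/eqP] := fx Dx; rewrite sqrf_eq0 => /eqP.
Qed.

End L2_space.

(** * Iterated integrals and primitives *)

Section iterated_integrals.
Context (R : realType).
Notation mu := (@lebesgue_measure R).
Notation mR := (measurableTypeR R).
Implicit Types (D : set (measurableTypeR R)) (f : R -> R).

(** Extension by zero off [A `*` B] reduces this to Fubini's theorem for the
    product measure; by Tonelli's theorem, the majorant [G] of the inner absolute
    integrals gives integrability on the product. *)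
Lemma Rintegral_Fubini (A B : set mR) (f : mR -> mR -> R) (G : R -> R) :
  measurable A -> measurable B ->
  measurable_fun [set: mR * mR] (fun z => f z.1 z.2) ->
  (forall x, A x -> mu.-integrable B (EFin \o f x)) ->
  (forall y, B y -> mu.-integrable A (EFin \o f ^~ y)) ->
  mu.-integrable A (EFin \o G) ->
  (forall x, A x -> \int[mu]_(y in B) `|f x y| <= G x) ->
  [/\ mu.-integrable A (EFin \o (fun x => \int[mu]_(y in B) f x y)),
      mu.-integrable B (EFin \o (fun y => \int[mu]_(x in A) f x y)) &
      \int[mu]_(x in A) (\int[mu]_(y in B) f x y) =
      \int[mu]_(y in B) (\int[mu]_(x in A) f x y)].
Proof.
move=> mA mB mf intB intA intG fG.
pose F : mR * mR -> \bar R := (fun z => (f z.1 z.2)%:E) \_ (A `*` B).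
have mF : measurable_fun setT F.
  apply/(measurable_restrictT _ (measurableX mA mB)).
  by apply: measurable_funTS; exact/measurable_EFinP.
have FE x y : F (x, y) = (((EFin \o f x) \_ B) y * (\1_A x)%:E)%E.
  rewrite /F !patchE indicE; have [xA|xA] := boolP (x \in A); last first.
    by rewrite mule0 ifF//; apply/negbTE; rewrite in_setX negb_and/= xA.
  have [yB|yB] := boolP (y \in B); last by rewrite mul0e ifF// in_setX/= xA (negbTE yB).
  by rewrite mule1 ifT// in_setX/= xA yB.
have intF1 x : (\int[mu]_y F (x, y) =
    ((EFin \o (fun x => (\int[mu]_(y in B) f x y)%R)) \_ A) x)%E.
  rewrite patchE; case: ifPn => xA.
    rewrite /Rintegral /= fineK; last exact: (integrable_fin_num mB (intB _ (set_mem xA))).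
    rewrite [RHS]integral_mkcond; apply: eq_integral => y _.
    by rewrite FE indicE xA mule1.
  by apply: integral0_eq => y _; rewrite FE indicE (negbTE xA) mule0.
have intF2 y : (\int[mu]_x F (x, y) =
    ((EFin \o (fun y => (\int[mu]_(x in A) f x y)%R)) \_ B) y)%E.
  rewrite patchE; case: ifPn => yB.
    rewrite /Rintegral /= fineK; last exact: (integrable_fin_num mA (intA _ (set_mem yB))).
    rewrite [RHS]integral_mkcond; apply: eq_integral => x _.
    by rewrite FE !patchE yB indicE; case: ifPn => _; rewrite ?mule1 ?mule0.
  by apply: integral0_eq => x _; rewrite FE patchE (negbTE yB) mul0e.
have iF : (mu \x mu)%E.-integrable setT F.
  apply/(integrable12ltyP mu mu mF).
  apply: (@le_lt_trans _ _ (\int[mu]_(x in A) (G x)%:E)%E); last first.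
    exact: (integrable_lty mA intG).
  rewrite [leRHS]integral_mkcond; apply: ge0_le_integral => //.
  - by move=> x _; exact: integral_ge0.
  - apply: (@measurable_fun_fubini_tonelli_F _ _ _ _ _ mu (fun z => `|F z|)%E) => //.
    exact: measurableT_comp.
  - by apply/(measurable_restrictT _ mA); case/integrableP : intG.
  move=> x _; rewrite patchE; case: ifPn => xA; last first.
    by rewrite integral0_eq// => y _; rewrite FE indicE (negbTE xA) mule0 abse0.
  have Bx := intB _ (set_mem xA).
  apply: (@le_trans _ _ (\int[mu]_(y in B) `|f x y|)%:E); last first.
    by rewrite lee_fin fG//; exact: set_mem.
  rewrite /Rintegral fineK; last exact: (integrable_fin_num mB (integrable_norm Bx)).
  rewrite [leRHS]integral_mkcond le_eqVlt; apply/orP; left; apply/eqP.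
  by apply: eq_integral => y _; rewrite FE indicE xA mule1 !patchE; case: ifPn => // _; rewrite abse0.
have I1 := integrable_fubini_F iF.
have I2 : mu.-integrable setT (fubini_G mu F).
  apply/integrableP; split; first exact: (measurable_fubini_G iF).
  apply: le_lt_trans ((integrable21ltyP mu mu mF).1 iF).
  apply: ge0_le_integral => //.
  - by apply: measurableT_comp => //; exact: (measurable_fubini_G iF).
  - apply: (@measurable_fun_fubini_tonelli_G _ _ _ _ _ mu (fun z => `|F z|)%E) => //.
    exact: measurableT_comp.
  - move=> y _; apply: le_abse_integral => //.
    exact: measurableT_comp.
have funF1 : fubini_F mu F = (EFin \o (fun x => \int[mu]_(y in B) f x y)) \_ A.
  by apply/funext => x; rewrite -intF1.
have funF2 : fubini_G mu F = (EFin \o (fun y => \int[mu]_(x in A) f x y)) \_ B.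
  by apply/funext => y; rewrite -intF2.
rewrite funF1 in I1; rewrite funF2 in I2; split.
- by apply/(integrable_mkcond _ mA).
- by apply/(integrable_mkcond _ mB).
rewrite /Rintegral; congr fine; rewrite [LHS]integral_mkcond [RHS]integral_mkcond.
transitivity (\int[mu]_x \int[mu]_y F (x, y))%E; first by apply: eq_integral => x _; rewrite intF1.
rewrite (Fubini iF).
by apply: eq_integral => y _; rewrite intF2.
Qed.

Lemma Rintegral_split (a c b : R) f : a <= c <= b ->
  mu.-integrable `[a, b] (EFin \o f) ->
  \int[mu]_(x in `[a, b]) f x =
  \int[mu]_(x in `[a, c]) f x + \int[mu]_(x in `[c, b]) f x.
Proof.
move=> /andP[ac cb] intf.
have icb : mu.-integrable `]c, b] (EFin \o f).
  by apply: integrableS intf => //; apply: subset_itvr; rewrite bnd_simp.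
rewrite -(Rintegral_itv_obnd_cbnd icb) -(Rintegral_itvB intf) ?bnd_simp//.
by rewrite addrC subrK.
Qed.

Lemma cvg_withinP (A : set R) (f : R -> R) (t l : R) :
  f s @[s --> within A (nbhs t)] --> l <->
  forall e, 0 < e -> exists2 d, 0 < d &
    forall s, A s -> `|s - t| < d -> `|f s - l| < e.
Proof.
split=> [/cvgrPdist_lt H e e0|H].
  have := H e e0; rewrite /prop_near1/= /nbhs/= /within /= => -[d /= d0 Hd].
  exists d => // s As st; rewrite distrC; apply: Hd => //.
  by rewrite /ball /= distrC.
apply/cvgrPdist_lt => e e0; have [d d0 Hd] := H e e0.
rewrite /prop_near1/= /nbhs/= /within /=; exists d => //= s.
by rewrite /ball /= distrC => st As; rewrite distrC; exact: Hd.
Qed.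

Lemma cvg_within_dnbhsP (A : set R) (f : R -> R) (t l : R) :
  f s @[s --> within A t^'] --> l <->
  forall e, 0 < e -> exists2 d, 0 < d &
    forall s, A s -> s != t -> `|s - t| < d -> `|f s - l| < e.
Proof.
split=> [/cvgrPdist_lt H e e0|H].
  have := H e e0; rewrite /prop_near1/= /nbhs/= /dnbhs /within /= => -[d /= d0 Hd].
  exists d => // s As sNt st; rewrite distrC; apply: Hd => //.
  by rewrite /ball /= distrC.
apply/cvgrPdist_lt => e e0; have [d d0 Hd] := H e e0.
rewrite /prop_near1/= /nbhs/= /dnbhs /within /=; exists d => //= s.
by rewrite /ball /= distrC => st sNt As; rewrite distrC; exact: Hd.
Qed.

Lemma within_continuousP (A : set R) (f : R -> R) :
  {within A, continuous f} <->
  forall t, A t -> forall e, 0 < e -> exists2 d, 0 < d &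
    forall s, A s -> `|s - t| < d -> `|f s - f t| < e.
Proof.
split=> [/subspace_continuousP H t At|H].
  by apply/cvg_withinP; exact: H.
by apply/subspace_continuousP => t At; apply/cvg_withinP; exact: H.
Qed.

Lemma continuous_primitive (b : R) f : 0 <= b ->
  mu.-integrable `[0, b] (EFin \o f) ->
  {within `[0, b], continuous (fun x => \int[mu]_(s in `[0, x]) f s)}.
Proof. by move=> b0 intf; exact: parameterized_integral_continuous. Qed.

(** A nonzero value would persist on an interval of positive measure. *)
Lemma continuous_ae_eq0 (b : R) f : 0 < b -> {within `[0, b], continuous f} ->
  (\forall x \ae mu, 0 <= x <= b -> f x = 0) ->
  forall x, 0 <= x <= b -> f x = 0.
Proof.
move=> b0 cf [N [mN N0 fN]] x xb; apply/eqP/negPn/negP => fx0.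
have xI : `[0, b]%classic x by rewrite /= in_itv.
have fx : 0 < `|f x| by rewrite normr_gt0.
have [e e0 He] := (within_continuousP _ _).1 cf x xI _ fx.
pose p := Num.max 0 (x - e / 2); pose q := Num.min b (x + e / 2).
have pq : p < q.
  by rewrite /p /q lt_min !gt_max; case/andP: xb => ? ?; apply/andP; split; apply/andP; split; lra.
have sub : `[p, q]%classic `<=` N.
  move=> z /=; rewrite in_itv/= /p /q ge_max le_min => /andP[/andP[z0 zx] /andP[zb xz]].
  apply: fN => /= fz; have zI : 0 <= z <= b by rewrite z0.
  have := He z; rewrite fz ?zI// sub0r normrN ltxx => H.
  suff : false by []. apply: H.
    by rewrite /= in_itv.
  by rewrite ltr_distl; apply/andP; split; lra.
have : (mu `[p, q]%classic <= mu N)%E by apply: le_measure => //; rewrite inE.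
rewrite [X in (_ <= X)%E -> _]N0 lebesgue_measure_itv/= lte_fin pq lee_fin.
lra.
Qed.

(** Lebesgue differentiation: the primitive determines the integrand. *)
Lemma ae_eq0_primitive (a b : R) f : mu.-integrable `[a, b] (EFin \o f) ->
  (forall x, a <= x <= b -> \int[mu]_(s in `[a, x]) f s = 0) ->
  \forall x \ae mu, a <= x <= b -> f x = 0.
Proof.
move=> intf f0.
have [ba|ab] := ltP b a.
  by apply: aeW => x /andP[ax xb]; lra.
pose g := f \_ `[a, b].
have ig : mu.-integrable setT (EFin \o g).
  rewrite /g -restrict_EFin; apply/integrable_restrict => //=; by rewrite setTI.
have gint y : mu.-integrable [set` Interval (BLeft a) (BRight y)] (EFin \o g).
  exact: integrableS ig.
have gloc : locally_integrable setT g.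
  exact: integrable_locally_restrict.
have N2 : \forall x \ae mu, x <> a /\ x <> b.
  exists [set a; b]; split.
  - by apply: measurableU; exact: measurable_set1.
  - apply: countable_lebesgue_measure0; exact/finite_set_countable/finite_set2.
  - move=> x /=; rewrite not_andP !not_notP => -[]; by [left|right].
have := FTC1 gint gloc; apply: ae_impl2 N2 => x [xa xb] H /andP[ax xb'].
have {}ax : a < x by rewrite lt_neqAle ax andbT eq_sym; exact/eqP.
have {}xb' : x < b by rewrite lt_neqAle xb' andbT; exact/eqP.
have [|_ Fx] := H; first by rewrite -?lteBSide ?bnd_simp ?lte_fin.
have gfx : g x = f x by rewrite /g patchE ifT// inE /= in_itv/= !ltW.
rewrite -gfx -Fx.
have nearx : \forall y \near x, a < y < b.
  near=> y; apply/andP; split; near: y; [exact: lt_nbhsr|exact: lt_nbhsl].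
rewrite derive1E (@near_eq_derive _ _ _ _ (cst 0)) ?derive_cst//.
apply: filterS nearx => y /andP[ay yb] /=.
rewrite -[RHS](f0 y); last by rewrite !ltW.
apply: eq_Rintegral => z; rewrite inE /= in_itv/= => /andP[az zy].
by rewrite /g patchE ifT// inE/= in_itv/= az (le_trans zy) ?ltW.
Unshelve. all: by end_near. Qed.

End iterated_integrals.

(** * Locally square-integrable functions and their translates *)

Section local_L2.
Context (R : realType).
Notation mu := (@lebesgue_measure R).
Notation mR := (measurableTypeR R).
Implicit Types (f g h v dv : R -> R).

Lemma mu_cc_fin (a b : R) : (mu `[a, b]%classic < +oo)%E.
Proof. by rewrite lebesgue_measure_itv/=; case: ifP => //; rewrite -EFinD ltry. Qed.

Definition L2loc h := measurable_fun setT h /\ forall a b : R, L2 `[a, b] h.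

Lemma integrable_cst_cc (a b c : R) : mu.-integrable `[a, b] (EFin \o (fun=> c)).
Proof.
apply/integrableP; split; first by apply/measurable_EFinP; exact: measurable_cst.
rewrite (eq_integral (cst `|c|%:E)) ?integral_cst//=.
by rewrite lte_mul_pinfty// ?mu_cc_fin.
Qed.

Lemma Rintegral_cst_cc (a b c : R) : a <= b ->
  \int[mu]_(x in `[a, b]) c = c * (b - a).
Proof.
move=> ab; rewrite Rintegral_cst//= lebesgue_measure_itv/= lte_fin.
by case: ltP => //= ba; congr (_ * _); apply/eqP; rewrite eq_sym subr_eq0 eq_le ab ba.
Qed.

Lemma L2_integrable_cc (a b : R) f : L2 `[a, b] f -> mu.-integrable `[a, b] (EFin \o f).
Proof. by move=> Lf; apply: L2_integrable => //; exact: mu_cc_fin. Qed.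

Lemma L2_subset_cc (a b c d : R) f : c <= a -> b <= d -> L2 `[c, d] f -> L2 `[a, b] f.
Proof.
move=> ca bd; apply: L2_subset => //.
by move=> x /=; rewrite !in_itv/= => /andP[? ?]; apply/andP; split; lra.
Qed.

Lemma L2loc_integrable h (a b : R) : L2loc h -> mu.-integrable `[a, b] (EFin \o h).
Proof. by case=> _ /(_ a b); exact: L2_integrable_cc. Qed.

Lemma L2_shift_cc h (a b c : R) : L2 `[a + c, b + c] h -> L2 `[a, b] (fun x => h (x + c)).
Proof.
by move=> /(@L2_shift R c _ _ (measurable_itv _)); rewrite shift_preimage_cc !addrK.
Qed.

Lemma L2_reflect_cc h (a b c : R) : L2 `[c - b, c - a] h -> L2 `[a, b] (fun x => h (c - x)).
Proof.
move=> /(@L2_reflect R c _ _ (measurable_itv _)).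
by rewrite reflect_preimage_cc !subKr.
Qed.

Lemma L2loc_shift h (c : R) : L2loc h -> L2loc (fun x => h (x + c)).
Proof.
move=> [mh Lh]; split; last by move=> a b; exact: L2_shift_cc.
by apply: measurableT_comp mh _; exact: measurable_funD.
Qed.

Lemma L2loc_reflect h (c : R) : L2loc h -> L2loc (fun x => h (c - x)).
Proof.
move=> [mh Lh]; split; last by move=> a b; exact: L2_reflect_cc.
by apply: measurableT_comp mh _; exact: measurable_funB.
Qed.

Lemma sub_Rintegral (a b c d : R) f : c <= a -> b <= d -> (forall x, 0 <= f x) ->
  mu.-integrable `[c, d] (EFin \o f) ->
  \int[mu]_(x in `[a, b]) f x <= \int[mu]_(x in `[c, d]) f x.
Proof.
move=> ca bd f0 intf.
have sub : `[a, b]%classic `<=` `[c, d]%classic.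
  by move=> x /=; rewrite !in_itv/= => /andP[? ?]; apply/andP; split; lra.
have inta : mu.-integrable `[a, b] (EFin \o f) by exact: integrableS intf.
apply: fine_le; [exact: integrable_fin_num|exact: integrable_fin_num|].
apply: ge0_subset_integral => //; last by move=> x _; rewrite lee_fin.
by case/integrableP: intf.
Qed.

(** The kernels of interest are the travelling ones [h (r + x)] and [h (r - x)].
    Their square norms over [[0, 1]] are bounded uniformly in [r] by that of [h] on
    the interval swept; through [2 |k eta| <= k ^ 2 + eta ^ 2] this bound [M]
    dominates the inner integrals. *)
Let Fubini_kernel (k : R -> R -> R) (eta : R -> R) (a b M : R) :
  measurable_fun [set: mR * mR] (fun z => k z.1 z.2) ->
  (forall r, L2 `[0, 1] (k r)) -> (forall x, L2 `[a, b] (k ^~ x)) ->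
  (forall r, a <= r <= b -> \int[mu]_(x in `[0, 1]) k r x ^+ 2 <= M) ->
  L2 `[0, 1] eta ->
  [/\ mu.-integrable `[a, b] (EFin \o (fun r => \int[mu]_(x in `[0, 1]) (k r x * eta x))),
      mu.-integrable `[0, 1] (EFin \o (fun x => eta x * \int[mu]_(r in `[a, b]) k r x)) &
  \int[mu]_(r in `[a, b]) (\int[mu]_(x in `[0, 1]) (k r x * eta x)) =
  \int[mu]_(x in `[0, 1]) (eta x * \int[mu]_(r in `[a, b]) k r x)].
Proof.
move=> mk Lk Lkt kM Le.
pose eta' := eta \_ `[0, 1].
have etaE x : `[0, 1]%classic x -> eta' x = eta x.
  by move=> x01; rewrite /eta' patchE mem_set.
have meta : measurable_fun setT eta'.
  by apply/(measurable_restrictT _ _).1 => //; exact: L2_measurable Le.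
have Le' : L2 `[0, 1] eta' by apply: eq_L2 Le => // x /etaE ->.
pose e2 := \int[mu]_(x in `[0, 1]) eta' x ^+ 2.
have bound r : a <= r <= b -> \int[mu]_(x in `[0, 1]) `|k r x * eta' x| <= M + e2.
  move=> /kM kM'; apply: le_trans (lerD kM' (lexx e2)).
  rewrite -RintegralD//; [|exact: L2_sq (Lk r)|exact: L2_sq].
  apply: le_Rintegral => //.
  - exact: (integrable_norm (L2_mul _ (Lk r) Le')).
  - exact: (integrableD _ (L2_sq (Lk r)) (L2_sq Le')).
  - move=> x _; rewrite normrM -(real_normK (num_real (k r x))).
    rewrite -(real_normK (num_real (eta' x))).
    by have := sqr_ge0 (`|k r x| - `|eta' x|); have := normr_ge0 (k r x);
      have := normr_ge0 (eta' x); nra.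
have intk x : mu.-integrable `[a, b] (EFin \o k ^~ x) by exact: L2_integrable_cc.
have [] := @Rintegral_Fubini R `[a, b] `[0, 1] (fun r x => k r x * eta' x) (fun=> M + e2).
- exact: measurable_itv.
- exact: measurable_itv.
- by apply: measurable_funM => //; apply: measurableT_comp meta _.
- by move=> r _; exact: L2_mul.
- move=> x _; have mab : measurable (`[a, b] : set mR) by [].
  have := integrableZl mab (eta' x) (intk x).
  by apply: (eq_integrable mab) => r _; rewrite /= mulrC.
- exact: integrable_cst_cc.
- by move=> r /=; rewrite in_itv/=; exact: bound.
have E1 r : \int[mu]_(x in `[0, 1]) (k r x * eta' x) = \int[mu]_(x in `[0, 1]) (k r x * eta x).
  by apply: eq_Rintegral => x /set_mem /etaE ->.
have E2 x : `[0, 1]%classic x -> \int[mu]_(r in `[a, b]) (k r x * eta' x) =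
    eta x * \int[mu]_(r in `[a, b]) k r x.
  by move=> /etaE ->; rewrite RintegralZr// mulrC.
move=> I1 I2 FF; split.
- by apply: eq_integrable I1 => // r _ /=; rewrite E1.
- by apply: eq_integrable I2 => // x /set_mem x01 /=; rewrite E2.
- transitivity (\int[mu]_(r in `[a, b]) \int[mu]_(x in `[0, 1]) (k r x * eta' x)).
    by apply: eq_Rintegral => r _; rewrite E1.
  by rewrite FF; apply: eq_Rintegral => x /set_mem x01; rewrite E2.
Qed.

Lemma Fubini_kernelD h eta (a b : R) : L2loc h -> L2 `[0, 1] eta ->
  [/\ mu.-integrable `[a, b] (EFin \o (fun r => \int[mu]_(x in `[0, 1]) (h (r + x) * eta x))),
      mu.-integrable `[0, 1] (EFin \o (fun x => eta x * \int[mu]_(r in `[a, b]) h (r + x))) &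
  \int[mu]_(r in `[a, b]) (\int[mu]_(x in `[0, 1]) (h (r + x) * eta x)) =
  \int[mu]_(x in `[0, 1]) (eta x * \int[mu]_(r in `[a, b]) h (r + x))].
Proof.
move=> Lh; have [mh Lab] := Lh.
apply: (@Fubini_kernel (fun r x => h (r + x)) _ _ _ (\int[mu]_(x in `[a, b + 1]) h x ^+ 2)).
- by apply: measurableT_comp mh _; exact: measurable_funD.
- move=> r; under [X in L2 _ X]eq_fun do rewrite addrC.
  by apply: L2_shift_cc; rewrite add0r.
- by move=> x; exact: L2_shift_cc.
- move=> r /andP[ar rb]; under eq_Rintegral do rewrite addrC.
  have := @Rintegral_shift R r (1 + r) r (fun x => h x ^+ 2).
  rewrite subrr addrK => ->; last by apply: measurable_funTS; exact: measurable_funX.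
  apply: sub_Rintegral => //; [lra|by move=> x; exact: sqr_ge0|].
  exact: L2_sq.
Qed.

Lemma Fubini_kernelB h eta (a b : R) : L2loc h -> L2 `[0, 1] eta ->
  [/\ mu.-integrable `[a, b] (EFin \o (fun r => \int[mu]_(x in `[0, 1]) (h (r - x) * eta x))),
      mu.-integrable `[0, 1] (EFin \o (fun x => eta x * \int[mu]_(r in `[a, b]) h (r - x))) &
  \int[mu]_(r in `[a, b]) (\int[mu]_(x in `[0, 1]) (h (r - x) * eta x)) =
  \int[mu]_(x in `[0, 1]) (eta x * \int[mu]_(r in `[a, b]) h (r - x))].
Proof.
move=> Lh; have [mh Lab] := Lh.
apply: (@Fubini_kernel (fun r x => h (r - x)) _ _ _ (\int[mu]_(x in `[a - 1, b]) h x ^+ 2)).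
- by apply: measurableT_comp mh _; exact: measurable_funB.
- by move=> r; apply: L2_reflect_cc.
- by move=> x; exact: L2_shift_cc.
- move=> r /andP[ar rb].
  have := @Rintegral_reflect R (r - 1) r r (fun x => h x ^+ 2).
  rewrite subrr subKr => ->; last by apply: measurable_funTS; exact: measurable_funX.
  apply: sub_Rintegral => //; [lra|by move=> x; exact: sqr_ge0|].
  exact: L2_sq.
Qed.

(** Fubini on the triangle [0 <= s <= x <= 1], cut out of the square by the
    factor [(s <= x)%:R]. *)
Let Fubini_triangle f dv : L2 `[0, 1] f -> L2 `[0, 1] dv ->
  [/\ mu.-integrable `[0, 1] (EFin \o (fun x => f x * \int[mu]_(s in `[0, x]) dv s)),
  mu.-integrable `[0, 1] (EFin \o (fun s => dv s * \int[mu]_(x in `[s, 1]) f x)) &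
  \int[mu]_(x in `[0, 1]) (f x * \int[mu]_(s in `[0, x]) dv s) =
  \int[mu]_(s in `[0, 1]) (dv s * \int[mu]_(x in `[s, 1]) f x)].
Proof.
move=> Lf Ldv; have m01 : measurable (`[0, 1] : set mR) by [].
pose F x s := f x * (dv s * (s <= x)%R%:R).
have [iF idv] := (L2_integrable_cc Lf, L2_integrable_cc Ldv).
have dvle x : `[0, 1]%classic x ->
    mu.-integrable `[0, 1] (EFin \o (fun s => dv s * (s <= x)%R%:R)) /\
    \int[mu]_(s in `[0, 1]) (dv s * (s <= x)%R%:R) = \int[mu]_(s in `[0, x]) dv s.
  rewrite /= in_itv/= => /andP[x0 x1].
  have cap : `[0, 1] `&` `[0, x] = `[0, x]%classic :> set R.
    apply/seteqP; split=> s /=; rewrite !in_itv/=; first by case.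
    by move=> /andP[-> sx]; split=> //; apply: le_trans x1.
  have patch s : s \in `[0, 1]%classic -> (dv \_ `[0, x]) s = dv s * (s <= x)%R%:R.
    rewrite inE /= in_itv/= => /andP[s0 s1]; rewrite patchE mem_setE in_itv/= s0/=.
    by case: ifP; rewrite ?mulr1 ?mulr0.
  split; last first.
    by rewrite -[in RHS]cap Rintegral_mkcondr; apply: eq_Rintegral => s /patch.
  have : mu.-integrable `[0, 1] (EFin \o (dv \_ `[0, x])).
    rewrite -restrict_EFin; apply/(integrable_restrict _ _) => //.
    by rewrite cap; apply: integrableS idv => // s /=; rewrite !in_itv/= => /andP[-> sx]; apply: le_trans x1.
  by apply: (eq_integrable m01) => s /patch /= ->.
have fle s : `[0, 1]%classic s ->
    mu.-integrable `[0, 1] (EFin \o (fun x => f x * (s <= x)%R%:R)) /\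
    \int[mu]_(x in `[0, 1]) (f x * (s <= x)%R%:R) = \int[mu]_(x in `[s, 1]) f x.
  rewrite /= in_itv/= => /andP[s0 s1].
  have cap : `[0, 1] `&` `[s, 1] = `[s, 1]%classic :> set R.
    apply/seteqP; split=> x /=; rewrite !in_itv/=; first by case.
    by move=> /andP[sx ->]; split=> //; rewrite andbT; apply: le_trans sx.
  have patch x : x \in `[0, 1]%classic -> (f \_ `[s, 1]) x = f x * (s <= x)%R%:R.
    rewrite inE /= in_itv/= => /andP[x0 x1]; rewrite patchE mem_setE in_itv/= x1 andbT.
    by case: ifP; rewrite ?mulr1 ?mulr0.
  split; last first.
    by rewrite -[in RHS]cap Rintegral_mkcondr; apply: eq_Rintegral => x /patch.
  have : mu.-integrable `[0, 1] (EFin \o (f \_ `[s, 1])).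
    rewrite -restrict_EFin; apply/(integrable_restrict _ _) => //.
    by rewrite cap; apply: integrableS iF => // x /=; rewrite !in_itv/= => /andP[sx ->]; rewrite andbT (le_trans s0).
  by apply: (eq_integrable m01) => x /patch /= ->.
pose G x := `|f x| * \int[mu]_(s in `[0, 1]) `|dv s|.
pose f' := f \_ `[0, 1]; pose dv' := dv \_ `[0, 1].
have f'E x : `[0, 1]%classic x -> f' x = f x by move=> x01; rewrite /f' patchE mem_set.
have dv'E x : `[0, 1]%classic x -> dv' x = dv x by move=> x01; rewrite /dv' patchE mem_set.
have mf' : measurable_fun setT f' by apply/(measurable_restrictT _ _).1 => //; exact: L2_measurable Lf.
have mdv' : measurable_fun setT dv' by apply/(measurable_restrictT _ _).1 => //; exact: L2_measurable Ldv.
have intF1 x : `[0, 1]%classic x -> mu.-integrable `[0, 1] (EFin \o (fun s => f' x * (dv' s * (s <= x)%R%:R))).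
  move=> x01; have := integrableZl m01 (f x) (dvle x x01).1.
  by apply: (eq_integrable m01) => s /set_mem /dv'E /= ->; rewrite f'E.
have intF2 s : `[0, 1]%classic s -> mu.-integrable `[0, 1] (EFin \o (fun x => f' x * (dv' s * (s <= x)%R%:R))).
  move=> s01; have := integrableZl m01 (dv s) (fle s s01).1.
  by apply: (eq_integrable m01) => x /set_mem /f'E /= ->; rewrite dv'E// -EFinM mulrCA.
have [] := @Rintegral_Fubini R `[0, 1] `[0, 1] (fun x s => f' x * (dv' s * (s <= x)%R%:R)) G m01 m01 _ intF1 intF2.
- apply: measurable_funM; first exact: measurableT_comp mf' _.
  apply: measurable_funM; first exact: measurableT_comp mdv' _.
  rewrite (_ : (fun _ => _) = (fun z : mR * mR => if (z.2 <= z.1)%R then 1 else 0)); last first.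
    by apply/funext => z; case: ifP.
  by apply: measurable_fun_ifT => //; apply: measurable_fun_ler.
- have := integrableZr m01 (\int[mu]_(s in `[0, 1]) `|dv s|) (integrable_norm iF).
  by apply: (eq_integrable m01) => x _.
- move=> x x01; rewrite /G.
  rewrite -[leRHS](RintegralZl (`|f x|) m01 (integrable_norm idv)).
  apply: le_Rintegral => //.
  + exact: (integrable_norm (intF1 x x01)).
  + exact: (integrableZl m01 `|f x| (integrable_norm idv)).
  + move=> s s01; rewrite f'E// dv'E// !normrM ler_wpM2l//.
    by rewrite normr_nat ler_piMr// lern1; case: (s <= x)%R.
have E1 x : `[0, 1]%classic x -> \int[mu]_(s in `[0, 1]) (f' x * (dv' s * (s <= x)%R%:R)) =
    f x * \int[mu]_(s in `[0, x]) dv s.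
  move=> x01; rewrite f'E// -(dvle x x01).2 -RintegralZl//; last exact: (dvle x x01).1.
  by apply: eq_Rintegral => s /set_mem /dv'E ->.
have E2 s : `[0, 1]%classic s -> \int[mu]_(x in `[0, 1]) (f' x * (dv' s * (s <= x)%R%:R)) =
    dv s * \int[mu]_(x in `[s, 1]) f x.
  move=> s01; rewrite dv'E// -(fle s s01).2 -RintegralZl//; last exact: (fle s s01).1.
  by apply: eq_Rintegral => x /set_mem /f'E ->; rewrite mulrCA.
move=> I1 I2 FF; split.
- by apply: eq_integrable I1 => // x /set_mem /E1 /= ->.
- by apply: eq_integrable I2 => // s /set_mem /E2 /= ->.
- transitivity (\int[mu]_(x in `[0, 1]) \int[mu]_(s in `[0, 1]) (f' x * (dv' s * (s <= x)%R%:R))).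
    by apply: eq_Rintegral => x /set_mem /E1 ->.
  by rewrite FF; apply: eq_Rintegral => s /set_mem /E2 ->.
Qed.

Lemma continuous_L2 (a b : R) f : {within `[a, b], continuous f} -> L2 `[a, b] f.
Proof.
move=> cf; split; first exact: subspace_continuous_measurable_fun.
apply: continuous_compact_integrable; first exact: segment_compact.
apply: (@within_continuous_comp R R R `[a, b] f (fun y => y ^+ 2)) cf.
by move=> y _; exact: exprn_continuous.
Qed.

Lemma continuous_H1 v dv : H1 v dv -> {within `[0, 1], continuous v}.
Proof.
move=> [Ldv vE].
have cdv := continuous_primitive ler01 (L2_integrable_cc Ldv).
apply/within_continuousP => t t01 e e0.
have [d d0 Hd] := (within_continuousP _ _).1 cdv t t01 e e0.
exists d => // s s01 st; rewrite /= in_itv/= in t01; have := s01; rewrite /= in_itv/= => s01'.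
by rewrite (vE s)// (vE t)// opprD addrACA subrr add0r; exact: Hd.
Qed.

Lemma H1_L2 v dv : H1 v dv -> L2 `[0, 1] v.
Proof. by move=> /continuous_H1; exact: continuous_L2. Qed.

(** Writing [v] as a primitive of [dv] and exchanging the integrals on the
    triangle transfers the integration from [dv] to [f]. *)
Lemma by_parts f v dv : L2 `[0, 1] f -> H1 v dv ->
  \int[mu]_(x in `[0, 1]) (f x * v x) = v 0 * \int[mu]_(x in `[0, 1]) f x +
    \int[mu]_(s in `[0, 1]) (dv s * \int[mu]_(x in `[s, 1]) f x).
Proof.
move=> Lf [Ldv vE]; have [I1 I2 <-] := Fubini_triangle Lf Ldv.
rewrite -RintegralZl//; last exact: L2_integrable_cc.
rewrite -RintegralD//; last exact: (integrableZl _ _ (L2_integrable_cc Lf)).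
by apply: eq_Rintegral => x; rewrite inE /= in_itv/= => /vE ->; ring.
Qed.

Lemma by_parts_right f v dv : L2 `[0, 1] f -> H1 v dv ->
  \int[mu]_(x in `[0, 1]) (f x * v x) = v 1 * \int[mu]_(x in `[0, 1]) f x -
    \int[mu]_(s in `[0, 1]) (dv s * \int[mu]_(x in `[0, s]) f x).
Proof.
move=> Lf Hv; have [Ldv vE] := Hv; rewrite (by_parts Lf Hv).
have [I1 I2 _] := Fubini_triangle Lf Ldv; have [J1 _ _] := Fubini_triangle Ldv Lf.
have -> : \int[mu]_(s in `[0, 1]) (dv s * \int[mu]_(x in `[s, 1]) f x) =
   \int[mu]_(s in `[0, 1]) (dv s * (\int[mu]_(x in `[0, 1]) f x) -
                           dv s * \int[mu]_(x in `[0, s]) f x).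
  apply: eq_Rintegral => s; rewrite inE /= in_itv/= => s01.
  by rewrite (Rintegral_split s01) ?(L2_integrable_cc Lf)//; ring.
rewrite RintegralB//; last exact: (integrableZr _ _ (L2_integrable_cc Ldv)).
rewrite RintegralZr//; last exact: L2_integrable_cc.
by rewrite (vE 1) ?lexx ?ler01//; ring.
Qed.

Lemma L2_primitive f (c : R) : L2 `[0, 1] f ->
  H1 (fun x => c + \int[mu]_(s in `[0, x]) f s) f.
Proof.
move=> Lf; split => // x x01.
by rewrite set_itv1 Rintegral_set1 addr0.
Qed.

(** The inverse of the signed square [p |-> p |p|] is Hoelder continuous of
    exponent 1/2. *)
Let sqr_sub_le_signed (p q : R) : (p - q) ^+ 2 <= 2 * `|p * `|p| - q * `|q| |.
Proof.
wlog pq : p q / q <= p.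
  move=> H; have [/H //|/ltW/H] := lerP q p.
  by rewrite [X in _ <= _ * X -> _]distrC -sqrrN opprB.
have pq0 : 0 <= p - q by rewrite subr_ge0.
have [p0|p0] := lerP 0 p; have [q0|q0] := lerP 0 q;
  rewrite ?(ger0_norm p0) ?(ger0_norm q0) ?(ltr0_norm p0) ?(ltr0_norm q0).
- have := mulr_ge0 pq0 p0; have := mulr_ge0 pq0 q0.
  rewrite ger0_norm; nra.
- have := sqr_ge0 (p + q); have := sqr_ge0 p; have := sqr_ge0 q.
  rewrite ger0_norm; nra.
- lra.
- have := mulr_ge0 pq0 (ltW (_ : 0 < - p)); have := mulr_ge0 pq0 (ltW (_ : 0 < - q)).
  rewrite !oppr_gt0 => /(_ q0) ? /(_ p0) ?.
  rewrite ger0_norm; nra.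
Qed.

(** The signed square [f = h |h|] is integrable and satisfies
    [(h x - h y)^2 <= 2 |f x - f y|], so that the continuity of translations in
    L^2 follows from their continuity in L^1, hence from the density of
    continuous functions. *)
Lemma L2_translation_continuous h (a b e : R) : a <= b -> L2loc h -> 0 < e ->
  exists2 d, 0 < d & forall r, `|r| < d ->
    \int[mu]_(x in `[a, b]) (h (x + r) - h x) ^+ 2 < e.
Proof.
move=> ab Lh e0; have [mh Lab] := Lh.
have arith (A B C : R) : A < e / 8 -> B < e / 8 -> C <= e / 8 -> 2 * (A + B + C) < e.
  by move: e0; clear; lra.
pose f x := h x * `|h x|.
have mf : measurable_fun setT f.
  by apply: measurable_funM => //; exact: measurableT_comp.
have mK : measurable (`[a - 1, b + 1] : set mR) by [].
have intf c d : mu.-integrable `[c, d] (EFin \o f).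
  have mcd : measurable (`[c, d] : set mR) by [].
  apply: (le_integrable mcd _ _ (L2_sq (Lab c d))).
    by apply/measurable_EFinP; exact: measurable_funTS.
  move=> x _; rewrite /= lee_fin /f normrM normr_id normrX expr2//.
have [g_ [cg_ ig_ cvg_g]] := approximation_continuous_integrable mK (mu_cc_fin _ _)
  (intf (a - 1) (b + 1)).
have [g [cg ig fg]] : exists g, [/\ continuous g,
    mu.-integrable `[a - 1, b + 1] (EFin \o g) &
    \int[mu]_(x in `[a - 1, b + 1]) `|f x - g x| < e / 8].
  have e8 : 0 < e / 8 by rewrite divr_gt0.
  have /fine_cvgP[_ /cvgrPdist_lt /(_ _ e8) [N _ HN]] := cvg_g.
  exists (g_ N); split => //.
  have := HN N (leqnn N); rewrite /= sub0r normrN ger0_norm//.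
  by apply: fine_ge0; apply: integral_ge0.
pose e' := e / (8 * (b - a + 1)).
have e'0 : 0 < e' by rewrite divr_gt0// mulr_gt0//; lra.
have unif : \forall r \near (0 : R), `[a, b]%classic `<=` [set x | `|g (x + r) - g x| < e'].
  have [/(_ (@segment_compact R a b)) cov _] := compact_near_coveringP `[a, b]%classic.
  apply: (cov R (nbhs (0 : R)) (fun r x => `|g (x + r) - g x| < e')) => x _.
  have [d1 /= d10 H1] : exists2 d, 0 < d & forall y, `|x - y| < d -> `|g x - g y| < e' / 2.
    have e2 : 0 < e' / 2 by rewrite divr_gt0.
    have /cvgrPdist_lt /(_ _ e2) [d /= d0 Hd] := cg x.
    by exists d => // y xy; exact: Hd.
  exists (ball x (d1 / 2), ball 0 (d1 / 2)).
    by split; apply: nbhsx_ballx; rewrite divr_gt0.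
  move=> [y r] [/= xy r0]; rewrite /ball /= in xy; rewrite /ball /= sub0r normrN in r0.
  have A1 := H1 y; have A2 := H1 (y + r).
  have -> : g (y + r) - g y = (g x - g y) - (g x - g (y + r)) by ring.
  apply: le_lt_trans (ler_normB _ _) _.
  rewrite (splitr e'); apply: ltrD; [apply: A1; lra|apply: A2].
  have -> : x - (y + r) = (x - y) - r by ring.
  apply: le_lt_trans (ler_normB _ _) _; lra.
have [d /= d0 Hd] := unif.
exists (Num.min d 1); first by rewrite lt_min d0 ltr01.
move=> r; rewrite lt_min => /andP[rd r1].
have gr x : a <= x <= b -> `|g (x + r) - g x| < e'.
  move=> xab; apply: (Hd r); last by rewrite /= in_itv.
  by rewrite /ball /= sub0r normrN.
have mab : measurable (`[a, b] : set mR) by [].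
have iS (u : R -> R) (c : R) : `|c| < 1 -> mu.-integrable `[a - 1, b + 1] (EFin \o u) ->
    mu.-integrable `[a, b] (EFin \o (fun x => u (x + c))).
  rewrite ltr_norml => /andP[c1 c2] iu.
  have mac : measurable (`[a + c, b + c] : set mR) by [].
  have iac : mu.-integrable `[a + c, b + c] (EFin \o u).
    apply: integrableS iu => // x /=; rewrite !in_itv/= => /andP[? ?]; apply/andP; split; lra.
  by have := @integrable_shift R c _ _ mac iac; rewrite shift_preimage_cc !addrK.
have iu := integrableB mK (intf _ _) ig.
have ifg c : `|c| < 1 ->
    mu.-integrable `[a, b] (EFin \o (fun x => `|f (x + c) - g (x + c)|)).
  by move=> c1; exact: (iS (fun x => `|f x - g x|) _ c1 (integrable_norm iu)).
have ifg_le c : `|c| < 1 -> \int[mu]_(x in `[a, b]) `|f (x + c) - g (x + c)| < e / 8.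
  move=> c1; apply: le_lt_trans fg; move: (c1); rewrite ltr_norml => /andP[c1' c2].
  have := @Rintegral_shift R (a + c) (b + c) c (fun x => `|f x - g x|).
  rewrite !addrK => ->.
    apply: sub_Rintegral; [lra|lra|by []|exact: (integrable_norm iu)].
  apply: measurable_funTS; apply: measurableT_comp => //; apply: measurable_funB => //.
  exact: continuous_measurable_fun.
have r00 : `|0 : R| < 1 by rewrite normr0.
have ie' : mu.-integrable `[a, b] (EFin \o (fun=> e')) by exact: integrable_cst_cc.
have i1 := integrableD mab (integrableD mab (ifg r r1) (ifg 0 r00)) ie'.
apply: (@le_lt_trans _ _ (\int[mu]_(x in `[a, b])
   (2 * (`|f (x + r) - g (x + r)| + `|f (x + 0) - g (x + 0)| + e')))).
  apply: le_Rintegral => //.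
  - exact: (L2_sq (L2B _ (L2_shift_cc (Lab _ _)) (Lab _ _))).
  - exact: (integrableZl mab 2 i1).
  move=> x; rewrite /= in_itv/= => xab; rewrite !addr0.
  apply: (@le_trans _ _ (2 * `|f (x + r) - f x|)).
    exact: sqr_sub_le_signed.
  rewrite ler_wpM2l//.
  have -> : f (x + r) - f x = (f (x + r) - g (x + r)) - (f x - g x) + (g (x + r) - g x) by ring.
  apply: le_trans (ler_normD _ _) _; apply: lerD; last exact: ltW (gr x xab).
  exact: ler_normB.
rewrite RintegralZl//.
rewrite RintegralD//; last exact: (integrableD mab (ifg r r1) (ifg 0 r00)).
rewrite RintegralD//; [|exact: ifg|exact: ifg].
have H1 := ifg_le r r1; have H2 := ifg_le 0 r00.
rewrite Rintegral_cst_cc//.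
have H3 : e' * (b - a) <= e / 8.
  apply: (@le_trans _ _ (e' * (b - a + 1))).
    by rewrite ler_wpM2l ?(ltW e'0)// lerDl.
  rewrite /e' le_eqVlt; apply/orP; left; apply/eqP; field.
  by apply: lt0r_neq0; lra.
exact: arith.
Qed.

End local_L2.

(** * Uniqueness of finite-energy solutions *)

Section uniqueness.
Context (R : realType).
Notation mu := (@lebesgue_measure R).
Notation mR := (measurableTypeR R).
Implicit Types (f g h k v dv : R -> R).

Let m01 : measurable (`[0, 1] : set mR). Proof. exact: measurable_itv. Qed.

Definition inner f g := \int[mu]_(x in `[0, 1]) (f x * g x).
Notation nrm := (L2norm `[0, 1]).
Notation L201 := (L2 `[0, 1]).

Lemma Rintegral0_eq D f : (forall x, D x -> f x = 0) -> \int[mu]_(x in D) f x = 0.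
Proof. by move=> f0; rewrite /Rintegral integral0_eq// => x Dx; rewrite f0. Qed.

Lemma innerC f g : inner f g = inner g f.
Proof. by apply: eq_Rintegral => x _; rewrite mulrC. Qed.

Lemma innerDl f g k : L201 f -> L201 g -> L201 k ->
  inner (fun x => f x + g x) k = inner f k + inner g k.
Proof.
move=> Lf Lg Lk; rewrite /inner -RintegralD//; try exact: L2_mul.
by apply: eq_Rintegral => x _; rewrite mulrDl.
Qed.

Lemma innerBl f g k : L201 f -> L201 g -> L201 k ->
  inner (fun x => f x - g x) k = inner f k - inner g k.
Proof.
move=> Lf Lg Lk; rewrite /inner -RintegralB//; try exact: L2_mul.
by apply: eq_Rintegral => x _; rewrite mulrBl.
Qed.

Lemma innerDr f g k : L201 f -> L201 g -> L201 k ->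
  inner k (fun x => f x + g x) = inner k f + inner k g.
Proof. by move=> Lf Lg Lk; rewrite innerC innerDl// !(innerC k). Qed.

Lemma innerBr f g k : L201 f -> L201 g -> L201 k ->
  inner k (fun x => f x - g x) = inner k f - inner k g.
Proof. by move=> Lf Lg Lk; rewrite innerC innerBl// !(innerC k). Qed.

Lemma innerZl f k (a : R) : L201 f -> L201 k ->
  inner (fun x => a * f x) k = a * inner f k.
Proof.
move=> Lf Lk; rewrite /inner -RintegralZl//; try exact: L2_mul.
by apply: eq_Rintegral => x _; rewrite mulrA.
Qed.

Lemma normr_inner f g : L201 f -> L201 g -> `|inner f g| <= nrm f * nrm g.
Proof. exact: normr_inner_le. Qed.

Lemma L2norm_lt D f (e : R) : 0 < e -> \int[mu]_(x in D) f x ^+ 2 < e ^+ 2 ->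
  L2norm D f < e.
Proof.
move=> e0 fe; rewrite -(ger0_norm (ltW e0)) -sqrtr_sqr ltr_sqrt//.
by rewrite exprn_gt0.
Qed.

Lemma L2norm_sym f g : nrm (fun x => f x - g x) = nrm (fun x => g x - f x).
Proof.
by congr Num.sqrt; apply: eq_Rintegral => x _; rewrite -sqrrN opprB.
Qed.

Lemma L2norm_near f g (e : R) : L201 f -> L201 g ->
  nrm (fun x => f x - g x) <= e -> nrm f <= nrm g + e.
Proof.
move=> Lf Lg fg; apply: (@le_trans _ _ (nrm (fun x => g x + (f x - g x)))).
  rewrite le_eqVlt; apply/orP; left; apply/eqP; congr Num.sqrt.
  by apply: eq_Rintegral => x _; congr (_ ^+ 2); ring.
apply: le_trans (ler_L2normD _ Lg (L2B m01 Lf Lg)) _ => //.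
by rewrite lerD2l.
Qed.

Lemma sqr_Rintegral_le f (a b : R) : L201 f -> 0 <= a -> a <= b -> b <= 1 ->
  (\int[mu]_(x in `[a, b]) f x) ^+ 2 <= \int[mu]_(x in `[0, 1]) f x ^+ 2.
Proof.
move=> Lf a0 ab b1.
have L1 : L2 `[a, b] f by apply: L2_subset_cc Lf.
have Lc : L2 `[a, b] (fun=> 1 : R).
  by apply: continuous_L2; apply: continuous_subspaceT => y; exact: cst_continuous.
have mab : measurable (`[a, b] : set mR) by [].
have q0 y : 0 <= f y ^+ 2 by exact: sqr_ge0.
have := Cauchy_Schwarz mab L1 Lc; under eq_Rintegral do rewrite mulr1.
move=> /le_trans; apply.
under [X in _ * X]eq_Rintegral do rewrite expr1n.
rewrite Rintegral_cst_cc// mul1r.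
apply: (@le_trans _ _ ((\int[mu]_(y in `[a, b]) f y ^+ 2) * 1)).
  by rewrite ler_wpM2l//; [apply: Rintegral_ge0 => y _|lra].
by rewrite mulr1; apply: sub_Rintegral => //; exact: L2_sq.
Qed.

Lemma L2_continuousP (T : \bar R) (f : R -> R -> R) (t : R) :
  L2_continuous T f -> time_itv T t -> forall e, 0 < e ->
  exists2 d, 0 < d & forall s, time_itv T s -> `|s - t| < d ->
    nrm (fun x => f s x - f t x) < e.
Proof.
move=> cf tT e e0; have e20 : 0 < e ^+ 2 by rewrite exprn_gt0.
have [d d0 Hd] := (cvg_withinP _ _ _ _).1 (cf t tT) _ e20.
exists d => // s sT st; apply: L2norm_lt => //.
by have := Hd s sT st; rewrite subr0; apply: le_lt_trans; exact: ler_norm.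
Qed.

Lemma L2_differentiableP (T : \bar R) (f df : R -> R -> R) (t : R) :
  L2_differentiable T f df -> time_itv T t -> forall e, 0 < e ->
  exists2 d, 0 < d & forall s, time_itv T s -> s != t -> `|s - t| < d ->
    nrm (fun x => (f s x - f t x) / (s - t) - df t x) < e.
Proof.
move=> cf tT e e0; have e20 : 0 < e ^+ 2 by rewrite exprn_gt0.
have [d d0 Hd] := (cvg_within_dnbhsP _ _ _ _).1 (cf t tT) _ e20.
exists d => // s sT sNt st; apply: L2norm_lt => //.
by have := Hd s sT sNt st; rewrite subr0; apply: le_lt_trans; exact: ler_norm.
Qed.

Lemma time_itv_le (T : \bar R) (t s : R) : time_itv T t -> 0 <= s <= t -> time_itv T s.
Proof.
move=> [t0 tT] /andP[s0 st]; split => //.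
by apply: le_trans tT; rewrite lee_fin.
Qed.

Lemma integrable_inner (T : \bar R) (f : R -> R -> R) k (a b : R) :
  L2_continuous T f -> (forall t, time_itv T t -> L201 (f t)) -> L201 k ->
  0 <= a -> time_itv T b ->
  mu.-integrable `[a, b] (EFin \o (fun s => inner (f s) k)).
Proof.
move=> cf Lf Lk a0 bT.
have sub s : `[a, b]%classic s -> time_itv T s.
  by rewrite /= in_itv/= => /andP[as_ sb]; apply: time_itv_le bT _; rewrite sb (le_trans a0).
apply: continuous_compact_integrable; first exact: segment_compact.
apply/within_continuousP => t /sub tT e e0.
have k0 : 0 < nrm k + 1 by rewrite ltr_wpDl// L2norm_ge0.
have [d d0 Hd] := L2_continuousP cf tT (divr_gt0 e0 k0).
exists d => // s /sub sT st; rewrite -innerBl; try exact: Lf; last exact: Lk.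
apply: le_lt_trans (normr_inner (L2B m01 (Lf s sT) (Lf t tT)) Lk) _.
have := Hd s sT st; rewrite ltr_pdivlMr// => H; apply: le_lt_trans H.
by rewrite ler_wpM2l ?L2norm_ge0// lerDl.
Qed.

(** Composing with the projection [cl] onto [[0, b]] turns the one-sided
    derivatives at the ends into derivatives, so that the mean value theorem on
    the whole line applies. *)
Lemma zero_slope_constant (f : R -> R) (b : R) : 0 <= b ->
  (forall t, 0 <= t <= b -> forall e, 0 < e -> exists2 d, 0 < d &
    forall s, 0 <= s <= b -> `|s - t| < d -> `|f s - f t| <= e * `|s - t|) ->
  f b = f 0.
Proof.
move=> b0 H; pose cl (t : R) := if t <= 0 then 0 else if b <= t then b else t.
have clI t : 0 <= cl t <= b.
  by rewrite /cl; case: (lerP t 0) => ?; [|case: (lerP b t) => ?]; apply/andP; split; lra.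
have cl_lip s t : `|cl s - cl t| <= `|s - t|.
  have H1 := ler_norm (s - t); have H2 := ler_norm (- (s - t)).
  rewrite normrN in H2; have H3 := normr_ge0 (s - t).
  move: H1 H2 H3; set m := `|s - t|; rewrite ler_norml /cl; clear -b0.
  case: (lerP s 0) => ?; case: (lerP t 0) => ?; case: (lerP b s) => ?;
    case: (lerP b t) => ?; move=> *; apply/andP; split; lra.
have cl0 : cl 0 = 0 by rewrite /cl lexx.
have clb : cl b = b by rewrite /cl; case: (lerP b 0) => ?; rewrite ?lexx//; lra.
suff : (f \o cl) b = (f \o cl) 0 by rewrite /= clb cl0.
apply: is_derive_0_is_cst => t.
have D : forall e, 0 < e -> \forall h \near (0 : R)^', `|h^-1 * (f (cl (h + t)) - f (cl t))| < e.
  move=> e e0; have e20 : 0 < e / 2 by rewrite divr_gt0.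
  have [d d0 Hd] := H (cl t) (clI t) _ e20.
  exists d => //= h; rewrite /ball /= sub0r normrN => hd h0.
  have := Hd (cl (h + t)) (clI _); have := cl_lip (h + t) t; rewrite addrK => clh.
  move=> /(_ (le_lt_trans clh hd)) H1.
  have h0' : 0 < `|h| by rewrite normr_gt0.
  rewrite normrM normfV ltr_pdivrMl//.
  apply: (le_lt_trans H1); apply: (@le_lt_trans _ _ (e / 2 * `|h|)).
    by rewrite ler_wpM2l// ltW.
  by rewrite mulrC ltr_pM2l//; lra.
have cvg0 : h^-1 *: ((f \o cl \o shift t) (h *: (1 : R)) - (f \o cl) t) @[h --> (0 : R)^'] --> (0 : R).
  apply/cvgrPdist_lt => e e0; apply: filterS (D e e0) => h.
  by rewrite sub0r normrN /= /GRing.scale /= mulr1.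
apply: DeriveDef; first by apply/cvg_ex; exists 0.
by rewrite /derive; apply/cvg_lim.
Qed.

(** ** The energy of a homogeneous solution *)

Section energy.
Variables (T : \bar R) (w wx wt : R -> R -> R).
Hypothesis H1w : forall t, time_itv T t -> H1 (w t) (wx t).
Hypothesis L2wt : forall t, time_itv T t -> L201 (wt t).
Hypothesis w0 : forall t, time_itv T t -> w t 0 = 0.
Hypothesis w_init : forall x, 0 <= x <= 1 -> w 0 x = 0.
Hypothesis wt_init : \forall x \ae mu, 0 <= x <= 1 -> wt 0 x = 0.
Hypothesis cw : forall t, time_itv T t -> forall e, 0 < e ->
  exists2 d, 0 < d & forall s, time_itv T s -> `|s - t| < d ->
    nrm (fun x => w s x - w t x) < e.
Hypothesis cwx : forall t, time_itv T t -> forall e, 0 < e ->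
  exists2 d, 0 < d & forall s, time_itv T s -> `|s - t| < d ->
    nrm (fun x => wx s x - wx t x) < e.
Hypothesis cwt : forall t, time_itv T t -> forall e, 0 < e ->
  exists2 d, 0 < d & forall s, time_itv T s -> `|s - t| < d ->
    nrm (fun x => wt s x - wt t x) < e.
Hypothesis dw : forall t, time_itv T t -> forall e, 0 < e ->
  exists2 d, 0 < d & forall s, time_itv T s -> s != t -> `|s - t| < d ->
    nrm (fun x => (w s x - w t x) / (s - t) - wt t x) < e.
Hypothesis iwx : forall k a b, L201 k -> 0 <= a -> time_itv T b ->
  mu.-integrable `[a, b] (EFin \o (fun s => inner (wx s) k)).
Hypothesis weak : forall v dv, H1 v dv -> v 0 = 0 -> forall t, time_itv T t ->
  inner (wt t) v = - \int[mu]_(s in `[0, t]) inner (wx s) dv.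

(** Formally [V_x = - wt] and [V_t = - wx], so that the time derivative of
    [int (w ^ 2 + V ^ 2)] is [-2] times the increment of [w V] between 0 and 1,
    which vanishes since [w] is zero at 0 and [V] at 1.  Unlike the natural energy
    [int (wx ^ 2 + wt ^ 2)], this one involves only quantities whose time
    derivatives are functions. *)
Let V t x := \int[mu]_(s in `[x, 1]) wt t s.

Let L2w t : time_itv T t -> L201 (w t). Proof. by move=> /H1w /H1_L2. Qed.
Let L2wx t : time_itv T t -> L201 (wx t). Proof. by move=> /H1w []. Qed.

Let VE t x : time_itv T t -> 0 <= x <= 1 ->
  V t x = \int[mu]_(s in `[0, 1]) wt t s - \int[mu]_(s in `[0, x]) wt t s.
Proof.
move=> tT x01; rewrite (Rintegral_split x01) ?(addrC (\int[mu]_(s in `[0, x]) _)) ?addrK//.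
exact/L2_integrable_cc/L2wt.
Qed.

Let L2V t : time_itv T t -> L201 (V t).
Proof.
move=> tT; pose c := \int[mu]_(s in `[0, 1]) wt t s.
have L1 := H1_L2 (L2_primitive 0 (L2wt tT)).
have Lc : L201 (cst c) by apply: continuous_L2; apply: continuous_subspaceT => x; exact: cst_continuous.
apply: eq_L2 (L2B m01 Lc L1) => // x /=; rewrite in_itv/= => x01.
by rewrite VE// add0r.
Qed.

Let wtV t k dk : time_itv T t -> H1 k dk -> k 0 = 0 -> inner (wt t) k = inner dk (V t).
Proof.
by move=> tT Hk k0; rewrite /inner (by_parts (L2wt tT) Hk) k0 mul0r add0r.
Qed.

(** Testing the equation with the primitive of an arbitrary [eta] in L^2 says
    that [V] is a primitive in time of [- wx]. *)
Let V_increment eta a b : L201 eta -> 0 <= a <= b -> time_itv T b ->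
  inner (V b) eta - inner (V a) eta = - \int[mu]_(r in `[a, b]) inner (wx r) eta.
Proof.
move=> Le /andP[a0 ab] bT; have aT : time_itv T a by apply: time_itv_le bT _; rewrite a0.
have Hp := L2_primitive 0 Le.
have p0 : 0 + \int[mu]_(s in `[0, 0]) eta s = 0 by rewrite set_itv1 Rintegral_set1 addr0.
rewrite !(innerC (V _)) -(wtV bT Hp p0) -(wtV aT Hp p0) (weak Hp p0 bT) (weak Hp p0 aT).
rewrite (@Rintegral_split _ 0 a b) ?a0//; last exact: iwx.
ring.
Qed.

Let nrmV t : time_itv T t -> nrm (V t) <= nrm (wt t).
Proof.
move=> tT; apply: L2norm_le; first exact: L2norm_ge0.
rewrite sqr_L2norm -[leRHS]mulr1 -[X in _ * X](subr0 1) -Rintegral_cst_cc//.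
apply: le_Rintegral => //; [exact: (L2_sq (L2V tT))|exact: integrable_cst_cc|].
move=> x; rewrite /= in_itv/= => /andP[x0 x1].
by apply: sqr_Rintegral_le => //; exact: L2wt.
Qed.

Let E t := \int[mu]_(x in `[0, 1]) w t x ^+ 2 + \int[mu]_(x in `[0, 1]) V t x ^+ 2.

Let innerE f : \int[mu]_(x in `[0, 1]) f x ^+ 2 = inner f f.
Proof. by apply: eq_Rintegral => x _; rewrite expr2. Qed.

Let addr_near_le (p q e : R) : p <= q + e -> p + q <= 2 * q + e.
Proof. lra. Qed.

(** The energy identity in difference form: [E b - E a] factors as increments
    against sums, and integration by parts cancels the principal terms.  The time
    [t] around which the increments are expanded is either end of [[a, b]], and
    [s] is the other one. *)
Let energy_step a b t s (e : R) : 0 <= a -> a < b -> time_itv T b ->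
  (t = a /\ s = b) \/ (t = b /\ s = a) -> e <= 1 ->
  nrm (fun x => w s x - w t x) <= e ->
  nrm (fun x => wt s x - wt t x) <= e ->
  nrm (fun x => (w s x - w t x) / (s - t) - wt t x) <= e ->
  (forall r, a <= r <= b -> nrm (fun x => wx r x - wx t x) <= e) ->
  `|E b - E a| <= (b - a) * (e * (3 * nrm (w t) + 3 * nrm (wt t) + 2)).
Proof.
move=> a0 ab bT cas e1 ews ewts edw ewx.
have bB : 0 <= b by case: bT.
have aT : time_itv T a by apply: time_itv_le bT _; rewrite a0 ltW.
have [tT sT] : time_itv T t /\ time_itv T s by case: cas => -[-> ->].
have e0 : 0 <= e by apply: le_trans ews; exact: L2norm_ge0.
have ba0 : 0 < b - a by rewrite subr_gt0.
have [Lwa Lwb Lws Lwt] := And4 (L2w aT) (L2w bT) (L2w sT) (L2w tT).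
have [Lta Ltb Lts Ltt] := And4 (L2wt aT) (L2wt bT) (L2wt sT) (L2wt tT).
have [LVa LVb] := (L2V aT, L2V bT).
have Lxt := L2wx tT.
pose G := fun x => V b x + V a x; have LG : L201 G by exact: L2D.
pose S := fun x => w b x + w a x; have LS : L201 S by exact: L2D.
pose Dq := fun x => (b - a)^-1 * (w b x - w a x).
have LDq : L201 Dq by apply: L2Z => //; exact: L2B.
have DqE x : (w s x - w t x) / (s - t) = Dq x.
  rewrite /Dq mulrC; case: cas => -[-> ->] //.
  by rewrite -(opprB b a) invrN mulNr -mulrN opprB.
have EE : E b - E a = (b - a) * inner Dq S + (inner (V b) G - inner (V a) G).
  rewrite /E !innerE /Dq innerZl//; last exact: L2B.
  rewrite mulrA divff ?gt_eqF// mul1r innerBl// !innerDr//.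
  rewrite (innerC (w a) (w b)) (innerC (V a) (V b)).
  move: (inner (w b) (w b)) (inner (w b) (w a)) (inner (w a) (w a)).
  by move: (inner (V b) (V b)) (inner (V b) (V a)) (inner (V a) (V a)) => *; ring.
have VG : inner (V b) G - inner (V a) G =
    - ((b - a) * inner (wx t) G) - \int[mu]_(r in `[a, b]) (inner (wx r) G - inner (wx t) G).
  rewrite V_increment//; last by rewrite a0 ltW.
  rewrite RintegralB//; [|exact: iwx|exact: integrable_cst_cc].
  rewrite Rintegral_cst_cc ?(ltW ab)//; ring.
have J : `|\int[mu]_(r in `[a, b]) (inner (wx r) G - inner (wx t) G)| <= (b - a) * (e * nrm G).
  have mab : measurable (`[a, b] : set mR) by [].
  have iB := integrableB mab (iwx LG a0 bT) (integrable_cst_cc a b (inner (wx t) G)).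
  apply: (le_trans (le_normr_Rintegral mab iB)).
  apply: (@le_trans _ _ (\int[mu]_(r in `[a, b]) (e * nrm G))); last first.
    by rewrite Rintegral_cst_cc ?(ltW ab)// mulrC.
  apply: le_Rintegral => //; [exact: (integrable_norm iB)|exact: integrable_cst_cc|].
  move=> r; rewrite /= in_itv/= => /[dup] rab /andP[ar rb].
  have rT : time_itv T r by apply: time_itv_le bT _; rewrite rb (le_trans a0).
  rewrite -innerBl//; last exact: L2wx.
  apply: le_trans (normr_inner (L2B m01 (L2wx rT) Lxt) LG) _.
  by rewrite ler_wpM2r ?L2norm_ge0// ewx.
have wtS : inner (wt t) S - inner (wx t) G =
    inner (wt t) (fun x => w s x - w t x) - inner (fun x => wt s x - wt t x) (w t).
  have wxV c : time_itv T c -> inner (wx t) (V c) = inner (wt c) (w t).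
    by move=> cT; rewrite (wtV cT (H1w tT) (w0 tT)).
  rewrite (_ : inner (wt t) S = inner (wt t) (w b) + inner (wt t) (w a)); last exact: innerDr.
  rewrite (_ : inner (wx t) G = inner (wx t) (V b) + inner (wx t) (V a)); last exact: innerDr.
  rewrite innerBr// innerBl// (wxV b bT) (wxV a aT).
  by case: cas => -[-> ->]; ring.
have nS : nrm S <= 2 * nrm (w t) + e.
  apply: (le_trans (ler_L2normD m01 Lwb Lwa)).
  have := L2norm_near Lws Lwt ews.
  by case: cas => -[-> ->] ?; [|rewrite addrC]; exact: addr_near_le.
have nG : nrm G <= 2 * nrm (wt t) + e.
  apply: (le_trans (ler_L2normD m01 LVb LVa)).
  apply: (le_trans (lerD (nrmV bT) (nrmV aT))).
  have := L2norm_near Lts Ltt ewts.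
  by case: cas => -[-> ->] ?; [|rewrite addrC]; exact: addr_near_le.
have I1 : `|inner (fun x => Dq x - wt t x) S| <= e * nrm S.
  apply: le_trans (normr_inner (L2B m01 LDq Ltt) LS) _.
  rewrite ler_wpM2r ?L2norm_ge0//; apply: le_trans edw.
  rewrite le_eqVlt; apply/orP; left; apply/eqP; congr Num.sqrt.
  by apply: eq_Rintegral => x _; rewrite DqE.
have I2 : `|inner (wt t) (fun x => w s x - w t x)| <= nrm (wt t) * e.
  apply: le_trans (normr_inner Ltt (L2B m01 Lws Lwt)) _.
  by rewrite ler_wpM2l ?L2norm_ge0.
have I3 : `|inner (fun x => wt s x - wt t x) (w t)| <= e * nrm (w t).
  apply: le_trans (normr_inner (L2B m01 Lts Ltt) Lwt) _.
  by rewrite ler_wpM2r ?L2norm_ge0.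
rewrite innerBl// in I1.
set J0 := \int[mu]_(r in _) _ in J VG *.
rewrite EE VG.
have -> : (b - a) * inner Dq S + (- ((b - a) * inner (wx t) G) - J0) =
  (b - a) * ((inner Dq S - inner (wt t) S) + (inner (wt t) S - inner (wx t) G)) - J0 by ring.
rewrite wtS; apply: (le_trans (ler_normB _ _)).
rewrite normrM gtr0_norm//.
have W0 := L2norm_ge0 `[0, 1] (w t); have Wt0 := L2norm_ge0 `[0, 1] (wt t).
move: J I1 I2 I3 nS nG W0 Wt0 e0 e1 ba0.
move: (inner Dq S - inner (wt t) S) (inner (wt t) (fun x => w s x - w t x)) => A1 A2.
move: (inner (fun x => wt s x - wt t x) (w t)) => A3.
move: (nrm (w t)) (nrm (wt t)) (nrm S) (nrm G) => W Wt nS nG.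
move: (b - a) => c; clear => J I1 I2 I3 HnS HnG W0 Wt0 e0 e1 c0.
apply: (@le_trans _ _ (c * (e * nS + (Wt * e + e * W)) + c * (e * nG))).
  apply: lerD => //; rewrite ler_pM2l//.
  apply: (le_trans (ler_normD _ _)); apply: lerD => //.
  apply: (le_trans (ler_normB _ _)); exact: lerD.
rewrite -mulrDr ler_pM2l//.
have := ler_wpM2l e0 HnS; have := ler_wpM2l e0 HnG; have := ler_wpM2l e0 e1.
nra.
Qed.

Let E_slope t : time_itv T t -> forall e, 0 < e -> exists2 d, 0 < d &
  forall s, time_itv T s -> `|s - t| < d -> `|E s - E t| <= e * `|s - t|.
Proof.
move=> tT e e0.
pose C := 3 * nrm (w t) + 3 * nrm (wt t) + 2.
have C0 : 0 < C.
  by rewrite /C; have := L2norm_ge0 `[0, 1] (w t); have := L2norm_ge0 `[0, 1] (wt t); lra.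
pose e' := Num.min 1 (e / C).
have e'0 : 0 < e' by rewrite lt_min ltr01 divr_gt0.
have [d1 d10 Hd1] := cw tT e'0; have [d2 d20 Hd2] := cwx tT e'0.
have [d3 d30 Hd3] := cwt tT e'0; have [d4 d40 Hd4] := dw tT e'0.
exists (Num.min (Num.min d1 d2) (Num.min d3 d4)).
  by rewrite !lt_min d10 d20 d30 d40.
move=> s sT; rewrite !lt_min => /andP[/andP[st1 st2] /andP[st3 st4]].
have e'C : e' * C <= e.
  by rewrite -ler_pdivlMr// /e' ge_min lexx orbT.
have e'1 : e' <= 1 by rewrite /e' ge_min lexx.
have [sE|sNt] := eqVneq s t; first by rewrite sE !subrr normr0 mulr0.
have [t0 s0] : 0 <= t /\ 0 <= s by case: tT; case: sT.
have [ts|st] := ltP t s.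
  apply: (@le_trans _ _ ((s - t) * (e' * C))).
    apply: (@energy_step t s t s e') => //; try by left.
    - exact/ltW/Hd1.
    - exact/ltW/Hd3.
    - exact/ltW/Hd4.
    move=> r /andP[tr rs]; apply/ltW/Hd2.
      by apply: time_itv_le sT _; rewrite rs (le_trans t0).
    apply: le_lt_trans st2; rewrite ger0_norm ?subr_ge0// ger0_norm ?subr_ge0 ?(ltW ts)//.
    by rewrite lerD2r.
  by rewrite gtr0_norm ?subr_gt0// mulrC ler_pM2r ?subr_gt0.
have {}st : s < t by rewrite lt_neqAle sNt.
rewrite distrC [X in _ <= _ * X]distrC.
apply: (@le_trans _ _ ((t - s) * (e' * C))).
  apply: (@energy_step s t t s e') => //; try by right.
  - exact/ltW/Hd1.
  - exact/ltW/Hd3.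
  - exact/ltW/Hd4.
  move=> r /andP[sr rt]; apply/ltW/Hd2.
    by apply: time_itv_le tT _; rewrite rt (le_trans s0).
  apply: le_lt_trans st2; rewrite distrC [leRHS]distrC.
  rewrite ger0_norm ?subr_ge0// ger0_norm ?subr_ge0 ?(ltW st)//.
  by rewrite lerD2l lerN2.
by rewrite gtr0_norm ?subr_gt0// mulrC ler_pM2r ?subr_gt0.
Qed.

Let E0 t : time_itv T t -> E t = 0.
Proof.
move=> tT; have t0 : 0 <= t by case: tT.
have sub s : 0 <= s <= t -> time_itv T s by move=> st; exact: time_itv_le tT st.
have -> : E t = E 0.
  apply: zero_slope_constant => // r /sub rT e e0.
  by have [d d0 Hd] := E_slope rT e0; exists d => // s /sub; exact: Hd.
have T0 : time_itv T 0 by apply: sub; rewrite lexx.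
rewrite /E.
have -> : \int[mu]_(x in `[0, 1]) w 0 x ^+ 2 = 0.
  by apply: Rintegral0_eq => x; rewrite /= in_itv/= => x01; rewrite w_init// expr0n.
have V0 x : 0 <= x <= 1 -> V 0 x = 0.
  move=> /andP[x0 x1]; rewrite /V.
  rewrite (@Rintegral_ae_eq _ _ (wt 0) (fun=> 0))// ?Rintegral_cst_cc ?mul0r//.
    apply: ae_impl wt_init => y H /=; rewrite in_itv/= => /andP[xy y1].
    by apply: H; rewrite y1 (le_trans x0).
  by apply: measurable_funS (L2_measurable (L2wt T0)) => // y /=; rewrite !in_itv/= => /andP[xy ->]; rewrite (le_trans x0).
rewrite add0r; apply: Rintegral0_eq => x.
by rewrite /= in_itv/= => x01; rewrite V0// expr0n.
Qed.

(** Zero energy annihilates [w] and [V], hence the integrands [wx] and [wt] of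
    which they are primitives. *)
Lemma homogeneous_solution_eq0 t : time_itv T t ->
  [/\ forall x, 0 <= x <= 1 -> w t x = 0,
      \forall x \ae mu, 0 <= x <= 1 -> wx t x = 0 &
      \forall x \ae mu, 0 <= x <= 1 -> wt t x = 0].
Proof.
move=> tT; have Et := E0 tT.
have A0 : 0 <= \int[mu]_(x in `[0, 1]) w t x ^+ 2 by apply: Rintegral_ge0 => x _; exact: sqr_ge0.
have B0 : 0 <= \int[mu]_(x in `[0, 1]) V t x ^+ 2 by apply: Rintegral_ge0 => x _; exact: sqr_ge0.
have [wE VE0] : \int[mu]_(x in `[0, 1]) w t x ^+ 2 = 0 /\ \int[mu]_(x in `[0, 1]) V t x ^+ 2 = 0.
  by move: Et A0 B0; rewrite /E; move: (integral) => _; lra.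
have w00 : forall x, 0 <= x <= 1 -> w t x = 0.
  apply: continuous_ae_eq0; [exact: ltr01|exact: continuous_H1 (H1w tT)|].
  by apply: ae_impl (sqint_eq0 m01 (L2w tT) wE) => x H x01; apply: H; rewrite /= in_itv.
have iwt := L2_integrable_cc (L2wt tT); have iwx' := L2_integrable_cc (L2wx tT).
split=> //.
  apply: (ae_eq0_primitive iwx') => x x01.
  have := (H1w tT).2 x x01; rewrite (w00 x x01) (w00 0) ?lexx ?ler01// add0r.
  by move=> <-.
have V00 : forall x, 0 <= x <= 1 -> V t x = 0.
  apply: continuous_ae_eq0; [exact: ltr01| |].
    have cp := continuous_primitive ler01 iwt.
    apply/within_continuousP => y y01 e e0.
    have [d d0 Hd] := (within_continuousP _ _).1 cp y y01 e e0.
    exists d => // s s01 st; have y01' : 0 <= y <= 1 by move: y01; rewrite /= in_itv.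
    have s01' : 0 <= s <= 1 by move: s01; rewrite /= in_itv.
    rewrite !VE// opprB addrC addrA subrK distrC; exact: Hd.
  by apply: ae_impl (sqint_eq0 m01 (L2V tT) VE0) => x H x01; apply: H; rewrite /= in_itv.
apply: (ae_eq0_primitive iwt) => x x01.
have := V00 0; rewrite lexx ler01 => /(_ isT); rewrite VE ?lexx ?ler01// set_itv1 Rintegral_set1 subr0 => V1.
by have := V00 x x01; rewrite VE// V1 sub0r => /eqP; rewrite oppr_eq0 => /eqP.
Qed.

End energy.

End uniqueness.

(** ** Comparison of two solutions *)

Section wave_uniqueness.
Context (R : realType).
Notation mu := (@lebesgue_measure R).
Notation mR := (measurableTypeR R).
Notation nrm := (L2norm `[0, 1]).
Notation L201 := (L2 `[0, 1]).

Let m01 : measurable (`[0, 1] : set mR). Proof. exact: measurable_itv. Qed.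

Lemma H1B (v dv k dk : R -> R) : H1 v dv -> H1 k dk ->
  H1 (fun x => v x - k x) (fun x => dv x - dk x).
Proof.
move=> [Ldv vE] [Ldk kE]; split; first exact: L2B.
move=> x x01; rewrite (vE x)// (kE x)//.
have sub : `[0, x]%classic `<=` (`[0, 1]%classic : set mR).
  by case/andP: x01 => _ x1 s /=; rewrite !in_itv/= => /andP[-> sx]; apply: le_trans x1.
rewrite RintegralB//; first ring.
  by apply: integrableS (L2_integrable_cc Ldv).
by apply: integrableS (L2_integrable_cc Ldk).
Qed.

Let near_sub (T : \bar R) (f g : R -> R -> R) t :
  (forall s, time_itv T s -> L201 (f s)) -> (forall s, time_itv T s -> L201 (g s)) ->
  L2_continuous T f -> L2_continuous T g -> time_itv T t ->
  forall e, 0 < e -> exists2 d, 0 < d & forall s, time_itv T s -> `|s - t| < d ->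
    nrm (fun x => (f s x - g s x) - (f t x - g t x)) < e.
Proof.
move=> Lf Lg cf cg tT e e0; have e20 : 0 < e / 2 by rewrite divr_gt0.
have [d1 d10 H1] := L2_continuousP cf tT e20.
have [d2 d20 H2] := L2_continuousP cg tT e20.
exists (Num.min d1 d2); first by rewrite lt_min d10.
move=> s sT; rewrite lt_min => /andP[st1 st2].
have Lf' := L2B m01 (Lf s sT) (Lf t tT); have Lg' := L2B m01 (Lg t tT) (Lg s sT).
rewrite (splitr e); apply: le_lt_trans (ltrD (H1 s sT st1) (H2 s sT st2)).
rewrite (L2norm_sym (g s)); apply: le_trans (ler_L2normD m01 Lf' Lg').
rewrite le_eqVlt; apply/orP; left; apply/eqP; congr Num.sqrt.
by apply: eq_Rintegral => x _; congr (_ ^+ 2); ring.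
Qed.

(** The difference of the two solutions is a homogeneous one: the boundary terms
    cancel under the time integral because [u] is integrable. *)
Lemma wave_solution_unique (T : \bar R) (y0 y1 u : R -> R) (y z : trajectory R) :
  (forall t, time_itv T t -> mu.-integrable `[0, t] (EFin \o u)) ->
  wave_solution T y0 y1 u y -> wave_solution T y0 y1 u z ->
  forall t, time_itv T t ->
  [/\ forall x, 0 <= x <= 1 -> pos y t x = pos z t x,
      \forall x \ae mu, 0 <= x <= 1 -> pos_x y t x = pos_x z t x &
      \forall x \ae mu, 0 <= x <= 1 -> pos_t y t x = pos_t z t x].
Proof.
move=> iu [[Hy cy cyx cyt dy] y_0 y_init yt_init y_weak].
move=> [[Hz cz czx czt dz] z_0 z_init zt_init z_weak] t tT.
pose w t x := pos y t x - pos z t x.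
pose wx t x := pos_x y t x - pos_x z t x.
pose wt t x := pos_t y t x - pos_t z t x.
have Ly s : time_itv T s -> L201 (pos y s) by move=> /Hy[/H1_L2].
have Lz s : time_itv T s -> L201 (pos z s) by move=> /Hz[/H1_L2].
have Lyx s : time_itv T s -> L201 (pos_x y s) by move=> /Hy[[]].
have Lzx s : time_itv T s -> L201 (pos_x z s) by move=> /Hz[[]].
have Lyt s : time_itv T s -> L201 (pos_t y s) by move=> /Hy[].
have Lzt s : time_itv T s -> L201 (pos_t z s) by move=> /Hz[].
have iyx k a b : L201 k -> 0 <= a -> time_itv T b ->
    mu.-integrable `[a, b] (EFin \o (fun s => inner (pos_x y s) k)).
  exact: integrable_inner.
have izx k a b : L201 k -> 0 <= a -> time_itv T b ->
    mu.-integrable `[a, b] (EFin \o (fun s => inner (pos_x z s) k)).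
  exact: integrable_inner.
have wxE s k : time_itv T s -> L201 k -> inner (wx s) k = inner (pos_x y s) k - inner (pos_x z s) k.
  by move=> sT Lk; rewrite -innerBl//; [exact: Lyx|exact: Lzx].
have subT b s : time_itv T b -> 0 <= s <= b -> time_itv T s by exact: time_itv_le.
have [] := @homogeneous_solution_eq0 R T w wx wt _ _ _ _ _ _ _ _ _ _ _ t tT.
- by move=> s sT; apply: H1B; [case: (Hy s sT)|case: (Hz s sT)].
- by move=> s sT; apply: L2B; [|exact: Lyt|exact: Lzt].
- by move=> s sT; rewrite /w y_0// z_0// subrr.
- by move=> x x01; rewrite /w y_init// z_init// subrr.
- apply: ae_impl2 yt_init zt_init => x A B x01.
  by rewrite /wt A// B// subrr.
- by move=> s sT; exact: near_sub.
- by move=> s sT; exact: near_sub.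
- by move=> s sT; exact: near_sub.
- move=> s sT e e0; have e20 : 0 < e / 2 by rewrite divr_gt0.
  have [d1 d10 H1] := L2_differentiableP dy sT e20.
  have [d2 d20 H2] := L2_differentiableP dz sT e20.
  exists (Num.min d1 d2); first by rewrite lt_min d10.
  move=> r rT rs; rewrite lt_min => /andP[rs1 rs2].
  have LDy : L201 (fun x => (pos y r x - pos y s x) / (r - s) - pos_t y s x).
    apply: L2B; [by []| |exact: Lyt].
    apply: (eq_L2 m01 _ (L2Z (r - s)^-1 m01 (L2B m01 (Ly r rT) (Ly s sT)))) => x _.
    by rewrite mulrC.
  have LDz : L201 (fun x => pos_t z s x - (pos z r x - pos z s x) / (r - s)).
    apply: L2B; [by []|exact: Lzt|].
    apply: (eq_L2 m01 _ (L2Z (r - s)^-1 m01 (L2B m01 (Lz r rT) (Lz s sT)))) => x _.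
    by rewrite mulrC.
  rewrite (splitr e); apply: le_lt_trans (ltrD (H1 r rT rs rs1) (H2 r rT rs rs2)).
  rewrite (L2norm_sym (fun x => (pos z r x - pos z s x) / (r - s))).
  apply: le_trans (ler_L2normD m01 LDy LDz).
  rewrite le_eqVlt; apply/orP; left; apply/eqP; congr Num.sqrt.
  apply: eq_Rintegral => x _; congr (_ ^+ 2); rewrite /w /wt.
  ring.
- move=> k a b Lk a0 bT; have mab : measurable (`[a, b] : set mR) by [].
  have := integrableB mab (iyx k a b Lk a0 bT) (izx k a b Lk a0 bT).
  apply: (eq_integrable mab) => s; rewrite inE /= in_itv/= => /andP[as_ sb].
  by rewrite wxE//; apply: subT bT _; rewrite sb (le_trans a0).
- move=> v dv Hv v0 s sT; have [Ldv _] := Hv; have Lv := H1_L2 Hv.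
  have s0 : time_itv T 0 by apply: (subT s) => //; rewrite lexx; case: sT.
  have m0s : measurable (`[0, s] : set mR) by [].
  have gy := y_weak v dv Hv v0 s sT; have gz := z_weak v dv Hv v0 s sT.
  have ifl (g : R -> R) : mu.-integrable `[0, s] (EFin \o g) ->
      mu.-integrable `[0, s] (EFin \o (fun r => u r * v 1 - cst 0 r * v 0 - g r)).
    move=> ig; have := integrableB m0s (integrableZl m0s (v 1) (iu s sT)) ig.
    by apply: (eq_integrable m0s) => r _ /=; rewrite mul0r subr0 mulrC.
  have -> : inner (wt s) v = \int[mu]_(x in `[0, 1]) (pos_t y s x * v x) -
                             \int[mu]_(x in `[0, 1]) (pos_t z s x * v x).
    by rewrite innerBl//; [exact: Lyt|exact: Lzt].
  have y0z0 : \int[mu]_(x in `[0, 1]) (pos_t y 0 x * v x) =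
              \int[mu]_(x in `[0, 1]) (pos_t z 0 x * v x).
    apply: Rintegral_ae_eq => //.
    + apply: ae_impl2 yt_init zt_init => x A B; rewrite /= in_itv/= => x01.
      by rewrite A// B.
    + by apply: measurable_funM; [exact: L2_measurable (Lyt 0 s0)|exact: L2_measurable Lv].
    + by apply: measurable_funM; [exact: L2_measurable (Lzt 0 s0)|exact: L2_measurable Lv].
  move: gy gz; rewrite /green_identity y0z0 => gy gz.
  have -> : \int[mu]_(x in `[0, 1]) (pos_t y s x * v x) -
            \int[mu]_(x in `[0, 1]) (pos_t z s x * v x) =
    (\int[mu]_(x in `[0, 1]) (pos_t y s x * v x) - \int[mu]_(x in `[0, 1]) (pos_t z 0 x * v x)) -
    (\int[mu]_(x in `[0, 1]) (pos_t z s x * v x) - \int[mu]_(x in `[0, 1]) (pos_t z 0 x * v x)).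
    ring.
  rewrite gy gz -RintegralB//; first last.
    exact/ifl/izx.
    exact/ifl/iyx.
  rewrite -[RHS]mulN1r -RintegralZl//; last first.
    have := integrableB m0s (iyx dv 0 s Ldv (lexx 0) sT) (izx dv 0 s Ldv (lexx 0) sT).
    apply: (eq_integrable m0s) => r; rewrite inE /= in_itv/= => rs.
    by rewrite wxE//; exact: (subT s).
  apply: eq_Rintegral => r; rewrite inE /= in_itv/= => rs.
  rewrite wxE//; last exact: (subT s).
  by rewrite /inner; ring.
move=> w0 wx0 wt0; split.
- by move=> x x01; apply/eqP; rewrite -subr_eq0; apply/eqP; exact: w0.
- by apply: ae_impl wx0 => x H x01; apply/eqP; rewrite -subr_eq0; apply/eqP; exact: H.
- by apply: ae_impl wt0 => x H x01; apply/eqP; rewrite -subr_eq0; apply/eqP; exact: H.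
Qed.

(** Green's formula tested against the constant function 1 isolates the primitive
    of the trace. *)
Lemma trace_unique (T : \bar R) (u : R -> R) (y z : trajectory R) (g h : R -> R) :
  (forall t, time_itv T t -> mu.-integrable `[0, t] (EFin \o u)) ->
  finite_energy T y -> finite_energy T z ->
  (forall t, time_itv T t ->
    (\forall x \ae mu, 0 <= x <= 1 -> pos_x y t x = pos_x z t x) /\
    (\forall x \ae mu, 0 <= x <= 1 -> pos_t y t x = pos_t z t x)) ->
  trace_x0 T u y g -> trace_x0 T u z h ->
  forall t, time_itv T t -> \forall s \ae mu, 0 <= s <= t -> g s = h s.
Proof.
move=> iu [Hy _ _ _ _] [Hz _ _ _ _] yz [ig gg] [ih gh] t tT.
have cst1 : H1 (cst (1 : R)) (cst 0).
  split; first exact: L2_0.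
  by move=> x _; rewrite Rintegral0_eq// addr0.
have mt s : measurable (`[0, s] : set mR) by [].
have sub s : 0 <= s <= t -> time_itv T s by exact: time_itv_le.
have E s : time_itv T s -> \int[mu]_(r in `[0, s]) g r = \int[mu]_(r in `[0, s]) h r.
  move=> sT; have s0 : time_itv T 0 by apply: (time_itv_le sT); rewrite lexx; case: sT.
  have := gg _ _ cst1 s sT; have := gh _ _ cst1 s sT; rewrite /green_identity /=.
  have flux (f : R -> R) (k : trajectory R) : mu.-integrable `[0, s] (EFin \o f) ->
     \int[mu]_(r in `[0, s]) (u r * 1 - f r * 1 - \int[mu]_(x in `[0, 1]) (pos_x k r x * 0)) =
     \int[mu]_(r in `[0, s]) u r - \int[mu]_(r in `[0, s]) f r.
    move=> i_f; rewrite -RintegralB//; last exact: iu.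
    apply: eq_Rintegral => r _; rewrite !mulr1 Rintegral0_eq ?subr0// => x _.
    by rewrite mulr0.
  rewrite !flux; [|exact: ig|exact: ih].
  have same r : time_itv T r -> \int[mu]_(x in `[0, 1]) (pos_t y r x * 1) =
      \int[mu]_(x in `[0, 1]) (pos_t z r x * 1).
    move=> rT; apply: Rintegral_ae_eq => //.
    + apply: ae_impl (yz r rT).2 => x A; rewrite /= in_itv/= => x01; by rewrite A.
    + by apply: measurable_funM => //; case: (Hy r rT) => _ [].
    + by apply: measurable_funM => //; case: (Hz r rT) => _ [].
  by rewrite !same// => -> /addrI/oppr_inj.
have igh := integrableB (mt t) (ig t tT) (ih t tT).
have : \forall s \ae mu, 0 <= s <= t -> g s - h s = 0.
  apply: (ae_eq0_primitive igh) => s st.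
  have sT := sub s st.
  rewrite RintegralB//; [|exact: ig|exact: ih].
  by rewrite E// subrr.
by apply: ae_impl => s H st; apply/eqP; rewrite -subr_eq0; apply/eqP; exact: H.
Qed.

End wave_uniqueness.

(** * D'Alembert solutions *)

Section dAlembert.
Context (R : realType).
Notation mu := (@lebesgue_measure R).
Notation mR := (measurableTypeR R).
Notation nrm := (L2norm `[0, 1]).
Notation L201 := (L2 `[0, 1]).

Let m01 : measurable (`[0, 1] : set mR). Proof. exact: measurable_itv. Qed.

(** The position is [H (t + x) - H (t - x)] for any primitive [H] of [h]; the
    integral form singles out none. *)
Definition dAlembert (h : R -> R) : trajectory R := Trajectory
  (fun t x => \int[mu]_(s in `[0, x]) (h (t + s) + h (t - s)))
  (fun t x => h (t + x) + h (t - x))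
  (fun t x => h (t + x) - h (t - x)).

Variable h : R -> R.
Hypothesis Lh : L2loc h.
Notation y := (dAlembert h).

Lemma L2_advance t a b : L2 `[a, b] (fun x => h (t + x)).
Proof.
have -> : (fun x => h (t + x)) = (fun x => h (x + t)) by apply/funext => x; rewrite addrC.
by apply: L2_shift_cc; exact: Lh.2.
Qed.

Lemma L2_retard t a b : L2 `[a, b] (fun x => h (t - x)).
Proof. by apply: L2_reflect_cc; exact: Lh.2. Qed.

Let L2_pos_x t : L201 (pos_x y t).
Proof. exact: (L2D m01 (L2_advance t 0 1) (L2_retard t 0 1)). Qed.

Let L2_pos_t t : L201 (pos_t y t).
Proof. exact: (L2B m01 (L2_advance t 0 1) (L2_retard t 0 1)). Qed.

Let H1_pos t : H1 (pos y t) (pos_x y t).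
Proof.
split; first exact: L2_pos_x.
by move=> x x01; rewrite /= set_itv1 Rintegral_set1 add0r.
Qed.

Let mh a b : measurable_fun (`[a, b] : set R) h.
Proof. by apply: measurable_funTS; exact: Lh.1. Qed.

Lemma Rintegral_advance t a b :
  \int[mu]_(x in `[a, b]) h (t + x) = \int[mu]_(x in `[t + a, t + b]) h x.
Proof.
have := @Rintegral_shift R (t + a) (t + b) t h (@mh _ _); rewrite !(addrC t) !addrK => <-.
by apply: eq_Rintegral => x _; rewrite addrC.
Qed.

Lemma Rintegral_retard t a b :
  \int[mu]_(x in `[a, b]) h (t - x) = \int[mu]_(x in `[t - b, t - a]) h x.
Proof.
by have := @Rintegral_reflect R (t - b) (t - a) t h (@mh _ _); rewrite !subKr => <-.
Qed.

Lemma Rintegral_delay x a b :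
  \int[mu]_(r in `[a, b]) h (r - x) = \int[mu]_(r in `[a - x, b - x]) h r.
Proof.
have := @Rintegral_shift R (a - x) (b - x) (- x) h (@mh _ _).
by rewrite !opprK !subrK.
Qed.

Let ih a b : mu.-integrable `[a, b] (EFin \o h).
Proof. exact: L2loc_integrable. Qed.

(* An integral over [[c, t]] is zero when [t < c], so that increments of [prim c]
   are integrals of [h] only to the right of [c]. *)
Let prim c t := \int[mu]_(s in `[c, t]) h s.

Let primB c a b : c <= a <= b -> \int[mu]_(s in `[a, b]) h s = prim c b - prim c a.
Proof. by move=> cab; rewrite /prim (Rintegral_split cab (ih c b)) addrC addKr. Qed.

Let intD t a b : \int[mu]_(s in `[a, b]) (h (t + s) + h (t - s)) =
  \int[mu]_(s in `[a, b]) h (t + s) + \int[mu]_(s in `[a, b]) h (t - s).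
Proof.
rewrite RintegralD//; [exact: L2_integrable_cc (L2_advance t a b)|].
exact: L2_integrable_cc (L2_retard t a b).
Qed.

Let intB t a b : \int[mu]_(s in `[a, b]) (h (t + s) - h (t - s)) =
  \int[mu]_(s in `[a, b]) h (t + s) - \int[mu]_(s in `[a, b]) h (t - s).
Proof.
rewrite RintegralB//; [exact: L2_integrable_cc (L2_advance t a b)|].
exact: L2_integrable_cc (L2_retard t a b).
Qed.

Let pos_prim c t x : c <= t - x -> 0 <= x -> pos y t x = prim c (t + x) - prim c (t - x).
Proof.
move=> ct x0; rewrite /= intD Rintegral_advance Rintegral_retard !addr0 !subr0.
rewrite (@primB c t (t + x)); last by apply/andP; split; lra.
rewrite (@primB c (t - x) t); last by apply/andP; split; lra.
ring.
Qed.

Let Rintegral_advance_time x a b :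
  \int[mu]_(r in `[a, b]) h (r + x) = \int[mu]_(r in `[a + x, b + x]) h r.
Proof. by have := @Rintegral_shift R (a + x) (b + x) x h (@mh _ _); rewrite !addrK. Qed.

(** Both sides are combinations of the values of a primitive of [h] at the four
    points [a + x], [a - x], [b + x] and [b - x]. *)
Let pos_increment a b x : a <= b -> 0 <= x ->
  pos y b x - pos y a x =
  \int[mu]_(r in `[a, b]) h (r + x) - \int[mu]_(r in `[a, b]) h (r - x).
Proof.
move=> ab x0; pose c := a - x.
rewrite (@pos_prim c b x) ?(@pos_prim c a x)//; try by rewrite /c; lra.
rewrite Rintegral_delay Rintegral_advance_time.
rewrite (@primB c (a + x) (b + x)); last by rewrite /c; apply/andP; split; lra.
rewrite (@primB c (a - x) (b - x)); last by rewrite /c; apply/andP; split; lra.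
ring.
Qed.

Let continuous_advance t e : 0 < e -> exists2 d, 0 < d &
  forall s, `|s - t| < d -> \int[mu]_(x in `[0, 1]) (h (s + x) - h (t + x)) ^+ 2 < e.
Proof.
move=> e0.
have [d d0 Hd] := L2_translation_continuous (@ler01 R) (L2loc_shift t Lh) e0.
exists d => // s /Hd; apply: le_lt_trans; rewrite le_eqVlt; apply/orP; left; apply/eqP.
by apply: eq_Rintegral => x _; congr ((h _ - h _) ^+ 2); ring.
Qed.

Let continuous_retard t e : 0 < e -> exists2 d, 0 < d &
  forall s, `|s - t| < d -> \int[mu]_(x in `[0, 1]) (h (s - x) - h (t - x)) ^+ 2 < e.
Proof.
move=> e0.
have [d d0 Hd] := L2_translation_continuous (@ler01 R) (L2loc_reflect t Lh) e0.
exists d => // s; rewrite distrC => /Hd.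
apply: le_lt_trans; rewrite le_eqVlt; apply/orP; left; apply/eqP.
by apply: eq_Rintegral => x _; congr ((h _ - h _) ^+ 2); ring.
Qed.

Let continuous_speeds t e : 0 < e -> exists2 d, 0 < d & forall s, `|s - t| < d ->
  \int[mu]_(x in `[0, 1]) (pos_x y s x - pos_x y t x) ^+ 2 < e /\
  \int[mu]_(x in `[0, 1]) (pos_t y s x - pos_t y t x) ^+ 2 < e.
Proof.
move=> e0; have e40 : 0 < e / 4 by rewrite divr_gt0.
have [d1 d10 H1] := continuous_advance t e40.
have [d2 d20 H2] := continuous_retard t e40.
exists (Num.min d1 d2); first by rewrite lt_min d10.
move=> s; rewrite lt_min => /andP[/H1 A1 /H2 A2].
have L1 := L2B m01 (L2_advance s 0 1) (L2_advance t 0 1).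
have L2 := L2B m01 (L2_retard s 0 1) (L2_retard t 0 1).
have L3 := L2B m01 (L2_retard t 0 1) (L2_retard s 0 1).
have arith (A B C : R) : A < e / 4 -> B < e / 4 -> C <= 2 * A + 2 * B -> C < e.
  by move=> *; lra.
split; apply: (arith _ _ _ A1 A2).
  apply: le_trans (sqint_add_le m01 L1 L2).
  rewrite le_eqVlt; apply/orP; left; apply/eqP.
  by apply: eq_Rintegral => x _ /=; congr (_ ^+ 2); ring.
have -> : \int[mu]_(x in `[0, 1]) (h (s - x) - h (t - x)) ^+ 2 =
          \int[mu]_(x in `[0, 1]) (h (t - x) - h (s - x)) ^+ 2.
  by apply: eq_Rintegral => x _; rewrite -sqrrN opprB.
apply: le_trans (sqint_add_le m01 L1 L3).
rewrite le_eqVlt; apply/orP; left; apply/eqP.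
by apply: eq_Rintegral => x _ /=; congr (_ ^+ 2); ring.
Qed.

Let L2_continuous_of (T : \bar R) (f : R -> R -> R) :
  (forall t e, 0 < e -> exists2 d, 0 < d & forall s, `|s - t| < d ->
    \int[mu]_(x in `[0, 1]) (f s x - f t x) ^+ 2 < e) -> L2_continuous T f.
Proof.
move=> H t _; apply/cvg_withinP => e e0; have [d d0 Hd] := H t e e0.
exists d => // s _ /Hd; rewrite subr0 ger0_norm//.
by apply: Rintegral_ge0 => x _; exact: sqr_ge0.
Qed.

Let continuous_pos t e : 0 < e -> exists2 d, 0 < d & forall s, `|s - t| < d ->
  \int[mu]_(x in `[0, 1]) (pos y s x - pos y t x) ^+ 2 < e.
Proof.
move=> e0; have [d d0 Hd] := continuous_speeds t e0.
exists d => // s /Hd[+ _]; apply: le_lt_trans.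
have LB := L2B m01 (L2_pos_x s) (L2_pos_x t).
rewrite -[leRHS]mulr1 -[X in _ * X](subr0 1) -Rintegral_cst_cc//.
have HB := H1B (H1_pos s) (H1_pos t).
apply: le_Rintegral => //; [exact: (L2_sq (H1_L2 HB))|exact: integrable_cst_cc|].
move=> x; rewrite /= in_itv/= => /andP[x0 x1].
have [_ ->] := HB; last by rewrite x0.
rewrite /= set_itv1 !Rintegral_set1 subrr add0r.
exact: sqr_Rintegral_le.
Qed.

(** The difference quotient of the position is a time average of velocities;
    pairing its error [D] with [D] itself and exchanging the integrals bounds
    the norm of [D] by the oscillation of the velocity. *)
Let quotient_error a b t e : a < b -> 0 <= e ->
  (forall r, a <= r <= b -> nrm (fun x => pos_t y r x - pos_t y t x) <= e) ->
  nrm (fun x => (b - a)^-1 * (pos y b x - pos y a x) - pos_t y t x) <= e.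
Proof.
move=> ab e0 He; have ab' := ltW ab; have ba0 : 0 < b - a by rewrite subr_gt0.
pose K x := pos y b x - pos y a x.
have LK : L201 K by exact: H1_L2 (H1B (H1_pos b) (H1_pos a)).
pose D x := (b - a)^-1 * K x - pos_t y t x.
have LD : L201 D by apply: L2B => //; apply: L2Z.
have [I1 J1 F1] := Fubini_kernelD a b Lh LD.
have [I2 J2 F2] := Fubini_kernelB a b Lh LD.
have velE r : inner (pos_t y r) D =
    \int[mu]_(x in `[0, 1]) (h (r + x) * D x) - \int[mu]_(x in `[0, 1]) (h (r - x) * D x).
  by rewrite innerBl//; [exact: L2_advance|exact: L2_retard].
have mab : measurable (`[a, b] : set mR) by [].
have ivel : mu.-integrable `[a, b] (EFin \o (fun r => inner (pos_t y r) D)).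
  by apply: (eq_integrable mab) (integrableB mab I1 I2) => r _; rewrite /= velE.
have KD : inner K D = \int[mu]_(r in `[a, b]) inner (pos_t y r) D.
  under [RHS]eq_Rintegral do rewrite velE.
  rewrite RintegralB// F1 F2 -RintegralB//; apply: eq_Rintegral => x.
  rewrite inE /= in_itv/= => /andP[x0 _].
  by rewrite /K pos_increment//; ring.
have DD : (b - a) * inner D D =
    \int[mu]_(r in `[a, b]) (inner (pos_t y r) D - inner (pos_t y t) D).
  rewrite RintegralB//; last exact: integrable_cst_cc.
  rewrite -KD Rintegral_cst_cc// {1}/D innerBl//; last exact: L2Z.
  by rewrite innerZl// mulrBr mulrA divff ?gt_eqF// mul1r (mulrC (inner _ _)).
have iB := integrableB mab ivel (integrable_cst_cc a b (inner (pos_t y t) D)).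
have H : (b - a) * inner D D <= (b - a) * (e * nrm D).
  rewrite DD mulrC -Rintegral_cst_cc//; apply: le_Rintegral => //.
    exact: integrable_cst_cc.
  move=> r; rewrite /= in_itv/= => rab.
  rewrite -(innerBl (L2_pos_t r) (L2_pos_t t) LD); apply: le_trans (ler_norm _) _.
  apply: le_trans (normr_inner (L2B m01 (L2_pos_t r) (L2_pos_t t)) LD) _.
  by rewrite ler_wpM2r ?L2norm_ge0// He.
rewrite ler_pM2l// in H.
have DE : inner D D = nrm D ^+ 2.
  by rewrite sqr_L2norm; apply: eq_Rintegral => x _; rewrite expr2.
have [D0|D0] := eqVneq (nrm D) 0; first by rewrite -[leLHS]/(nrm D) D0.
have D0' : 0 < nrm D by rewrite lt_neqAle eq_sym D0 L2norm_ge0.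
by move: H; rewrite DE expr2 ler_pM2r.
Qed.

Let differentiable_pos (T : \bar R) : L2_differentiable T (pos y) (pos_t y).
Proof.
move=> t _; apply/cvg_within_dnbhsP => e e0.
pose e' := Num.min 1 (e / 2).
have e'0 : 0 < e' by rewrite lt_min ltr01 divr_gt0.
have e'20 : 0 < e' ^+ 2 by rewrite exprn_gt0.
have [d d0 Hd] := continuous_speeds t e'20.
exists d => // s _ sNt st; rewrite subr0 ger0_norm; last first.
  by apply: Rintegral_ge0 => x _; exact: sqr_ge0.
have He r : `|r - t| < d -> nrm (fun x => pos_t y r x - pos_t y t x) <= e'.
  by move=> /Hd[_ H]; apply: L2norm_le; exact: ltW.
have e'e : e' ^+ 2 < e.
  have [H1 H2] : e' <= 1 /\ e' <= e / 2 by rewrite /e' !ge_min !lexx orbT.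
  rewrite expr2; apply: (@le_lt_trans _ _ (1 * (e / 2))); last by lra.
  by apply: ler_pM => //; exact: ltW.
apply: le_lt_trans e'e.
suff N : nrm (fun x => (pos y s x - pos y t x) / (s - t) - pos_t y t x) <= e'.
  rewrite /sqdist -sqr_L2norm.
  by apply: lerXn2r; rewrite ?nnegrE ?L2norm_ge0 ?(ltW e'0).
have [ts|st'] := ltP t s.
  have := @quotient_error t s t e' ts (ltW e'0).
  under [X in nrm X]eq_fun do rewrite mulrC.
  apply => r /andP[tr rs]; apply: He; rewrite ger0_norm ?subr_ge0//.
  by apply: le_lt_trans st; rewrite ger0_norm ?subr_ge0 ?(ltW ts)// lerD2r.
have {}st' : s < t by rewrite lt_neqAle sNt.
have := @quotient_error s t t e' st' (ltW e'0).
have -> : (fun x => (t - s)^-1 * (pos y t x - pos y s x) - pos_t y t x) =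
    (fun x => (pos y s x - pos y t x) / (s - t) - pos_t y t x).
  by apply/funext => x; rewrite mulrC -(opprB s t) invrN mulrN -mulNr opprB.
apply => r /andP[sr rt]; apply: He; rewrite distrC ger0_norm ?subr_ge0//.
by apply: le_lt_trans st; rewrite distrC ger0_norm ?subr_ge0 ?(ltW st')// lerD2l lerN2.
Qed.

Lemma dAlembert_finite_energy (T : \bar R) : finite_energy T y.
Proof.
split.
- by move=> t _; split; [exact: H1_pos|exact: L2_pos_t].
- exact: L2_continuous_of continuous_pos.
- apply: L2_continuous_of => t e e0; have [d d0 Hd] := continuous_speeds t e0.
  by exists d => // s /Hd[].
- apply: L2_continuous_of => t e e0; have [d d0 Hd] := continuous_speeds t e0.
  by exists d => // s /Hd[].
- exact: differentiable_pos.
Qed.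

(** After integration by parts in space and exchange of the time and space
    integrals, every term is a combination of values on characteristics of one
    primitive [P] of [h]: the kinetic terms give [A] and [B], the strain gives [A]
    again, and the two boundary fluxes give [A 1] and [B]. *)
Lemma dAlembert_green (u v dv : R -> R) (t : R) : 0 <= t -> H1 v dv ->
  (forall s, 0 <= s <= t -> u s = h (s + 1) + h (s - 1)) ->
  green_identity y (fun s => 2 * h s) u v dv t.
Proof.
move=> t0 Hv uE; have [Ldv vE] := Hv; have idv := L2_integrable_cc Ldv.
pose P := prim (-1).
have PB a b : -1 <= a <= b -> \int[mu]_(s in `[a, b]) h s = P b - P a by exact: primB.
have PB0 : \int[mu]_(s in `[0, t]) h s = P t - P 0 by rewrite PB// t0 lerN10.
have advance x : 0 <= x <= 1 -> \int[mu]_(s in `[0, t]) h (s + x) = P (t + x) - P x.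
  move=> /andP[x0 x1]; rewrite Rintegral_advance_time PB add0r//.
  by apply/andP; split; lra.
have delay x : 0 <= x <= 1 -> \int[mu]_(s in `[0, t]) h (s - x) = P (t - x) - P (- x).
  move=> /andP[x0 x1]; rewrite Rintegral_delay PB add0r//.
  by apply/andP; split; lra.
pose Q r x := \int[mu]_(s in `[0, x]) pos_t y r s.
have QE r x : 0 <= r -> 0 <= x <= 1 -> Q r x = P (r + x) + P (r - x) - 2 * P r.
  move=> r0 /andP[x0 x1]; rewrite /Q /= intB Rintegral_advance Rintegral_retard addr0 subr0.
  by rewrite !PB; [ring|apply/andP; split; lra|apply/andP; split; lra].
have LQ r : L201 (Q r).
  have := H1_L2 (L2_primitive 0 (L2_pos_t r)); apply: eq_L2 => // x _.
  by rewrite add0r.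
pose A x := P (t + x) - P x + P (t - x) - P (- x); pose B := 2 * (P t - P 0).
have QAB x : 0 <= x <= 1 -> Q t x - Q 0 x = A x - B.
  by move=> x01; rewrite !QE// /A /B add0r sub0r; ring.
have lhs : \int[mu]_(x in `[0, 1]) (pos_t y t x * v x) -
    \int[mu]_(x in `[0, 1]) (pos_t y 0 x * v x) =
    v 1 * (A 1 - B) - \int[mu]_(x in `[0, 1]) (dv x * (Q t x - Q 0 x)).
  rewrite !(by_parts_right (L2_pos_t _) Hv).
  rewrite -[\int[mu]_(x in `[0, 1]) pos_t y t x]/(Q t 1).
  rewrite -[\int[mu]_(x in `[0, 1]) pos_t y 0 x]/(Q 0 1) -(QAB 1) ?ler01 ?lexx//.
  have -> : \int[mu]_(x in `[0, 1]) (dv x * (Q t x - Q 0 x)) =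
      \int[mu]_(x in `[0, 1]) (dv x * Q t x) - \int[mu]_(x in `[0, 1]) (dv x * Q 0 x).
    rewrite -RintegralB//; try exact: L2_mul.
    by apply: eq_Rintegral => x _; ring.
  rewrite /Q; ring.
have [I1 J1 F1] := Fubini_kernelD 0 t Lh Ldv.
have [I2 J2 F2] := Fubini_kernelB 0 t Lh Ldv.
have m0t : measurable (`[0, t] : set mR) by [].
have strainE s : \int[mu]_(x in `[0, 1]) (pos_x y s x * dv x) =
   \int[mu]_(x in `[0, 1]) (h (s + x) * dv x) + \int[mu]_(x in `[0, 1]) (h (s - x) * dv x).
  by rewrite -[LHS]/(inner (pos_x y s) dv) innerDl//; [exact: L2_advance|exact: L2_retard].
have strain : \int[mu]_(s in `[0, t])
    (\int[mu]_(x in `[0, 1]) (h (s + x) * dv x) + \int[mu]_(x in `[0, 1]) (h (s - x) * dv x)) =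
    \int[mu]_(x in `[0, 1]) (dv x * A x).
  rewrite RintegralD// F1 F2 -RintegralD//; apply: eq_Rintegral => x.
  rewrite inE /= in_itv/= => x01; rewrite advance// delay//.
  by rewrite -mulrDr addrA.
have i_h1 : mu.-integrable `[0, t] (EFin \o (fun s => h (s + 1))).
  by apply: L2_integrable_cc; apply: L2_shift_cc; exact: Lh.2.
have i_h2 : mu.-integrable `[0, t] (EFin \o (fun s => h (s - 1))).
  by apply: L2_integrable_cc; apply: L2_shift_cc; exact: Lh.2.
have flux : \int[mu]_(s in `[0, t]) (1 * (h (s + 1) + h (s - 1)) + 0 * h s) = A 1.
  rewrite Rintegral_lin//; last exact: (integrableD m0t i_h1 i_h2).
  rewrite mul1r mul0r addr0 RintegralD//.
  by rewrite advance ?delay ?ler01 ?lexx// addrA.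
rewrite /green_identity lhs.
have -> : \int[mu]_(s in `[0, t]) (u s * v 1 - 2 * h s * v 0 -
     \int[mu]_(x in `[0, 1]) (pos_x y s x * dv x)) =
  \int[mu]_(s in `[0, t]) ((v 1 * (1 * (h (s + 1) + h (s - 1)) + 0 * h s) + (- 2 * v 0) * h s) -
    (\int[mu]_(x in `[0, 1]) (h (s + x) * dv x) + \int[mu]_(x in `[0, 1]) (h (s - x) * dv x))).
  apply: eq_Rintegral => s; rewrite inE /= in_itv/= => st.
  by rewrite strainE uE//; ring.
have i_u := integrable_lin 1 0 m0t (integrableD m0t i_h1 i_h2) (ih 0 t).
rewrite RintegralB//; [|exact: integrable_lin i_u (ih 0 t)|exact: (integrableD m0t I1 I2)].
rewrite strain (Rintegral_lin _ _ m0t i_u (ih 0 t)) flux PB0.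
have -> : \int[mu]_(x in `[0, 1]) (dv x * (Q t x - Q 0 x)) =
    \int[mu]_(x in `[0, 1]) (dv x * A x) - (v 1 - v 0) * B.
  have i_A : mu.-integrable `[0, 1] (EFin \o (fun x => dv x * A x)).
    apply: (eq_integrable m01) (integrableD m01 J1 J2) => x.
    rewrite inE /= in_itv/= => x01; rewrite advance// delay//.
    by rewrite -EFinD -mulrDr addrA.
  have -> : v 1 - v 0 = \int[mu]_(x in `[0, 1]) dv x.
    by rewrite (vE 1) ?ler01 ?lexx//; ring.
  rewrite -RintegralZr//.
  rewrite -RintegralB//; last exact: (integrableZr m01 B idv).
  by apply: eq_Rintegral => x; rewrite inE /= in_itv/= => x01; rewrite QAB//; ring.
rewrite /B; ring.
Qed.

End dAlembert.

(** At the ends, [h (t + x) + h (t - x)] is [2 h t] and [h (t + 1) + h (t - 1)];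
    at time 0, [h x + h (- x)] and [h x - h (- x)] unfold [Fdata] into [dy0] and
    [y1]. *)
Lemma dAlembert_solution (R : realType) (T : \bar R) (y0 dy0 y1 u h : R -> R) :
  L2loc h -> initial_data y0 dy0 y1 ->
  (forall s, -1 <= s < 1 -> h s = Fdata dy0 y1 s) ->
  (forall s, time_itv T s -> u s = h (s + 1) + h (s - 1)) ->
  wave_solution T y0 y1 u (dAlembert h) /\ trace_x0 T u (dAlembert h) (fun s => 2 * h s).
Proof.
move=> Lh [[Ldy0 y0E] y00 Ly1] hF uE.
have uE' t s : time_itv T t -> 0 <= s <= t -> u s = h (s + 1) + h (s - 1).
  by move=> tT st; apply: uE; exact: time_itv_le tT st.
have greenT v dv t : H1 v dv -> time_itv T t ->
    green_identity (dAlembert h) (fun s => 2 * h s) u v dv t.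
  move=> Hv tT; apply: dAlembert_green => //; first by case: tT.
  by move=> s; exact: uE'.
have dataE x : 0 < x < 1 -> h x + h (- x) = dy0 x /\ h x - h (- x) = y1 x.
  move=> /andP[x0 x1]; rewrite !hF; [|apply/andP; split; lra..].
  by rewrite /Fdata oppr_lt0 x0 ltNge (ltW x0) /= opprK; split; lra.
have N01 : \forall x \ae (@lebesgue_measure R), x != 0 /\ x != 1.
  exists [set 0; 1]; split; first by apply: measurableU; exact: measurable_set1.
    exact/countable_lebesgue_measure0/finite_set_countable/finite_set2.
  by move=> x /= /not_andP[/negP/negPn/eqP|/negP/negPn/eqP]; [left|right].
have oo x : x != 0 -> x != 1 -> 0 <= x <= 1 -> 0 < x < 1.
  by rewrite !lt_neqAle [0 == x]eq_sym => -> -> /andP[-> ->].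
split; first split.
- exact: dAlembert_finite_energy.
- by move=> t _; rewrite /= set_itv1 Rintegral_set1.
- move=> x x01; rewrite (y0E x x01) y00 add0r /=.
  have sub : `[0, x]%classic `<=` (`[0, 1]%classic : set (measurableTypeR R)).
    by case/andP: x01 => _ x1 s /=; rewrite !in_itv/= => /andP[-> sx]; apply: le_trans x1.
  have Lx := L2D (measurable_itv _) (L2_advance Lh 0 0 x) (L2_retard Lh 0 0 x).
  apply: Rintegral_ae_eq => //.
  + apply: ae_impl N01 => s [s0 s1] /sub; rewrite /= in_itv/= => s01.
    by rewrite add0r sub0r (dataE s _).1// oo.
  + exact: L2_measurable Lx.
  + exact: measurable_funS (L2_measurable Ldy0).
- apply: ae_impl N01 => x [x0 x1] x01.
  by rewrite /= add0r sub0r (dataE x _).2// oo.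
- move=> v dv Hv v0 t tT; have := greenT v dv t Hv tT.
  rewrite /green_identity => ->; apply: eq_Rintegral => s _.
  by rewrite v0 !mulr0.
split; last by move=> v dv Hv t tT; exact: greenT.
move=> t _; have m0t : measurable (`[0, t] : set (measurableTypeR R)) by [].
exact: (integrableZl m0t 2 (L2loc_integrable 0 t Lh)).
Qed.

(** * Profiles prescribed along the chains [s, s + 2, s + 4, ...] *)

Section chains.
Context (R : realType).
Notation mu := (@lebesgue_measure R).
Notation mR := (measurableTypeR R).
Implicit Types (a : nat -> R -> R).

(** The optimality conditions couple a profile only along the sequences
    [s + 2 k] with [s] in [[-1, 1)], and every [t >= -1] lies on exactly one of
    them: [a k s] is the value at the [k]-th point of the chain of [s]. *)
Definition chain a (t : R) : R :=
  if t < -1 then 0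
  else let k := Num.truncn ((t + 1) / 2) in a k (t - 2 * k%:R).

Lemma chainE a k (s : R) : -1 <= s < 1 -> chain a (s + 2 * k%:R) = a k s.
Proof.
move=> /andP[s1 s2]; have k0 : 0 <= k%:R :> R by exact: ler0n.
rewrite /chain ltNge (_ : -1 <= _) /=; last by lra.
rewrite (@truncn_def R _ k) ?addrK//.
by rewrite -[k.+1]addn1 natrD; apply/andP; split; lra.
Qed.

Lemma chain_decomp (t : R) : -1 <= t -> exists k s, -1 <= s < 1 /\ t = s + 2 * k%:R.
Proof.
move=> t1; have t0 : 0 <= (t + 1) / 2 by lra.
exists (Num.truncn ((t + 1) / 2)), (t - 2 * (Num.truncn ((t + 1) / 2))%:R).
split; last by rewrite subrK.
have := truncn_itv t0; rewrite -[(Num.truncn _).+1]addn1 natrD => /andP[? ?].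
by apply/andP; split; lra.
Qed.

Let Itv N : set R := [set x | x < 2 * N%:R - 1].

Let mItv N : measurable (Itv N : set mR).
Proof.
have -> : Itv N = `]-oo, 2 * N%:R - 1[%classic :> set R.
  by apply/seteqP; split=> x /=; rewrite in_itv.
exact: measurable_itv.
Qed.

Lemma L2loc_chain a : (forall k, L2 `[-1, 1[ (a k)) -> L2loc (chain a).
Proof.
move=> La.
have Lk k : L2 `[2 * k%:R - 1, 2 * k%:R + 1[ (chain a).
  have mi : measurable (`[-1, 1[ : set mR) by [].
  have := @L2_shift R (- (2 * k%:R)) _ _ mi (La k).
  rewrite shift_preimage_co !opprK ![_ + 2 * _]addrC.
  apply: eq_L2 => // t; rewrite /= in_itv/= => /andP[t1 t2].
  rewrite -(@chainE a k (t - 2 * k%:R)) ?subrK//.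
  by apply/andP; split; lra.
have LN N : L2 (Itv N) (chain a).
  elim: N => [|N IH].
    apply: (eq_L2 _ _ (L2_0 _)) => //; try exact: mItv.
    by move=> x; rewrite /Itv /= mulr0 sub0r /chain => ->.
  have <- : Itv N `|` `[2 * N%:R - 1, 2 * N%:R + 1[%classic = Itv N.+1.
    rewrite /Itv -[N.+1]addn1 natrD; apply/seteqP; split=> x /=; rewrite in_itv/=.
      by case=> [?|/andP[? ?]]; lra.
    move=> x2; have [x1|x1] := ltP x (2 * N%:R - 1); [by left|right].
    by apply/andP; split; lra.
  exact: L2_setU.
have ex (b : R) : exists N, b < 2 * N%:R - 1.
  exists (Num.truncn b).+2; have := truncnS_gt b.
  have : 0 <= (Num.truncn b)%:R :> R by exact: ler0n.
  rewrite -[(Num.truncn b).+2]addn2 -[(Num.truncn b).+1]addn1 !natrD; lra.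
split.
  rewrite (_ : setT = \bigcup_N Itv N); last first.
    apply/seteqP; split=> // x _; have [N xN] := ex x.
  by exists N; [exact: I|exact: xN].
  apply/measurable_fun_bigcup; first exact: mItv.
  by move=> N; exact: (LN N).1.
move=> c d; have [N dN] := ex d; apply: (@L2_subset R (Itv N) _ _ (@mItv N) (measurable_itv _) _ (LN N)).
by move=> x /=; rewrite in_itv/= => /andP[_ xd]; apply: le_lt_trans dN.
Qed.

End chains.

(** * The profile of a feasible state *)

Section feasible.
Context (R : realType).
Notation mu := (@lebesgue_measure R).
Notation mR := (measurableTypeR R).
Variables (T : \bar R) (y0 dy0 y1 : R -> R).
Hypothesis T2 : (2%:E <= T)%E.
Hypothesis data : initial_data y0 dy0 y1.

Lemma L2_Fdata : L2 `[-1, 1] (Fdata dy0 y1).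
Proof.
have [[Ldy0 _] _ Ly1] := data.
have -> : `[-1, 1]%classic = `[-1, 0[ `|` `[0, 1] :> set mR.
  apply/seteqP; split=> x /=; rewrite !in_itv/=.
    by move=> /andP[? ?]; case: (ltP x 0) => ?; [left|right]; apply/andP; split.
  by case=> /andP[? ?]; apply/andP; split; lra.
have Lr (f : R -> R) : L2 `[0, 1] f -> L2 `[-1, 0[ (fun x => f (0 - x)).
  move=> Lf; have L0 : L2 `[-1, 0] (fun x => f (0 - x)).
    by apply: L2_reflect_cc; rewrite subr0 sub0r opprK.
  apply: L2_subset L0 => //.
  by move=> x /=; rewrite !in_itv/= => /andP[-> /ltW].
apply: L2_setU => //.
  have m10 : measurable (`[-1, 0[ : set mR) by [].
  have := L2_lin 2^-1 (- 2^-1) m10 (Lr _ Ldy0) (Lr _ Ly1); apply: eq_L2 => //.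
  by move=> x /=; rewrite in_itv/= => /andP[_ x0]; rewrite /Fdata x0 sub0r; ring.
have m01 : measurable (`[0, 1] : set mR) by [].
have := L2_lin 2^-1 2^-1 m01 Ldy0 Ly1; apply: eq_L2 => //.
move=> x /=; rewrite in_itv/= => /andP[x0 _]; rewrite /Fdata ltNge x0 /=; ring.
Qed.

Lemma L2_Fdata_co : L2 `[-1, 1[ (Fdata dy0 y1).
Proof.
apply: L2_subset L2_Fdata => //.
by move=> x /=; rewrite !in_itv/= => /andP[-> /ltW].
Qed.

Lemma time_itv_ge0 t : time_itv T t -> 0 <= t. Proof. by case. Qed.

Lemma measurable_time_itv : measurable (time_itv T : set mR).
Proof.
case: T T2 => [r|//|//] _.
  rewrite (_ : time_itv _ = `[0, r]%classic :> set R)//.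
  apply/seteqP; split=> x; rewrite /time_itv /= in_itv/= lee_fin; first by case=> -> ->.
  by case/andP.
rewrite (_ : time_itv _ = `[0, +oo[%classic :> set R)//.
apply/seteqP; split=> x; rewrite /time_itv /= in_itv/= andbT; first by case.
by move=> ->; rewrite leey.
Qed.

Lemma measurable_fun_time_itv (g : R -> R) :
  (forall t, time_itv T t -> measurable_fun (`[0, t] : set mR) g) ->
  measurable_fun (time_itv T : set mR) g.
Proof.
move=> mg; have mD := measurable_time_itv; case: T T2 mg mD => [r||//] T2' mg mD.
  have rr : time_itv r%:E r.
    by split; [move: T2'; rewrite lee_fin; lra|exact: lexx].
  apply: measurable_funS (mg r rr) => //.
  by move=> x [x0 xr]; rewrite /= in_itv/= x0 -lee_fin.
have -> : time_itv +oo%E = \bigcup_n (`[0, n%:R]%classic : set mR).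
  apply/seteqP; split=> [x [x0 _]|x [n _]]; last first.
    by rewrite /= in_itv/= => /andP[x0 _]; split; rewrite ?leey.
  by exists (Num.truncn x).+1 => //; rewrite /= in_itv/= x0 ltW// truncnS_gt.
apply: (measurable_fun_bigcup g _).2; first by move=> n; exact: measurable_itv.
by move=> n; exact: (mg n%:R (conj (ler0n _ _) (leey _))).
Qed.

Lemma L2_time_integrable u : L2 (time_itv T) u ->
  forall t, time_itv T t -> mu.-integrable `[0, t] (EFin \o u).
Proof.
move=> Lu t tT; apply: L2_integrable_cc; apply: L2_subset Lu => //.
  exact: measurable_time_itv.
by move=> s /=; rewrite in_itv/= => st; exact: time_itv_le tT st.
Qed.

Lemma ae_time_itv (P : R -> Prop) :
  (forall t, time_itv T t -> \forall s \ae mu, 0 <= s <= t -> P s) ->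
  \forall s \ae mu, time_itv T s -> P s.
Proof.
case: T T2 => [r T2' H|_ H|//].
  have : time_itv r%:E r.
    by split; [move: T2'; rewrite lee_fin; lra|exact: lexx].
  move=> /H; apply: ae_impl => s Hs [s0 sr]; apply: Hs.
  by rewrite s0 -lee_fin.
have : \forall s \ae mu, forall n : nat, 0 <= s <= n%:R -> P s.
  apply: ae_foralln => n; apply: H; split; first exact: ler0n.
  by rewrite leey.
apply: ae_impl => s Hs [s0 _]; apply: (Hs (Num.truncn s).+1).
by rewrite s0 ltW// truncnS_gt.
Qed.

Fixpoint control_chain (u : R -> R) k (s : R) : R :=
  if k is k'.+1 then u (s + 2 * k'%:R + 1) - control_chain u k' s
  else Fdata dy0 y1 s.

(** Reading [h (t + 1) = u t - h (t - 1)] along the chains builds the profile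
    from the control, and uniqueness identifies the state with the d'Alembert
    solution of that profile. *)
Lemma feasible_profile u w g : feasible T y0 y1 u w g ->
  exists h, [/\ L2loc h,
    forall s, -1 <= s < 1 -> h s = Fdata dy0 y1 s,
    forall t, time_itv T t -> u t = h (t + 1) + h (t - 1),
    \forall t \ae mu, time_itv T t -> g t = 2 * h t &
    (forall t, time_itv T t ->
      (\forall x \ae mu, 0 <= x <= 1 -> pos_x w t x = h (t + x) + h (t - x)) /\
      (\forall x \ae mu, 0 <= x <= 1 -> pos_t w t x = h (t + x) - h (t - x))) /\
    forall r : R, T = r%:E ->
      \forall t \ae mu, r - 1 <= t <= r + 1 -> h t = 0].
Proof.
move=> [Lu Hw Hg Hend].
pose u' := u \_ (time_itv T).
have u'E t : time_itv T t -> u' t = u t by move=> tT; rewrite /u' patchE mem_set.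
have Lu' : L2 setT u'.
  apply/(L2_restrict u measurableT measurable_time_itv).1.
  by rewrite setTI.
pose h := chain (control_chain u').
have Lh : L2loc h.
  apply: L2loc_chain; elim => [|k IH]; first exact: L2_Fdata_co.
  apply: L2B => //.
  have := @L2_shift R (2 * k%:R + 1) _ _ measurableT Lu'; rewrite preimage_setT => L.
  have := @L2_subset R setT `[-1, 1[ _ measurableT _ _ L.
  move=> /(_ (measurable_itv _) (@subsetT _ _)).
  by apply: eq_L2 => // x _ /=; rewrite addrA.
have hF s : -1 <= s < 1 -> h s = Fdata dy0 y1 s.
  by move=> s1; have := @chainE R (control_chain u') 0 s s1; rewrite mulr0 addr0.
have hu t : time_itv T t -> u t = h (t + 1) + h (t - 1).
  move=> tT; have t0 := time_itv_ge0 tT.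
  have tm1 : -1 <= t - 1 by lra.
  have [k [s [s1 tE]]] := chain_decomp tm1.
  rewrite tE /h chainE//.
  have -> : t + 1 = s + 2 * k.+1%:R by rewrite -[k.+1]addn1 natrD -[t](subrK 1) tE; ring.
  rewrite chainE//= (_ : s + 2 * k%:R + 1 = t) ?u'E ?subrK// -tE subrK//.
have iu := L2_time_integrable Lu.
have [Hd Htr] := dAlembert_solution Lh data hF hu.
have eqw := wave_solution_unique iu Hw Hd.
have eqxt t (tT : time_itv T t) := let: And3 _ A B := eqw t tT in conj A B.
exists h; split => //.
  apply: ae_time_itv => t tT; have [fw _ _ _ _] := Hw; have [fd _ _ _ _] := Hd.
  exact: (trace_unique iu fw fd eqxt Hg Htr).
split => // r Tr; have rT : time_itv T r.
  by rewrite Tr; split; [move: T2; rewrite Tr lee_fin; lra|exact: lexx].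
have [A _ C] := eqw r rT; have [pos0 pos_t0] := Hend r Tr.
have sum0 : \forall x \ae mu, 0 <= x <= 1 -> h (r + x) + h (r - x) = 0.
  have L := L2D (measurable_itv _) (L2_advance Lh r 0 1) (L2_retard Lh r 0 1).
  apply: (ae_eq0_primitive (L2_integrable_cc L)) => x x01.
  by have := A x x01; rewrite pos0.
have both : \forall x \ae mu, 0 <= x <= 1 -> h (r + x) = 0 /\ h (r - x) = 0.
  have dif0 : \forall x \ae mu, 0 <= x <= 1 -> h (r + x) - h (r - x) = 0.
    by apply: ae_impl2 pos_t0 C => x D1 D2 x01; have := D2 x01; rewrite D1// => /esym.
  by apply: ae_impl2 sum0 dif0 => x S D x01; have := S x01; have := D x01; split; lra.
have B1 := @ae_shift R (- r) _ both; have B2 := @ae_reflect R r _ both.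
apply: ae_impl2 B1 B2 => t H1 H2 /andP[t1 t2].
have [tr|rt] := lerP t r.
  have [|_] := H2; first by apply/andP; split; lra.
  by rewrite subKr.
have [|+ _] := H1; first by apply/andP; split; lra.
by rewrite addrC subrK.
Qed.

End feasible.

(** * Optimality from the Euler-Lagrange recurrence *)

Section optimality.
Context (R : realType).
Notation mu := (@lebesgue_measure R).
Notation mR := (measurableTypeR R).

Lemma Rintegral_shiftT (f : R -> R) (c : R) : measurable_fun setT f ->
  \int[mu]_x f (x + c) = \int[mu]_x f x.
Proof.
move=> mf; rewrite /Rintegral.
have := @integral_shift R c setT (EFin \o f) measurableT.
by rewrite preimage_setT => -> //; exact/measurable_EFinP.
Qed.

Lemma L2T_shift (f : R -> R) (c : R) : L2 setT f -> L2 setT (fun x => f (x + c)).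
Proof.
move=> Lf; have := @L2_shift R c setT f measurableT Lf.
by rewrite preimage_setT.
Qed.

Variables (T : \bar R) (lambda : R) (y0 dy0 y1 h : R -> R).
Hypothesis T2 : (2%:E <= T)%E.
Hypothesis lambda01 : 0 <= lambda <= 1.
Hypothesis lambda1 : T = +oo%E -> lambda < 1.
Hypothesis data : initial_data y0 dy0 y1.
Hypothesis Lh : L2 setT h.
Hypothesis h_data : forall s, -1 <= s < 1 -> h s = Fdata dy0 y1 s.
Hypothesis h_end : forall r : R, T = r%:E -> forall t, r - 1 <= t -> h t = 0.
Hypothesis Euler_Lagrange : forall t, 1 <= t -> ((t + 1)%:E < T)%E ->
  lambda * h (t - 2) + (4 - 2 * lambda) * h t + lambda * h (t + 2) = 0.

Definition profile_control (t : R) := h (t + 1) + h (t - 1).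
Notation u := profile_control.
Notation D := (time_itv T).

Let T_cases : (exists r : R, T = r%:E) \/ T = +oo%E.
Proof. by case: T T2 => [r|//|//] _; [left; exists r|right]. Qed.

Let mD : measurable (D : set mR). Proof. exact: measurable_time_itv. Qed.

(* The times at which the profile is constrained neither by the initial data
   nor by the terminal condition. *)
Let free : set R := [set t | 1 <= t /\ ((t + 1)%:E < T)%E].

Let mfree : measurable (free : set mR).
Proof.
rewrite /free; case: T T2 => [r|//|//] _.
  have -> : [set t : R | 1 <= t /\ ((t + 1)%:E < r%:E)%E] = `[1, r - 1[%classic.
    apply/seteqP; split=> t /=; rewrite in_itv/= lte_fin.
      by move=> [? ?]; apply/andP; split; lra.
    by move=> /andP[? ?]; split; lra.
  exact: measurable_itv.
have -> : [set t : R | 1 <= t /\ ((t + 1)%:E < +oo)%E] = `[1, +oo[%classic.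
  apply/seteqP; split=> t /=; rewrite in_itv/= andbT; first by case.
  by move=> ?; split => //; rewrite ltry.
exact: measurable_itv.
Qed.

Let free_D t c : free t -> -1 <= c <= 1 -> D (t + c).
Proof.
move=> [t1 tT] /andP[c1 c2]; split; first by lra.
apply: le_trans (ltW tT); rewrite lee_fin; lra.
Qed.

Let free_D0 t : free t -> D t.
Proof. by move=> ft; rewrite -[t]addr0; apply: free_D => //; apply/andP; split; lra. Qed.

Let Lloc : L2loc h.
Proof.
split; first exact: L2_measurable Lh.
by move=> a b; apply: L2_subset Lh.
Qed.

Lemma L2_profile_control : L2 setT u.
Proof. by apply: L2D => //; exact: L2T_shift. Qed.
Let Lu := L2_profile_control.

Lemma profile_feasible : feasible T y0 y1 u (dAlembert h) (fun t => 2 * h t).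
Proof.
have uE t : D t -> u t = h (t + 1) + h (t - 1) by [].
have [Hw Hg] := dAlembert_solution Lloc data h_data uE.
split => //; first exact: L2_subset Lu.
move=> r Tr; have hr x : -1 <= x -> h (r + x) = 0 by move=> x1; apply: (h_end Tr); lra.
split=> [x /andP[x0 x1]|].
  rewrite /=; apply: Rintegral0_eq => s; rewrite /= in_itv/= => /andP[s0 sx].
  by rewrite !hr ?addr0//; lra.
apply: aeW => x /andP[x0 x1] /=; rewrite !hr ?subr0//; lra.
Qed.

Let lambda0 : 0 <= lambda. Proof. by case/andP: lambda01. Qed.
Let onem_lambda0 : 0 <= 1 - lambda. Proof. by case/andP: lambda01; lra. Qed.

Let q (a b : R) := (1 - lambda) * a ^+ 2 + lambda * b ^+ 2.

Let q_ge0 a b : 0 <= q a b.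
Proof. by rewrite addr_ge0// mulr_ge0 ?sqr_ge0 ?lambda0 ?onem_lambda0. Qed.

Let q_integrable (a b : R -> R) : L2 D a -> L2 D b ->
  mu.-integrable D (EFin \o (fun t => q (a t) (b t))).
Proof. by move=> La Lb; apply: integrable_lin => //; exact: L2_sq. Qed.

Let shifts (d : R -> R) t := d (t + 1) + d (t - 1).

(** First variation: moving the translations from the variation [d] onto the
    control leaves the Euler-Lagrange expression against [d]. *)
Let first_variation d : L2 setT d -> (forall t, ~ free t -> d t = 0) ->
  \int[mu]_(t in D) ((1 - lambda) * (4 * (h t * d t)) + lambda * (u t * shifts d t)) = 0.
Proof.
move=> Ld d0; pose U := u \_ D.
have mT : measurable (setT : set mR) by [].
have LU : L2 setT U.
  by apply/(L2_restrict u measurableT mD).1; rewrite setTI; apply: L2_subset Lu.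
have Ld1 := L2T_shift 1 Ld; have Ldm1 := L2T_shift (-1) Ld.
have LU1 := L2T_shift 1 LU; have LUm1 := L2T_shift (-1) LU.
have i0 := L2_mul mT Lh Ld; have i1 := L2_mul mT LU Ld1; have i2 := L2_mul mT LU Ldm1.
have j1 := L2_mul mT LUm1 Ld; have j2 := L2_mul mT LU1 Ld.
have i12 : mu.-integrable setT (EFin \o (fun t => 1 * (U t * d (t + 1)) + 1 * (U t * d (t - 1)))).
  exact: integrable_lin.
have j12 : mu.-integrable setT (EFin \o (fun t => 1 * (U (t - 1) * d t) + 1 * (U (t + 1) * d t))).
  exact: integrable_lin.
transitivity (\int[mu]_t (4 * (1 - lambda) * (h t * d t) +
    lambda * (1 * (U t * d (t + 1)) + 1 * (U t * d (t - 1))))).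
  rewrite Rintegral_mkcond; apply: eq_Rintegral => t _; rewrite patchE /U patchE /shifts.
  case: ifPn => tD; first ring.
  have -> : d t = 0 by apply: d0 => /free_D0; move: tD => /negP; rewrite inE.
  by rewrite !mul0r !mulr0 addr0 mulr0 addr0.
rewrite Rintegral_lin// Rintegral_lin//.
rewrite -(@Rintegral_shiftT (fun t => U t * d (t + 1)) (-1)); last first.
  by apply: measurable_funM; [exact: L2_measurable LU|exact: L2_measurable Ld1].
rewrite -(@Rintegral_shiftT (fun t => U t * d (t - 1)) 1); last first.
  by apply: measurable_funM; [exact: L2_measurable LU|exact: L2_measurable Ldm1].
have -> : \int[mu]_t (U (t - 1) * d (t - 1 + 1)) = \int[mu]_t (U (t - 1) * d t).
  by apply: eq_Rintegral => t _; rewrite subrK.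
have -> : \int[mu]_t (U (t + 1) * d (t + 1 - 1)) = \int[mu]_t (U (t + 1) * d t).
  by apply: eq_Rintegral => t _; rewrite addrK.
rewrite -Rintegral_lin// -Rintegral_lin//; apply: Rintegral0_eq => t _.
have [ft|nft] := pselect (free t); last by rewrite (d0 t nft) !mulr0 addr0 mulr0 addr0.
have D1 : D (t - 1) by apply: free_D => //; apply/andP; split; lra.
have D2 : D (t + 1) by apply: free_D => //; apply/andP; split; lra.
rewrite /U !patchE !mem_set// /u subrK addrK.
have [t1 tT] := ft; have EL := Euler_Lagrange t1 tT.
have -> : t + 1 + 1 = t + 2 by ring.
have -> : t - 1 - 1 = t - 2 by ring.
transitivity ((lambda * h (t - 2) + (4 - 2 * lambda) * h t + lambda * h (t + 2)) * d t).
  ring.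
by rewrite EL mul0r.
Qed.

(** The profile [k] of a competitor agrees with [h] wherever the data and the
    terminal condition prescribe it, so that [d = k - h] is supported in the free
    times.  The cost is quadratic, and its cross term is the first variation.  On
    an infinite horizon a finite cost puts [k] in L^2, as [lambda < 1]. *)
Lemma cost_expansion v w g : feasible T y0 y1 v w g -> (cost T lambda v g < +oo)%E ->
  exists d, [/\ L2 setT d, forall t, ~ D t -> d t = 0,
    \forall t \ae mu, D t -> v t = u t + (d (t + 1) + d (t - 1)) &
    cost T lambda v g = (cost T lambda u (fun t => 2 * h t)%R +
      \int[mu]_(t in D) ((1 - lambda) * (2 * d t) ^+ 2 +
                         lambda * (d (t + 1) + d (t - 1)) ^+ 2)%:E)%E].
Proof.
move=> Hfeas fin; have [Lv _ [ig _] _] := Hfeas.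
have [k [Lk kF vE gE [_ kend]]] := feasible_profile T2 data Hfeas.
have mg : measurable_fun (D : set mR) g.
  apply: measurable_fun_time_itv => // t /ig.
  by move=> /(measurable_int mu)/measurable_EFinP.
have mk (E : set mR) : measurable_fun E k by apply: measurable_funTS; exact: Lk.1.
have mv : measurable_fun (D : set mR) v by exact: L2_measurable Lv.
have costE : cost T lambda v g = (\int[mu]_(t in D) (q (2 * k t) (v t))%:E)%E.
  apply: ae_eq_integral => //.
  - apply/measurable_EFinP; apply: measurable_funD; apply: measurable_funM => //;
      exact: measurable_funX.
  - apply/measurable_EFinP; apply: measurable_funD; apply: measurable_funM => //;
      apply: measurable_funX => //; exact: measurable_funM.
  - by apply: ae_impl gE => t Hg /Hg ->.
have LkD : L2 D k.
  have [[r Tr]|Too] := T_cases.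
    have [] // : L2 D k; apply: L2_subset (Lk.2 0 r) => //.
    by move=> t [t0]; rewrite Tr lee_fin /= in_itv/= t0.
  split; first exact: mk.
  have l1 := lambda1 Too; have l1' : 0 < 1 - lambda by rewrite subr_gt0.
  have iq : mu.-integrable D (EFin \o (fun t => q (2 * k t) (v t))).
    apply/integrableP; split.
      apply/measurable_EFinP; apply: measurable_funD; apply: measurable_funM => //;
      apply: measurable_funX => //; exact: measurable_funM.
    rewrite costE in fin; apply: le_lt_trans fin; rewrite le_eqVlt; apply/orP; left.
    by apply/eqP/eq_integral => t _ /=; rewrite ger0_norm.
  have iq' := integrableZl mD (1 - lambda)^-1 iq.
  apply: (@le_integrable _ _ _ mu D mD (EFin \o (fun t => k t ^+ 2)) _ _ _ iq').
    by apply/measurable_EFinP; exact: measurable_funX.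
  move=> t _; rewrite /= lee_fin !ger0_norm ?sqr_ge0 ?mulr_ge0 ?invr_ge0 ?(ltW l1')//.
  rewrite mulrC ler_pdivlMr// /q.
  have := mulr_ge0 lambda0 (sqr_ge0 (v t)); have := mulr_ge0 (ltW l1') (sqr_ge0 (k t)).
  nra.
pose d := (fun t => k t - h t) \_ free.
have Ld : L2 setT d.
  apply/(L2_restrict _ measurableT mfree).1; rewrite setTI.
  apply: L2B => //; last by apply: L2_subset Lh.
  by apply: L2_subset LkD => //; exact: free_D0.
have d_free t : ~ free t -> d t = 0.
  by move=> nt; rewrite /d patchE memNset.
have kd : \forall t \ae mu, -1 <= t -> ((t - 1)%:E <= T)%E -> k t = h t + d t.
  have kend' : \forall t \ae mu, forall r, T = r%:E -> r - 1 <= t <= r + 1 -> k t = 0.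
    have [[r Tr]|nT] := pselect (exists r, T = r%:E); last first.
      by apply: aeW => t r Tr; case: nT; exists r.
    apply: ae_impl (kend r Tr) => t H r'; rewrite Tr => -[<-]; exact: H.
  apply: ae_impl kend' => t kt tm1 tT.
  have [t1|t1] := ltP t 1.
    rewrite d_free ?addr0; last by case=> t1' _; move: (lt_le_trans t1 t1'); rewrite ltxx.
    by rewrite kF ?h_data//; apply/andP; split.
  have [ft|nft] := pselect (free t); first by rewrite /d patchE mem_set// addrC subrK.
  rewrite d_free// addr0; have : (T <= (t + 1)%:E)%E.
    by rewrite leNgt; apply/negP => tT'; apply: nft.
  have [[r Tr]|Too] := T_cases; last by rewrite Too leye_eq.
  move: tT; rewrite Tr !lee_fin => tr rt.
  have tr1 : r - 1 <= t by rewrite lerBlDr.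
  rewrite (kt r Tr); last by rewrite tr1 -lerBlDr.
  by rewrite (h_end Tr).
have sub1 t : D t -> -1 <= t + 1 /\ ((t + 1 - 1)%:E <= T)%E.
  by move=> [t0 tT]; rewrite addrK; split => //; lra.
have sub2 t : D t -> -1 <= t - 1 /\ ((t - 1 - 1)%:E <= T)%E.
  by move=> [t0 tT]; split; [lra|apply: le_trans tT; rewrite lee_fin; lra].
have vu : \forall t \ae mu, D t -> v t = u t + (d (t + 1) + d (t - 1)).
  have A1 := @ae_shift R 1 _ kd; have A2 := @ae_shift R (-1) _ kd.
  apply: ae_impl2 A1 A2 => t H1 H2 Dt; rewrite vE//.
  have [a1 b1] := sub1 t Dt; have [a2 b2] := sub2 t Dt.
  by rewrite H1// H2// /u; ring.
have kdD : \forall t \ae mu, D t -> k t = h t + d t.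
  apply: ae_impl kd => t H [t0 tT]; apply: H; first by lra.
  by apply: le_trans tT; rewrite lee_fin; lra.
have Ld1 := L2T_shift 1 Ld; have Ldm1 := L2T_shift (-1) Ld.
have mT : measurable (setT : set mR) by [].
have LD (f : R -> R) : L2 setT f -> L2 D f by move=> Lf; apply: L2_subset Lf.
have Ls : L2 setT (shifts d) by exact: (L2D mT Ld1 Ldm1).
exists d; split => //.
  by move=> t nDt; apply: d_free => /free_D0.
have Lkk := LD _ (L2D mT Lh Ld); have Luu := LD _ (L2D mT Lu Ls).
rewrite costE (_ : (\int[mu]_(t in D) (q (2 * k t) (v t))%:E =
   \int[mu]_(t in D) (q (2 * (h t + d t)) (u t + shifts d t))%:E)%E); last first.
  apply: ae_eq_integral => //.
  - apply/measurable_EFinP; apply: measurable_funD; apply: measurable_funM => //;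
      apply: measurable_funX => //; exact: measurable_funM.
  - exact: (measurable_int mu (q_integrable (L2Z 2 mD Lkk) Luu)).
  - by apply: ae_impl2 kdD vu => t H1 H2 Dt; rewrite H1// H2.
pose b t := (1 - lambda) * (4 * (h t * d t)) + lambda * (u t * shifts d t).
have ib : mu.-integrable D (EFin \o b).
  apply: integrable_lin => //; last exact: (L2_mul mD (LD _ Lu) (LD _ Ls)).
  exact: (integrableZl mD 4 (L2_mul mD (LD _ Lh) (LD _ Ld))).
have qh := q_integrable (L2Z 2 mD (LD _ Lh)) (LD _ Lu).
have qd := q_integrable (L2Z 2 mD (LD _ Ld)) (LD _ Ls).
have b0 : (\int[mu]_(t in D) (b t)%:E = 0)%E.
  rewrite -[LHS]fineK; last exact: (integrable_fin_num mD ib).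
  by congr EFin; exact: first_variation.
transitivity (\int[mu]_(t in D) (q (2 * h t) (u t) + (2 * b t + q (2 * d t) (shifts d t)))%:E)%E.
  apply: eq_integral => t _; congr EFin; rewrite /q /b; ring.
have i2b := integrableZl mD 2 ib.
rewrite integralD_EFin//; last exact: (integrableD mD i2b qd).
congr (_ + _)%E; rewrite integralD_EFin//.
have -> : (\int[mu]_(t in D) (2 * b t)%:E = 0)%E.
  transitivity (\int[mu]_(t in D) (2%:E * (b t)%:E))%E; first by apply: eq_integral.
  by rewrite integralZl// b0 mule0.
by rewrite add0e.
Qed.

Let cost_fin : (cost T lambda u (fun t => (2 * h t)%R) < +oo)%E.
Proof.
apply: (integrable_lty mD); apply: q_integrable; last exact: L2_subset Lu.
by apply: L2Z => //; exact: L2_subset Lh.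
Qed.

Let variation_ge0 (d : R -> R) :
  (0 <= \int[mu]_(t in D) ((1 - lambda) * (2 * d t) ^+ 2 +
                         lambda * (d (t + 1) + d (t - 1)) ^+ 2)%:E)%E.
Proof. by apply: integral_ge0 => t _; rewrite lee_fin; exact: q_ge0. Qed.

Lemma profile_optimal : optimal T lambda y0 y1 u (dAlembert h).
Proof.
exists (fun t => 2 * h t); first exact: profile_feasible.
move=> v w g Hfeas; have [fin|] := ltP (cost T lambda v g) +oo%E; last first.
  by rewrite leye_eq => /eqP ->; rewrite leey.
have [d [_ _ _ ->]] := cost_expansion Hfeas fin.
by rewrite leeDl.
Qed.

(** Equality of costs kills the second variation, hence the deviation itself
    when [lambda < 1] and that of the control when [lambda = 1]. *)
Lemma profile_unique v w : optimal T lambda y0 y1 v w ->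
  \forall t \ae mu, D t -> v t = u t.
Proof.
move=> [g Hfeas Hopt]; have le_cost := Hopt _ _ _ profile_feasible.
have fin := le_lt_trans le_cost cost_fin.
have [d [Ld dD vu costE]] := cost_expansion Hfeas fin.
have mT : measurable (setT : set mR) by [].
have LD (f : R -> R) : L2 setT f -> L2 D f by move=> Lf; apply: L2_subset Lf.
have Ls : L2 setT (shifts d) by exact: (L2D mT (L2T_shift 1 Ld) (L2T_shift (-1) Ld)).
have qd := q_integrable (L2Z 2 mD (LD _ Ld)) (LD _ Ls).
have cost0 : (0 <= cost T lambda u (fun t => (2 * h t)%R))%E.
  by apply: integral_ge0 => t _; rewrite lee_fin; exact: q_ge0.
have int0 : (\int[mu]_(t in D) (q (2 * d t) (shifts d t))%:E = 0)%E.
  apply/eqP; rewrite eq_le variation_ge0 andbT.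
  move: le_cost; rewrite costE -[leRHS]adde0 leeD2lE//.
  by rewrite ge0_fin_numE.
have /(ae_eq_integral_abs _ mD (measurable_int _ qd)) q0 :
    (\int[mu]_(t in D) `|(q (2 * d t) (shifts d t))%:E| = 0)%E.
  by rewrite -[RHS]int0; apply: eq_integral => t _; rewrite gee0_abs// lee_fin.
have {}q0 : \forall t \ae mu, D t -> q (2 * d t) (shifts d t) = 0.
  by apply: ae_impl q0 => t H Dt; have [] := H Dt.
have [l1|l1] := eqVneq lambda 1.
  apply: ae_impl2 q0 vu => t H1 H2 Dt; rewrite H2//; have := H1 Dt.
  rewrite /q l1 subrr mul0r add0r mul1r /shifts => /eqP; rewrite sqrf_eq0 => /eqP ->.
  by rewrite addr0.
have l1' : 0 < 1 - lambda by rewrite subr_gt0 lt_neqAle l1; case/andP: lambda01.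
have d0 : \forall t \ae mu, d t = 0.
  apply: ae_impl q0 => t H; have [Dt|nDt] := pselect (D t); last exact: dD.
  have := H Dt; rewrite /q => /eqP.
  have q1 : 0 <= (1 - lambda) * (2 * d t) ^+ 2 by rewrite mulr_ge0 ?sqr_ge0.
  have q2 : 0 <= lambda * shifts d t ^+ 2 by rewrite mulr_ge0 ?sqr_ge0.
  rewrite (paddr_eq0 q1 q2).
  move=> /andP[+ _]; rewrite mulf_eq0 (gt_eqF l1') /= sqrf_eq0 mulf_eq0 pnatr_eq0 /=.
  by move=> /eqP.
have A1 := @ae_shift R 1 _ d0; have A2 := @ae_shift R (-1) _ d0.
apply: ae_impl2 vu (ae_impl2 (fun t H1 H2 => conj H1 H2) A1 A2) => t H1 [H2 H3] Dt.
by rewrite H1// H2 H3 !addr0.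
Qed.

End optimality.

(** * The discrete Euler-Lagrange equation *)

Section recurrence.
Context (R : realType).
Variable lambda : R.
Notation z := (zlam lambda).

(** In terms of [s = sqrt (1 - lambda)] the identities satisfied by [zlam] are
    rational. *)
Lemma zlam_sqrt : 0 <= lambda < 1 ->
  z = (Num.sqrt (1 - lambda) - 1) / (Num.sqrt (1 - lambda) + 1).
Proof.
move=> /andP[l0 l1]; rewrite /zlam; set s := Num.sqrt _.
have s0 : 0 <= s by exact: sqrtr_ge0.
have lE : lambda = 1 - s ^+ 2 by rewrite sqr_sqrtr ?subr_ge0 ?ltW//; ring.
rewrite {1 2}lE.
have -> : 2 - (1 - s ^+ 2) + 2 * s = (s + 1) ^+ 2 by ring.
have -> : - (1 - s ^+ 2) = (s - 1) * (s + 1) by ring.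
have s1 : s + 1 != 0 by apply: lt0r_neq0; lra.
by field.
Qed.

Lemma zlam_itv : 0 <= lambda < 1 -> -1 < z <= 0.
Proof.
move=> l01; rewrite zlam_sqrt//; set s := Num.sqrt _.
have /andP[l0 l1] := l01.
have s0 : 0 < s by rewrite sqrtr_gt0 subr_gt0.
have s1 : s <= 1 by rewrite -[leRHS]sqrtr1; apply: ler_wsqrtr; rewrite gerBl.
have s1' : 0 < s + 1 by lra.
by rewrite ltr_pdivlMr// ler_pdivrMr// mul0r; apply/andP; split; lra.
Qed.

Lemma zlam_lt0 : 0 < lambda < 1 -> z < 0.
Proof.
move=> /andP[l0 l1]; rewrite /zlam mulNr oppr_lt0 divr_gt0//.
by have := sqrtr_ge0 (1 - lambda); lra.
Qed.

Lemma zlam_root : 0 <= lambda < 1 -> lambda + (4 - 2 * lambda) * z + lambda * z ^+ 2 = 0.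
Proof.
move=> l01; have /andP[l0 l1] := l01; rewrite zlam_sqrt//; set s := Num.sqrt _.
have s0 : 0 <= s by exact: sqrtr_ge0.
have -> : lambda = 1 - s ^+ 2 by rewrite sqr_sqrtr ?subr_ge0 ?ltW//; ring.
have s1 : s + 1 != 0 by apply: lt0r_neq0; lra.
by field.
Qed.

Lemma zlam_pow_lt1 n : 0 <= lambda < 1 -> (0 < n)%N -> z ^+ (2 * n) < 1.
Proof.
move=> /zlam_itv/andP[z1 z0] n0; rewrite exprM.
have z2 : 0 <= z ^+ 2 < 1 by rewrite sqr_ge0 /=; nra.
by rewrite expr_lt1//; case/andP: z2.
Qed.

(** The solution of the two-point problem [c 0 = 1], [c n = 0] of the
    recurrence: a combination of [z ^ k] and [z ^ - k] when [lambda < 1], and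
    an alternating affine sequence when the two roots collide at -1.  Writing
    [z ^ (2 n - k)] avoids inverting [z], which vanishes for [lambda = 0]. *)
Definition coef (n k : nat) : R :=
  if (n <= k)%N then 0
  else if lambda == 1 then (-1) ^+ k * (1 - k%:R / n%:R)
  else (z ^+ k - z ^+ (2 * n - k)) / (1 - z ^+ (2 * n)).

Lemma coef_ge n k : (n <= k)%N -> coef n k = 0.
Proof. by rewrite /coef => ->. Qed.

Lemma coef_eq1 n k : lambda = 1 -> (0 < n)%N -> (k <= n)%N ->
  coef n k = (-1) ^+ k * (1 - k%:R / n%:R).
Proof.
move=> l1 n0 kn; rewrite /coef l1 eqxx; case: ifP => // nk.
have -> : k = n by apply/eqP; rewrite eqn_leq kn.
by rewrite divff ?subrr ?mulr0// pnatr_eq0 -lt0n.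
Qed.

Lemma coef_lt1 n k : lambda < 1 -> (k <= n)%N ->
  coef n k = (z ^+ k - z ^+ (2 * n - k)) / (1 - z ^+ (2 * n)).
Proof.
move=> l1 kn; rewrite /coef lt_eqF//; case: ifP => // nk.
have -> : k = n by apply/eqP; rewrite eqn_leq kn.
by rewrite mul2n -addnn addnK subrr mul0r.
Qed.

Lemma coef0 n : 0 <= lambda <= 1 -> (0 < n)%N -> coef n 0 = 1.
Proof.
move=> /andP[l0]; rewrite le_eqVlt => /orP[/eqP l1|l1] n0.
  by rewrite coef_eq1// mul0r subr0 expr0 mulr1.
rewrite coef_lt1// subn0 expr0 divff// subr_eq0 eq_sym lt_eqF//.
by apply: zlam_pow_lt1; rewrite ?l0.
Qed.

Lemma coef_recurrence n k : 0 <= lambda <= 1 -> (k.+1 < n)%N ->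
  lambda * coef n k + (4 - 2 * lambda) * coef n k.+1 + lambda * coef n k.+2 = 0.
Proof.
move=> /andP[l0]; rewrite le_eqVlt => /orP[/eqP l1|l1] kn.
  have n0 : (0 < n)%N by exact: leq_ltn_trans kn.
  rewrite !coef_eq1//; [|exact: ltnW|exact: (ltnW (ltnW kn))].
  rewrite l1 -[k.+2]addn2 -[k.+1]addn1 !natrD !exprD.
  have nn : n%:R != 0 :> R by rewrite pnatr_eq0 -lt0n.
  by field.
rewrite !coef_lt1//; [|exact: ltnW|exact: (ltnW (ltnW kn))].
have zr := @zlam_root (introT andP (conj l0 l1)).
have [m mE] : exists m, (2 * n - k)%N = m.+2.
  have : (1 < 2 * n - k)%N by rewrite ltn_subRL addn1 (leq_trans kn)// leq_pmull.
  by case: (2 * n - k)%N => [|[|m]] // _; exists m.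
have -> : (2 * n - k.+1)%N = m.+1 by rewrite subnS mE.
have -> : (2 * n - k.+2)%N = m by rewrite !subnS mE.
rewrite mE.
transitivity ((z ^+ k - z ^+ m) * (lambda + (4 - 2 * lambda) * z + lambda * z ^+ 2)
    / (1 - z ^+ (2 * n))); last by rewrite zr mulr0 mul0r.
rewrite !exprS; ring.
Qed.

End recurrence.

(** * The optimal profiles *)

Section candidates.
Context (R : realType).
Notation mu := (@lebesgue_measure R).
Notation mR := (measurableTypeR R).
Variables (lambda : R) (y0 dy0 y1 : R -> R).
Hypothesis data : initial_data y0 dy0 y1.
Notation F := (Fdata dy0 y1).
Notation z := (zlam lambda).

Let mI : measurable (`[-1, 1[ : set mR). Proof. exact: measurable_itv. Qed.

(** On a horizon [2 N + rho] the chain of [s] has [N + 1] control times when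
    [s < rho - 1] and [N] otherwise. *)
Definition finite_profile (N : nat) (rho : R) : R -> R :=
  chain (fun k s => coef lambda (if s < rho - 1 then N.+1 else N) k * F s).

Definition infinite_profile : R -> R := chain (fun k s => z ^+ k * F s).

Let L2_two_scales (p c d : R) : L2 `[-1, 1[ (fun s => (if s < p then c else d) * F s).
Proof.
have LF := L2_Fdata_co data.
pose A : set R := [set s | s < p].
have mA : measurable (A : set mR).
  rewrite (_ : A = `]-oo, p[%classic :> set R); first exact: measurable_itv.
  by apply/seteqP; split=> x /=; rewrite in_itv.
have mAC : measurable (~` A : set mR) by exact: measurableC.
have L1 : L2 `[-1, 1[ (F \_ A).
  apply/(L2_restrict F mI mA).1.
  by apply: (L2_subset mI (measurableI _ _ mI mA) _ LF) => x [].
have L2' : L2 `[-1, 1[ (F \_ (~` A)).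
  apply/(L2_restrict F mI mAC).1.
  by apply: (L2_subset mI (measurableI _ _ mI mAC) _ LF) => x [].
have := L2_lin c d mI L1 L2'; apply: eq_L2 => // s _.
rewrite !patchE in_setC; have -> : (s \in A) = (s < p) by apply/idP/idP; rewrite inE.
by case: (s < p); rewrite /= mulr0 ?addr0 ?add0r.
Qed.

Lemma finite_profileE N rho k s : -1 <= s < 1 -> finite_profile N rho (s + 2 * k%:R) =
  coef lambda (if s < rho - 1 then N.+1 else N) k * F s.
Proof. by move=> s1; rewrite /finite_profile chainE. Qed.

Lemma infinite_profileE k s : -1 <= s < 1 ->
  infinite_profile (s + 2 * k%:R) = z ^+ k * F s.
Proof. by move=> s1; rewrite /infinite_profile chainE. Qed.

Section finite_horizon.
Variables (N : nat) (rho : R).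
Hypothesis N0 : (0 < N)%N.
Hypothesis rho02 : 0 <= rho < 2.
Hypothesis lambda01 : 0 <= lambda <= 1.
Notation T := (2 * N%:R + rho).
Notation h := (finite_profile N rho).

Let rho0 : 0 <= rho. Proof. by case/andP: rho02. Qed.
Let N1 : 1 <= N%:R :> R. Proof. by rewrite ler1n. Qed.

Let chain_length s := if s < rho - 1 then N.+1 else N.

Let length_gt0 s : (0 < chain_length s)%N.
Proof. by rewrite /chain_length; case: ifP. Qed.

Let length_le k s : -1 <= s < 1 -> T - 1 <= s + 2 * k%:R -> (chain_length s <= k)%N.
Proof.
move=> /andP[s1 s2] Tk; have r0 := rho0; rewrite /chain_length; case: ltP => sr.
  rewrite -(ltr_nat R); lra.
by rewrite -ltnS -(ltr_nat R) -[k.+1]addn1 natrD; lra.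
Qed.

Let length_gt k s : -1 <= s < 1 -> s + 2 * k%:R < T - 1 -> (k < chain_length s)%N.
Proof.
move=> /andP[s1 s2] Tk; have /andP[_ r2] := rho02; rewrite /chain_length; case: ltP => sr.
  by rewrite -(ltr_nat R) -[N.+1]addn1 natrD; lra.
by rewrite -(ltr_nat R); lra.
Qed.

Let h_data s : -1 <= s < 1 -> h s = F s.
Proof.
move=> s1; have := finite_profileE N rho 0 s1; rewrite mulr0 addr0 => ->.
by rewrite coef0 ?mul1r//; exact: length_gt0.
Qed.

Let h_end t : T - 1 <= t -> h t = 0.
Proof.
move=> tT; have [|k [s [s1 tE]]] := @chain_decomp R t; first by have := rho0; have := N1; lra.
rewrite tE finite_profileE// coef_ge ?mul0r//.
by apply: length_le => //; rewrite -tE.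
Qed.

Let L2h : L2 setT h.
Proof.
have Lloc : L2loc h.
  apply: L2loc_chain => k.
  have := L2_two_scales (rho - 1) (coef lambda N.+1 k) (coef lambda N k).
  by apply: eq_L2 => // s _; case: ifP.
have mT : measurable (`[-1, T] : set mR) by exact: measurable_itv.
have := Lloc.2 (-1) T; rewrite -[X in L2 X]setTI => /(L2_restrict h measurableT mT).1.
apply: eq_L2 => // t _; rewrite patchE; case: ifPn => //.
rewrite notin_setE /= in_itv/= => /negP; rewrite negb_and -!ltNge => /orP[t1|t1].
  by rewrite /finite_profile /chain t1.
by rewrite h_end//; lra.
Qed.

Let h_EL t : 1 <= t -> ((t + 1)%:E < T%:E)%E ->
  lambda * h (t - 2) + (4 - 2 * lambda) * h t + lambda * h (t + 2) = 0.
Proof.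
rewrite lte_fin => t1 tT; have [|k [s [s1 tE]]] := @chain_decomp R (t - 2); first lra.
have tE1 : t = s + 2 * k.+1%:R by rewrite -[k.+1]addn1 natrD; lra.
have tE2 : t + 2 = s + 2 * k.+2%:R by rewrite -[k.+2]addn2 natrD; lra.
rewrite tE2 tE tE1 !finite_profileE// -/(chain_length s).
have kn : (k.+1 < chain_length s)%N by apply: length_gt => //; rewrite -tE1; lra.
have EL := coef_recurrence lambda01 kn.
transitivity ((lambda * coef lambda (chain_length s) k +
  (4 - 2 * lambda) * coef lambda (chain_length s) k.+1 +
  lambda * coef lambda (chain_length s) k.+2) * F s); first ring.
by rewrite EL mul0r.
Qed.

Lemma finite_horizon_optimal :
  optimal T%:E lambda y0 y1 (profile_control h) (dAlembert h) /\
  forall v w, optimal T%:E lambda y0 y1 v w ->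
    \forall t \ae mu, time_itv T%:E t -> v t = profile_control h t.
Proof.
have T2 : (2%:E <= T%:E)%E by rewrite lee_fin; have := rho0; have := N1; lra.
have Tfin : T%:E = +oo%E -> lambda < 1 by [].
have hend r : T%:E = r%:E -> forall t, r - 1 <= t -> h t = 0 by move=> [<-].
split; first exact: (profile_optimal T2 lambda01 Tfin data L2h h_data hend h_EL).
exact: (profile_unique T2 lambda01 Tfin data L2h h_data hend h_EL).
Qed.

End finite_horizon.

Section infinite_horizon.
Hypothesis lambda01 : 0 <= lambda < 1.
Notation h := infinite_profile.

Let h_data s : -1 <= s < 1 -> h s = F s.
Proof.
by move=> s1; have := infinite_profileE 0 s1; rewrite mulr0 addr0 expr0 mul1r.
Qed.

Lemma infinite_profile_step t k : -1 <= t -> h (t + 2 * k%:R) = z ^+ k * h t.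
Proof.
move=> /chain_decomp[j [s [s1 ->]]].
have -> : s + 2 * j%:R + 2 * k%:R = s + 2 * (j + k)%:R by rewrite natrD; ring.
by rewrite !infinite_profileE// mulrA -exprD addnC.
Qed.

Lemma L2loc_infinite_profile : L2loc h.
Proof.
apply: L2loc_chain => k.
exact: (L2Z _ mI (L2_Fdata_co data)).
Qed.
Let Lloc := L2loc_infinite_profile.

Let isq a b : mu.-integrable `[a, b] (EFin \o (fun x => h x ^+ 2)).
Proof. exact: (L2_sq (Lloc.2 a b)). Qed.

Lemma sqint_infinite_profile_step (a b : R) k : -1 <= a ->
  \int[mu]_(x in `[a + 2 * k%:R, b + 2 * k%:R]) h x ^+ 2 =
  z ^+ (2 * k) * \int[mu]_(x in `[a, b]) h x ^+ 2.
Proof.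
move=> a1.
have := @Rintegral_shift R (a + 2 * k%:R) (b + 2 * k%:R) (2 * k%:R) (fun x => h x ^+ 2).
rewrite !addrK => <-; last by apply: measurable_funTS; apply: measurable_funX; exact: Lloc.1.
rewrite -RintegralZl//; apply: eq_Rintegral => x; rewrite inE /= in_itv/= => /andP[ax _].
by rewrite infinite_profile_step ?(le_trans a1)// exprMn -exprM mulnC.
Qed.

Let I0 := \int[mu]_(x in `[-1, 1]) h x ^+ 2.

(** Each period carries [z ^ 2] times the square norm of the preceding one: the
    bound is the sum of the geometric series. *)
Let bounded_energy n : \int[mu]_(x in `[-1, 2 * n%:R + 1]) h x ^+ 2 <= I0 / (1 - z ^+ 2).
Proof.
have /andP[z1 z0] := zlam_itv lambda01.
have z2 : 0 < 1 - z ^+ 2 by nra.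
have z20 : 0 <= z ^+ 2 by exact: sqr_ge0.
have I00 : 0 <= I0 by apply: Rintegral_ge0 => x _; exact: sqr_ge0.
elim: n => [|n IH].
  by rewrite mulr0 add0r ler_pdivlMr// -/I0; nra.
have n0 : 0 <= n%:R :> R by exact: ler0n.
rewrite (@Rintegral_split _ _ 1); [|by rewrite -[n.+1]addn1 natrD; apply/andP; split; lra|exact: isq].
have -> : 2 * n.+1%:R + 1 = (2 * n%:R + 1) + 2 * 1%:R :> R by rewrite -[n.+1]addn1 natrD; ring.
have := @sqint_infinite_profile_step (-1) (2 * n%:R + 1) 1 (lexx _).
have -> : -1 + 2 * 1%:R = 1 :> R by ring.
move=> ->; rewrite muln1 -/I0.
move: IH; rewrite !ler_pdivlMr//; move: (\int[mu]_(x in _) _) => J H.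
nra.
Qed.

Let L2h : L2 setT h.
Proof.
pose A : set mR := [set t | -1 <= t].
pose B n : set mR := `[-1, 2 * n%:R + 1]%classic.
have AE : A = \bigcup_n B n.
  apply/seteqP; split=> [x x1|x [n _]]; last by rewrite /B /= in_itv/= => /andP[].
  exists (Num.truncn x).+1 => //; rewrite /B /= in_itv/= x1 /=.
  have := truncnS_gt x; have : 0 <= (Num.truncn x).+1%:R :> R by exact: ler0n.
  lra.
have mB n : measurable (B n) by exact: measurable_itv.
have mA : measurable A by rewrite AE; exact: bigcupT_measurable.
have LA : L2 A h.
  split; first by apply: measurable_funTS; exact: Lloc.1.
  apply/integrableP; split.
    by apply/measurable_EFinP/measurable_funX/measurable_funTS; exact: Lloc.1.
  apply: (@le_lt_trans _ _ (I0 / (1 - z ^+ 2))%:E); last exact: ltry.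
  have ndB : nondecreasing_seq B.
    move=> m n mn; apply/subsetPset => x; rewrite /B /= !in_itv/= => /andP[-> xm].
    by apply: (le_trans xm); rewrite lerD2r ler_pM2l// ler_nat.
  have mf n : measurable_fun (B n) (fun x => `|(h x ^+ 2)%:E|)%E.
    apply: measurableT_comp => //.
    by apply/measurable_EFinP/measurable_funX/measurable_funTS; exact: Lloc.1.
  have f0 n x : B n x -> (0 <= `|(h x ^+ 2)%:E|)%E by move=> _; exact: abse_ge0.
  have cv := ge0_nondecreasing_set_cvg_integral (mu := mu) ndB mB mf f0.
  rewrite AE -(cvg_lim _ cv)//; apply: lime_le; first by apply/cvg_ex; eexists; exact: cv.
  apply: nearW => n.
  have -> : (\int[mu]_(x in B n) `|(h x ^+ 2)%:E| = (\int[mu]_(x in B n) (h x ^+ 2))%:E)%E.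
    rewrite /Rintegral fineK; last exact: (integrable_fin_num (mB n) (isq _ _)).
    by apply: eq_integral => x _; rewrite gee0_abs// lee_fin sqr_ge0.
  by rewrite lee_fin bounded_energy.
move: LA; rewrite -[X in L2 X]setTI => /(L2_restrict h measurableT mA).1.
apply: eq_L2 => // t _; rewrite patchE; case: ifPn => //.
rewrite notin_setE /A /= => /negP; rewrite -ltNge => t1.
by rewrite /infinite_profile /chain t1.
Qed.

Let h_EL t : 1 <= t -> ((t + 1)%:E < +oo)%E ->
  lambda * h (t - 2) + (4 - 2 * lambda) * h t + lambda * h (t + 2) = 0.
Proof.
move=> t1 _; have tm : -1 <= t - 2 by lra.
have E1 := infinite_profile_step 1 tm; have E2 := infinite_profile_step 2 tm.
have -> : h t = z * h (t - 2) by rewrite -[z]expr1 -E1; congr h; ring.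
have -> : h (t + 2) = z ^+ 2 * h (t - 2) by rewrite -E2; congr h; ring.
transitivity ((lambda + (4 - 2 * lambda) * z + lambda * z ^+ 2) * h (t - 2)); first ring.
by rewrite zlam_root// mul0r.
Qed.

Lemma infinite_horizon_optimal :
  optimal +oo%E lambda y0 y1 (profile_control h) (dAlembert h) /\
  forall v w, optimal +oo%E lambda y0 y1 v w ->
    \forall t \ae mu, time_itv +oo%E t -> v t = profile_control h t.
Proof.
have /andP[l0 l1] := lambda01.
have l01 : 0 <= lambda <= 1 by rewrite l0 ltW.
have T2 : ((2 : R)%:E <= +oo)%E by rewrite leey.
have hend (r : R) : +oo%E = r%:E -> forall t, r - 1 <= t -> h t = 0 by [].
split; first exact: (profile_optimal T2 l01 (fun=> l1) data L2h h_data hend h_EL).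
exact: (profile_unique T2 l01 (fun=> l1) data L2h h_data hend h_EL).
Qed.

End infinite_horizon.

End candidates.

(** * Explicit controls and decay of the state *)

Section explicit_controls.
Context (R : realType).
Notation mu := (@lebesgue_measure R).
Notation mR := (measurableTypeR R).
Variables (lambda : R) (y0 dy0 y1 : R -> R).
Hypothesis data : initial_data y0 dy0 y1.
Notation F := (Fdata dy0 y1).
Notation z := (zlam lambda).

Let ae_along_chains (T : \bar R) (u v : R -> R) :
  (\forall t \ae mu, time_itv T t -> v t = u t) ->
  \forall t \ae mu, 0 < t < 2 -> forall k : nat, ((t + 2 * k%:R)%:E <= T)%E ->
    v (t + 2 * k%:R) = u (t + 2 * k%:R).
Proof.
move=> vu; have : \forall t \ae mu, forall k : nat, time_itv T (t + 2 * k%:R) ->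
    v (t + 2 * k%:R) = u (t + 2 * k%:R).
  by apply: ae_foralln => k; exact: (@ae_shift R (2 * k%:R) _ vu).
apply: ae_impl => t H /andP[t0 _] k tk; apply: H; split => //.
by rewrite addr_ge0 ?(ltW t0)// mulr_ge0.
Qed.

Lemma Fdata_left t : t < 1 -> F (t - 1) = (dy0 (1 - t) - y1 (1 - t)) / 2.
Proof. by move=> t1; rewrite /Fdata subr_lt0 t1 opprB. Qed.

Lemma Fdata_right t : 1 <= t -> F (t - 1) = (dy0 (t - 1) + y1 (t - 1)) / 2.
Proof. by move=> t1; rewrite /Fdata subr_lt0 ltNge t1. Qed.

Lemma even_horizon_control n v : (0 < n)%N -> 0 <= lambda <= 1 ->
  optimal_control ((2 * n)%:R%:E) lambda y0 y1 v ->
  \forall t \ae mu, 0 < t < 2 -> forall k : nat, t + 2 * k%:R <= (2 * n)%:R ->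
    v (t + 2 * k%:R) = (coef lambda n k + coef lambda n k.+1) * F (t - 1).
Proof.
move=> n0 l01 [w].
have rho : 0 <= (0 : R) < 2 by rewrite lexx /=.
have -> : (2 * n)%:R = 2 * n%:R + 0 :> R by rewrite natrM addr0.
have [_ uniq] := finite_horizon_optimal data n0 rho l01.
move=> /uniq/ae_along_chains; apply: ae_impl => t H t02 k tk.
rewrite (H t02 k); last by rewrite lee_fin.
have s1 : -1 <= t - 1 < 1 by case/andP: t02 => ? ?; apply/andP; split; lra.
rewrite /profile_control.
have -> : t + 2 * k%:R + 1 = t - 1 + 2 * k.+1%:R by rewrite -[k.+1]addn1 natrD; ring.
have -> : t + 2 * k%:R - 1 = t - 1 + 2 * k%:R by ring.
rewrite !finite_profileE// sub0r ltNge; case/andP: s1 => -> _ /=.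
by rewrite -mulrDl addrC.
Qed.

Lemma infinite_horizon_control v : 0 <= lambda < 1 ->
  optimal_control +oo%E lambda y0 y1 v ->
  \forall t \ae mu, 0 < t < 2 -> forall k : nat,
    v (t + 2 * k%:R) = z ^+ k * ((1 + z) * F (t - 1)).
Proof.
move=> l01 [w]; have [_ uniq] := infinite_horizon_optimal data l01.
move=> /uniq/ae_along_chains; apply: ae_impl => t H t02 k.
rewrite (H t02 k) ?leey//.
have s1 : -1 <= t - 1 < 1 by case/andP: t02 => ? ?; apply/andP; split; lra.
rewrite /profile_control.
have -> : t + 2 * k%:R + 1 = t - 1 + 2 * k.+1%:R by rewrite -[k.+1]addn1 natrD; ring.
have -> : t + 2 * k%:R - 1 = t - 1 + 2 * k%:R by ring.
rewrite !infinite_profileE// exprS; ring.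
Qed.

(** Induction along the chains, each value being the control minus the preceding
    value. *)
Let profile_determined (h k : R -> R) :
  (forall s, -1 <= s < 1 -> k s = h s) ->
  (\forall t \ae mu, 0 <= t -> k (t + 1) + k (t - 1) = h (t + 1) + h (t - 1)) ->
  \forall t \ae mu, -1 <= t -> k t = h t.
Proof.
move=> kh0 step.
have step1 := @ae_shift R (-1) _ step.
have A n : \forall t \ae mu, 2 * n%:R - 1 <= t < 2 * n%:R + 1 -> k t = h t.
  elim: n => [|n IH].
    by apply: aeW => t; rewrite mulr0 sub0r add0r; exact: kh0.
  have IH2 := @ae_shift R (-2) _ IH.
  apply: ae_impl2 step1 IH2 => t H1 H2; rewrite -[n.+1]addn1 natrD => /andP[t1 t2].
  have n0 : 0 <= n%:R :> R by exact: ler0n.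
  have E2 : k (t - 2) = h (t - 2) by apply: H2; apply/andP; split; lra.
  have := H1 _; rewrite subrK.
  have -> : t - 1 - 1 = t - 2 by ring.
  by rewrite E2 => /(_ _)/addIr; apply; lra.
have : \forall t \ae mu, forall n : nat, 2 * n%:R - 1 <= t < 2 * n%:R + 1 -> k t = h t.
  exact: ae_foralln.
apply: ae_impl => t H /chain_decomp[n [s [/andP[s1 s2] tE]]].
by apply: (H n); rewrite tE; apply/andP; split; lra.
Qed.

Lemma infinite_horizon_state u y : 0 <= lambda < 1 ->
  optimal +oo%E lambda y0 y1 u y -> forall t, 0 <= t ->
  (\forall x \ae mu, 0 <= x <= 1 -> pos_x y t x =
    infinite_profile lambda dy0 y1 (t + x) + infinite_profile lambda dy0 y1 (t - x)) /\
  (\forall x \ae mu, 0 <= x <= 1 -> pos_t y t x =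
    infinite_profile lambda dy0 y1 (t + x) - infinite_profile lambda dy0 y1 (t - x)).
Proof.
move=> l01 Hopt t t0; set h := infinite_profile _ _ _.
have [_ uniq] := infinite_horizon_optimal data l01.
have uh := uniq _ _ Hopt; have [g Hfeas _] := Hopt.
have T2 : ((2 : R)%:E <= +oo)%E by rewrite leey.
have [k [_ kF uE _ [state _]]] := feasible_profile T2 data Hfeas.
have DT (s : R) : 0 <= s -> time_itv +oo%E s by move=> s0; split => //; rewrite leey.
have kh : \forall s \ae mu, -1 <= s -> k s = h s.
  apply: profile_determined.
    move=> s s1; rewrite kF//.
    by have := infinite_profileE lambda dy0 y1 0 s1; rewrite mulr0 addr0 expr0 mul1r.
  apply: ae_impl uh => s H s0; rewrite -uE; last exact: DT.
  by rewrite H//; exact: DT.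
have [px pt] := state t (DT t t0).
have khD : \forall x \ae mu, 0 <= x <= 1 -> k (t + x) = h (t + x) /\ k (t - x) = h (t - x).
  have A1 := @ae_shift R t _ kh; have A2 := @ae_reflect R t _ kh.
  apply: ae_impl2 A1 A2 => x H1 H2 /andP[x0 x1]; split; last by apply: H2; lra.
  by rewrite addrC; apply: H1; lra.
split.
  by apply: ae_impl2 px khD => x H1 H2 x01; rewrite H1//; have [-> ->] := H2 x01.
by apply: ae_impl2 pt khD => x H1 H2 x01; rewrite H1//; have [-> ->] := H2 x01.
Qed.

Let ae_ne01 : \forall x \ae mu, 0 <= x <= 1 -> 0 < x < 1.
Proof.
exists [set 0; 1]; split; first by apply: measurableU; exact: measurable_set1.
  exact/countable_lebesgue_measure0/finite_set_countable/finite_set2.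
move=> x /= /not_implyP[/andP[x0 x1]]; rewrite !lt_neqAle x0 x1 !andbT => /negP.
by rewrite negb_and !negbK => /orP[/eqP <-|/eqP ->]; [left|right].
Qed.

Let sqint_sym (h : R -> R) (t : R) : L2loc h ->
  \int[mu]_(x in `[0, 1]) (h (t + x) ^+ 2 + h (t - x) ^+ 2) =
  \int[mu]_(x in `[t - 1, t + 1]) h x ^+ 2.
Proof.
move=> Lh.
have mh2 a b : measurable_fun (`[a, b] : set R) (fun x => h x ^+ 2).
  by apply: measurable_funTS; apply: measurable_funX; exact: Lh.1.
rewrite RintegralD//; [|exact: (L2_sq (L2_advance Lh t 0 1))|exact: (L2_sq (L2_retard Lh t 0 1))].
have := @Rintegral_reflect R (t - 1) t t _ (@mh2 _ _); rewrite subrr subKr => ->.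
have := @Rintegral_shift R t (1 + t) t _ (@mh2 _ _); rewrite subrr addrK => E.
under eq_Rintegral do rewrite addrC.
rewrite E addrC [1 + t]addrC; apply/esym/Rintegral_split; first by apply/andP; split; lra.
exact: (L2_sq (Lh.2 _ _)).
Qed.

Let measurable_sqsum (h : R -> R) (t : R) : L2loc h ->
  measurable_fun (`[0, 1] : set R) (fun x => 2 * (h (t + x) ^+ 2 + h (t - x) ^+ 2)).
Proof.
move=> Lh; apply: measurable_funM => //; apply: measurable_funD; apply: measurable_funX.
  exact: (L2_advance Lh t 0 1).1.
exact: (L2_retard Lh t 0 1).1.
Qed.

Let sqint_data : 0 <= lambda < 1 ->
  2 * \int[mu]_(x in `[-1, 1]) infinite_profile lambda dy0 y1 x ^+ 2 =
  \int[mu]_(x in `[0, 1]) (dy0 x ^+ 2 + y1 x ^+ 2).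
Proof.
move=> l01; have [[Ldy0 _] _ Ly1] := data.
have Lh := L2loc_infinite_profile lambda data; set h := infinite_profile _ _ _ in Lh *.
have m01 : measurable (`[0, 1] : set mR) by [].
have := sqint_sym 0 Lh; rewrite sub0r add0r => <-.
have i2 := integrableD m01 (L2_sq (L2_advance Lh 0 0 1)) (L2_sq (L2_retard Lh 0 0 1)).
rewrite -(RintegralZl 2 m01 i2); apply: Rintegral_ae_eq => //.
- apply: ae_impl ae_ne01 => x H; rewrite /= in_itv/= => /H/andP[x0 x1].
  have hF s : -1 <= s < 1 -> h s = F s.
    by move=> s1; have := infinite_profileE lambda dy0 y1 0 s1; rewrite mulr0 addr0 expr0 mul1r.
  rewrite add0r sub0r !hF; [|apply/andP; split; lra..].
  rewrite /Fdata oppr_lt0 x0 ltNge (ltW x0) /= opprK; by field.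
- exact: (@measurable_sqsum h 0 Lh).
- by apply: measurable_funD; apply: measurable_funX; [exact: Ldy0.1|exact: Ly1.1].
Qed.

(** The energy at time [r] is twice the square norm of the profile over
    [[r - 1, r + 1]].  Going back by [2 k] extracts [z ^ (2 k)], and the remaining
    window [[t - 1, t + 1]] meets two periods of the profile, the second one
    carrying at most as much as the first: hence the factor 2. *)
Lemma infinite_horizon_decay u y : 0 <= lambda < 1 ->
  optimal +oo%E lambda y0 y1 u y -> forall (t : R) k, 0 < t < 2 ->
  \int[mu]_(x in `[0, 1])
    (pos_x y (t + 2 * k%:R) x ^+ 2 + pos_t y (t + 2 * k%:R) x ^+ 2) <=
  2 * `|z| ^+ (2 * k) * \int[mu]_(x in `[0, 1]) (dy0 x ^+ 2 + y1 x ^+ 2).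
Proof.
move=> l01 Hopt t k /andP[t0 t2].
have tk0 : 0 <= t + 2 * k%:R by rewrite addr_ge0 ?(ltW t0)// mulr_ge0.
have [px pt] := infinite_horizon_state l01 Hopt tk0.
have [g [_ [[Hen _ _ _ _] _ _ _ _] _ _] _] := Hopt.
have [[Lpx _] Lpt] := Hen (t + 2 * k%:R) (conj tk0 (leey _)).
have Lh := L2loc_infinite_profile lambda data; set h := infinite_profile _ _ _ in px pt Lh *.
have m01 : measurable (`[0, 1] : set mR) by [].
set r := t + 2 * k%:R in px pt Lpx Lpt *.
have i2 := integrableD m01 (L2_sq (L2_advance Lh r 0 1)) (L2_sq (L2_retard Lh r 0 1)).
have -> : \int[mu]_(x in `[0, 1]) (pos_x y r x ^+ 2 + pos_t y r x ^+ 2) =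
    \int[mu]_(x in `[0, 1]) (2 * (h (r + x) ^+ 2 + h (r - x) ^+ 2)).
  apply: Rintegral_ae_eq => //.
  - apply: ae_impl2 px pt => x H1 H2; rewrite /= in_itv/= => x01.
    by rewrite H1// H2//; ring.
  - by apply: measurable_funD; apply: measurable_funX; [exact: Lpx.1|exact: Lpt.1].
  - exact: (@measurable_sqsum h r Lh).
rewrite (RintegralZl 2 m01 i2) (sqint_sym _ Lh).
have -> : r - 1 = (t - 1) + 2 * k%:R by rewrite /r; ring.
have -> : r + 1 = (t + 1) + 2 * k%:R by rewrite /r; ring.
rewrite (sqint_infinite_profile_step lambda data)//; last by lra.
have zk : z ^+ (2 * k) = `|z| ^+ (2 * k) by rewrite !exprM real_normK ?num_real.
rewrite zk -(sqint_data l01) -/h.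
have sq0 x : 0 <= h x ^+ 2 by exact: sqr_ge0.
have isq a b : mu.-integrable `[a, b] (EFin \o (fun x => h x ^+ 2)) by exact: (L2_sq (Lh.2 _ _)).
set I0 := \int[mu]_(x in `[-1, 1]) _.
have I00 : 0 <= I0 by apply: Rintegral_ge0.
have le4 : \int[mu]_(x in `[t - 1, t + 1]) h x ^+ 2 <= 2 * I0.
  apply: (@le_trans _ _ (\int[mu]_(x in `[-1, 3]) h x ^+ 2)).
    by apply: sub_Rintegral => //; lra.
  rewrite (@Rintegral_split _ _ 1); [|by apply/andP; split; lra|exact: isq].
  have := @sqint_infinite_profile_step R lambda _ _ _ data (-1) 1 1 (lexx _).
  have -> : -1 + 2 * 1%:R = 1 :> R by ring.
  have -> : 1 + 2 * 1%:R = 3 :> R by ring.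
  rewrite muln1 => ->; rewrite -/I0.
  have /andP[z1 z0] := zlam_itv l01.
  have z2 : z ^+ 2 <= 1 by nra.
  have := ler_wpM2r I00 z2; lra.
have zk0 : 0 <= `|z| ^+ (2 * k) by rewrite exprn_ge0.
have := ler_wpM2l zk0 le4; lra.
Qed.

End explicit_controls.

Lemma horizon_decomp (R : realType) (r : R) : 2 <= r ->
  exists N rho, [/\ (0 < N)%N, 0 <= rho < 2 & r = 2 * N%:R + rho].
Proof.
move=> r2; have r0 : 0 <= r / 2 by lra.
exists (Num.truncn (r / 2)), (r - 2 * (Num.truncn (r / 2))%:R).
have := truncn_itv r0; rewrite -[(Num.truncn _).+1]addn1 natrD => /andP[a b].
split; [|by apply/andP; split; lra|by rewrite addrC subrK].
by rewrite truncn_gt0; lra.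
Qed.

Theorem theorem1 (R : realType) :
  (forall y0 dy0 y1 : R -> R, initial_data y0 dy0 y1 ->
    [/\
      (* existence and uniqueness *)
      forall (T : \bar R) (lambda : R),
        (2%:E <= T)%E -> 0 <= lambda <= 1 -> (T = +oo%E -> lambda < 1) ->
        exists2 u, optimal_control T lambda y0 y1 u &
          forall v, optimal_control T lambda y0 y1 v ->
            \forall t \ae (@lebesgue_measure R), time_itv T t -> v t = u t,
      (* 1a *)
      forall (n : nat) (u : R -> R), (0 < n)%N ->
        optimal_control ((2 * n)%:R%:E) 1 y0 y1 u ->
        (\forall t \ae (@lebesgue_measure R), 0 < t < 2 ->
           forall k : nat, t + 2 * k%:R <= (2 * n)%:R ->
             u (t + 2 * k%:R) = (-1) ^+ k * u t) /\
        (\forall t \ae (@lebesgue_measure R),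
           (0 < t < 1 ->
              u t = 1 / (2 * n)%:R * (dy0 (1 - t) - y1 (1 - t))) /\
           (1 < t < 2 ->
              u t = 1 / (2 * n)%:R * (dy0 (t - 1) + y1 (t - 1)))),
      (* 1b *)
      forall (n : nat) (lambda : R) (u : R -> R), (0 < n)%N ->
        0 < lambda < 1 ->
        optimal_control ((2 * n)%:R%:E) lambda y0 y1 u ->
        [/\ -1 < zlam lambda < 0,
            L2 `[-1, 1] (Fdata dy0 y1) &
            \forall t \ae (@lebesgue_measure R), 0 < t < 2 ->
              forall k : nat, t + 2 * k%:R <= (2 * n)%:R ->
                u (t + 2 * k%:R) =
                  zlam lambda ^+ k * fplus n lambda dy0 y1 t +
                  1 / zlam lambda ^+ k * fminus n lambda dy0 y1 t],
      (* 2a *)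
      forall u w : R -> R,
        optimal_control +oo%E 0 y0 y1 u ->
        optimal_control (2%:E) 1 y0 y1 w ->
        (\forall t \ae (@lebesgue_measure R), 0 <= t <= 2 -> u t = w t) &
      (* 2b, control *)
      forall (lambda : R) (u : R -> R), 0 < lambda < 1 ->
        optimal_control +oo%E lambda y0 y1 u ->
        (\forall t \ae (@lebesgue_measure R),
           (0 < t < 1 ->
              u t = (1 + zlam lambda) / 2 * (dy0 (1 - t) - y1 (1 - t))) /\
           (1 < t < 2 ->
              u t = (1 + zlam lambda) / 2 * (dy0 (t - 1) + y1 (t - 1)))) /\
        (\forall t \ae (@lebesgue_measure R), 0 < t < 2 ->
           forall k : nat, (0 < k)%N ->
             u (t + 2 * k%:R) = zlam lambda ^+ k * u t)]) /\
  (* 2b, state: C0 does not depend on the initial data *)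
  (forall lambda : R, 0 < lambda < 1 ->
    exists2 C0 : R, 0 < C0 &
      forall (y0 dy0 y1 : R -> R), initial_data y0 dy0 y1 ->
      forall (u : R -> R) (y : trajectory R),
        optimal +oo%E lambda y0 y1 u y ->
      forall (t : R) (k : nat), 0 < t < 2 -> (0 < k)%N ->
        \int[@lebesgue_measure R]_(x in `[0, 1])
          (pos_x y (t + 2 * k%:R) x ^+ 2 + pos_t y (t + 2 * k%:R) x ^+ 2) <=
        C0 * `|zlam lambda| ^+ (2 * k) *
        \int[@lebesgue_measure R]_(x in `[0, 1]) (dy0 x ^+ 2 + y1 x ^+ 2)).
Proof.
split=> [y0 dy0 y1 data|lambda /andP[l0 l1]]; last first.
  exists 2 => // y0 dy0 y1 data u y Hopt t k t02 _.
  have l01 : 0 <= lambda < 1 by rewrite (ltW l0) l1.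
  exact: (infinite_horizon_decay data l01 Hopt).
have zE0 (R' : realType) (l : R') : 0 < l < 1 -> 0 <= l < 1.
  by move=> /andP[/ltW -> ->].
have zE1 (R' : realType) (l : R') : 0 < l < 1 -> 0 <= l <= 1.
  by move=> /andP[/ltW -> /ltW ->].
split.
- move=> T lambda T2 l01 linf; have [[r Tr]|Too] : (exists r : R, T = r%:E) \/ T = +oo%E.
    by case: T T2 {linf} => [r|//|//] _; [left; exists r|right].
  + have r2 : 2 <= r by move: T2; rewrite Tr lee_fin.
    have [N [rho [N0 rho02 rE]]] := horizon_decomp r2.
    have [opt uniq] := finite_horizon_optimal data N0 rho02 l01.
    rewrite Tr rE; eexists; first by eexists; exact: opt.
    by move=> v [w]; exact: uniq.
  + have l01' : 0 <= lambda < 1 by case/andP: l01 => -> _; exact: linf.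
    have [opt uniq] := infinite_horizon_optimal data l01'.
    rewrite Too; eexists; first by eexists; exact: opt.
    by move=> v [w]; exact: uniq.
- move=> n u n0 Hopt; have l01 : 0 <= (1 : R) <= 1 by rewrite ler01 lexx.
  have nn : n%:R != 0 :> R by rewrite pnatr_eq0 -lt0n.
  have n1 : 1 <= n%:R :> R by rewrite ler1n.
  have H := even_horizon_control data n0 l01 Hopt.
  have {}H : \forall t \ae (@lebesgue_measure R), 0 < t < 2 -> forall k : nat,
      t + 2 * k%:R <= (2 * n)%:R ->
      u (t + 2 * k%:R) = (-1) ^+ k * (n%:R^-1 * Fdata dy0 y1 (t - 1)).
    apply: ae_impl H => t Ht /[dup] t02 /andP[t0 t2] k tk; rewrite Ht//.
    have kn : (k < n)%N.
      by rewrite -(ltr_nat R); move: tk; rewrite natrM; lra.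
    rewrite !coef_eq1//; last exact: ltnW.
    rewrite exprS -[k.+1]addn1 natrD; by field.
  have H0 : \forall t \ae (@lebesgue_measure R), 0 < t < 2 ->
      u t = n%:R^-1 * Fdata dy0 y1 (t - 1).
    apply: ae_impl H => t Ht /[dup] t02 /andP[t0 t2].
    have := Ht t02 0; rewrite mulr0 addr0 expr0 mul1r => -> //.
    by rewrite natrM; lra.
  split.
    apply: ae_impl2 H H0 => t H1 H2 t02 k tk.
    by rewrite H1// H2.
  apply: ae_impl H0 => t Ht; split=> /andP[t0 t1]; rewrite Ht ?natrM; try (by apply/andP; split; lra).
    by rewrite Fdata_left//; field.
  by rewrite Fdata_right ?ltW//; field.
- move=> n lambda u n0 l01 Hopt; have /andP[l0 l1] := l01.
  have l01' := zE0 _ _ l01; have l01'' := zE1 _ _ l01.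
  have z0 := zlam_lt0 l01; have /andP[z1 _] := zlam_itv l01'.
  split; [by rewrite z1 z0|exact: (L2_Fdata data)|].
  have H := even_horizon_control data n0 l01'' Hopt.
  apply: ae_impl H => t Ht /[dup] t02 /andP[t0 t2] k tk; rewrite Ht//.
  have kn : (k < n)%N.
    by rewrite -(ltr_nat R); move: tk; rewrite natrM; lra.
  rewrite (coef_lt1 l1 (ltnW kn)) (coef_lt1 l1 kn) /fplus /fminus.
  have zn1 := zlam_pow_lt1 l01' n0.
  set z := zlam lambda in z0 z1 zn1 *.
  have zz : z != 0 by rewrite lt_eqF.
  have zk : z ^+ k != 0 by rewrite expf_neq0.
  (* With [m = 2 n - k - 1] all the exponents are sums, and the identity is
     rational in [z], [z ^ k] and [z ^ m]. *)
  have [m mE] : exists m, (2 * n - k)%N = m.+1.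
    have : (0 < 2 * n - k)%N by rewrite subn_gt0 (leq_trans kn)// leq_pmull.
    by case: (2 * n - k)%N => // m _; exists m.
  have nE : (2 * n)%N = (m + k.+1)%N.
    by rewrite addnS -addSn -mE subnK// (leq_trans (ltnW kn))// leq_pmull.
  rewrite subnS mE /=; move: zn1; rewrite nE exprD => zn1.
  have zm : z ^+ m != 0 by rewrite expf_neq0.
  rewrite !exprS; move: zn1; rewrite exprS.
  move: (z ^+ k) (z ^+ m) zk zm => a b a0 b0 zn1.
  have d1 : 1 - b * (z * a) != 0 by rewrite subr_eq0 eq_sym lt_eqF.
  field.
  by rewrite a0 zz b0 d1 -opprB oppr_eq0 d1.
- move=> u w Hu Hw.
  have l0 : 0 <= (0 : R) < 1 by rewrite lexx ltr01.
  have l1 : 0 <= (1 : R) <= 1 by rewrite ler01 lexx.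
  have H1 := infinite_horizon_control data l0 Hu.
  have Hw' : optimal_control ((2 * 1)%:R%:E) 1 y0 y1 w by [].
  have H2 := even_horizon_control data (ltn0Sn 0) l1 Hw'.
  have N02 : \forall t \ae (@lebesgue_measure R), 0 <= t <= 2 -> 0 < t < 2.
    exists [set 0; 2]; split; first by apply: measurableU; exact: measurable_set1.
      exact/countable_lebesgue_measure0/finite_set_countable/finite_set2.
    move=> x /= /not_implyP[/andP[x0 x1]]; rewrite !lt_neqAle x0 x1 !andbT => /negP.
    by rewrite negb_and !negbK => /orP[/eqP <-|/eqP ->]; [left|right].
  apply: ae_impl2 (ae_impl2 (fun t A B => conj A B) H1 H2) N02 => t [A B] C /C t02.
  have t2 : t + 2 * 0%:R <= (2 * 1)%:R by rewrite mulr0 addr0 muln1 ltW//; case/andP: t02.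
  have := B t02 0 t2; have := A t02 0; rewrite mulr0 addr0 => -> ->.
  (* For [T = 2] the chains have the two terms 1 and 0, and for [lambda = 0] the
     root is 0: both controls are [Fdata] itself. *)
  rewrite coef0// coef_ge// expr0 mul1r.
  by rewrite /zlam oppr0 mul0r addr0.
- move=> lambda u l01 Hopt; have l01' := zE0 _ _ l01.
  have H := infinite_horizon_control data l01' Hopt.
  have H0 : \forall t \ae (@lebesgue_measure R), 0 < t < 2 ->
      u t = (1 + zlam lambda) * Fdata dy0 y1 (t - 1).
    apply: ae_impl H => t Ht t02.
    by have := Ht t02 0; rewrite mulr0 addr0 expr0 mul1r.
  split.
    apply: ae_impl H0 => t Ht; split=> /andP[t0 t1]; rewrite Ht; try (by apply/andP; split; lra).
      by rewrite Fdata_left//; field.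
    by rewrite Fdata_right ?ltW//; field.
  by apply: ae_impl2 H H0 => t H1 H2 t02 k _; rewrite H1// H2.
Qed.
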